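(* Let $R$ be a Noetherian commutative ring with non-zero identity and $I$ an ideal of $R$. Let $M$ be a finitely generated $R$-module and $N$ an $R$-module. Then: (i) There is a Grothendieck spectral sequence $$E_2^{p,q}=\mathrm{Ext}^p_R(M,R^qD_I(N))\underset{p}{\Longrightarrow} R^{p+q}D_I(M,N);$$ (ii) for every integer $t\geq 0$, $$\mathrm{Ass}_R(R^tD_I(M,N))\subseteq \Big(\bigcup_{i=1}^t \mathrm{Ass}_R(E_{t+2}^{i,t-i})\Big)\cup \mathrm{Ass}_R(\mathrm{Hom}_R(M,R^tD_I(N))),$$ where $E_{t+2}^{i,t-i}$ are the terms on page $t+2$ of the spectral sequence in (i); (iii) for every integer $t\geq 0$, $$\mathrm{Supp}_R(R^tD_I(M,N))\subseteq \bigcup_{i=0}^t \mathrm{Supp}_R(\mathrm{Ext}^i_R(M,R^{t-i}D_I(N))).$$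
   Context: For $R$-modules $M,N$, the generalized ideal transform is $D_I(M,N)=\varinjlim_n \mathrm{Hom}_R(I^nM,N)$, the transition maps being restriction along $I^{j}M\subseteq I^{i}M$ for $i\le j$; $R^iD_I(M,-)$ denotes the $i$-th right derived functor of $D_I(M,-)$ (so $R^0D_I(M,-)=D_I(M,-)$), and it is isomorphic to $\varinjlim_n \mathrm{Ext}^i_R(I^nM,-)$. The ordinary ideal transform is $D_I(N)=\varinjlim_n\mathrm{Hom}_R(I^n,N)=D_I(R,N)$ and $R^qD_I(N)$ is the value at $N$ of its $q$-th right derived functor. The spectral sequence in (i) is the (first quadrant, cohomological) Grothendieck spectral sequence of the composite of the functors $G=D_I(-)$ followed by $F=\mathrm{Hom}_R(M,-)$, the composite being identified with $D_I(M,-)$ by a natural equivalence $D_I(M,-)\cong\mathrm{Hom}_R(M,D_I(-))$; the differentials on page $r$ are $d_r\colon E_r^{p,q}\to E_r^{p+r,q-r+1}$. *)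

(* Defs.v *)
From HB Require Import structures.
From mathcomp Require Import all_boot all_order all_algebra.
From mathcomp Require Import all_classical prodnormedzmodule ring.

Set Implicit Arguments.
Unset Strict Implicit.
Unset Printing Implicit Defensive.

Import Order.TTheory GRing.Theory Num.Theory.
Local Open Scope ring_scope.
Local Open Scope classical_set_scope.

Record submod (R : comNzRingType) (M : lmodType R) := Submod {
  submod_set :> M -> Prop;
  submod0 : submod_set 0;
  submodZD : forall a x y, submod_set x -> submod_set y ->
    submod_set (a *: x + y) }.

Definition ideal (R : comNzRingType) := submod (R^o : lmodType R).

Section Submodules.
Variables (R : comNzRingType) (M : lmodType R).
Implicit Types (S : submod M) (A : set M).

Lemma submodP S S' : (forall x, S x <-> S' x) -> S = S'.
Proof.
case: S S' => [S S0 SP] [S' S'0 S'P] /= SS'.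
have E : S = S' by apply/funext => x; apply/propext; exact: SS'.
rewrite -{}E in S'0 S'P SS' *.
by congr Submod; exact: Prop_irrelevance.
Qed.

Lemma submodD S x y : S x -> S y -> S (x + y).
Proof. by move=> Sx Sy; rewrite -[x]scale1r; exact: submodZD. Qed.

Lemma submodZ S a x : S x -> S (a *: x).
Proof. by move=> Sx; rewrite -[_ *: _]addr0; apply: submodZD => //; exact: submod0. Qed.

Lemma submodN S x : S x -> S (- x).
Proof. by rewrite -scaleN1r; exact: submodZ. Qed.

Lemma submodB S x y : S x -> S y -> S (x - y).
Proof. by move=> Sx Sy; apply: submodD => //; exact: submodN. Qed.

Definition submod_full : submod M := @Submod R M setT I (fun _ _ _ _ _ => I).

Program Definition submod_zero : submod M := @Submod R M [set 0] _ _.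
Next Obligation. by []. Qed.
Next Obligation. by move=> a x y /= -> ->; rewrite scaler0 addr0. Qed.

Program Definition submod_sum S S' : submod M :=
  @Submod R M [set x | exists y z, [/\ S y, S' z & x = y + z]] _ _.
Next Obligation.
by move=> S S'; exists 0, 0; rewrite addr0; split=> //; exact: submod0.
Qed.
Next Obligation.
move=> S S' a _ _ [y [z [Sy Sz ->]]] [y' [z' [Sy' Sz' ->]]].
exists (a *: y + y'), (a *: z + z'); split; try exact: submodZD.
by rewrite scalerDr addrACA.
Qed.

Program Definition span A : submod M :=
  @Submod R M [set x | forall S, (forall y, A y -> S y) -> S x] _ _.
Next Obligation. by move=> A S _; exact: submod0. Qed.
Next Obligation.
by move=> A a x y Sx Sy S AS; apply: submodZD; [exact: Sx|exact: Sy].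
Qed.

Definition fin_gen_submod S := exists s : seq M, S = span [set` s].

Definition smem S : {pred M} := fun x => `[< S x >].

Lemma smem_submod S : submod_closed (smem S).
Proof.
split=> [|a x y /asboolP Sx /asboolP Sy]; apply/asboolP; first exact: submod0.
exact: submodZD.
Qed.
End Submodules.

HB.instance Definition _ (R : comNzRingType) (M : lmodType R) (S : submod M) :=
  GRing.isSubmodClosed.Build R M (smem S) (smem_submod S).

Definition smod (R : comNzRingType) (M : lmodType R) (S : submod M) : Type :=
  {x : M | x \in smem S}.

Section SubmoduleType.
Variables (R : comNzRingType) (M : lmodType R) (S : submod M).

HB.instance Definition _ := SubChoice.on (smod S).
HB.instance Definition _ := [SubChoice_isSubLmodule of smod S by <:].

Lemma smodP (x : smod S) : S (val x).
Proof. exact/asboolP/(valP x). Qed.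

Definition mk_smod (x : M) (Sx : S x) : smod S := Sub x (introT (asboolP _) Sx).

Lemma mk_smodK x (Sx : S x) : val (mk_smod Sx) = x.
Proof. by []. Qed.
End SubmoduleType.

Definition qmod (R : comNzRingType) (M : lmodType R) (S : submod M) : Type :=
  Quotient.quot (smem S).

Section QuotientType.
Variables (R : comNzRingType) (M : lmodType R) (S : submod M).
Local Open Scope quotient_scope.

HB.instance Definition _ := GRing.Zmodule.on (qmod S).
HB.instance Definition _ := EqQuotient.on (qmod S).

Definition qcls_fun (x : M) : qmod S := \pi_(Quotient.quot (smem S)) x.

Lemma qcls_eq x y : qcls_fun x = qcls_fun y <-> S (x - y).
Proof.
rewrite /qcls_fun; split=> [/eqP|Sxy]; last first.
  by apply/eqP; rewrite -Quotient.idealrBE; exact/asboolP.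
by rewrite -Quotient.idealrBE => /asboolP.
Qed.

Lemma qcls_fun_surj (a : qmod S) : exists x, qcls_fun x = a.
Proof. by exists (repr a); rewrite /qcls_fun reprK. Qed.

Lemma qcls_funD x y : qcls_fun (x + y) = qcls_fun x + qcls_fun y.
Proof. exact: raddfD. Qed.

Definition qscale (a : R) (u : qmod S) : qmod S := qcls_fun (a *: repr u).

Lemma qscaleE a x : qscale a (qcls_fun x) = qcls_fun (a *: x).
Proof.
apply/qcls_eq; rewrite -scalerBr; apply: submodZ; apply/qcls_eq.
by rewrite /qcls_fun reprK.
Qed.

Fact qscaleA a b u : qscale a (qscale b u) = qscale (a * b) u.
Proof. by have [x <-] := qcls_fun_surj u; rewrite !qscaleE scalerA. Qed.
Fact qscale1 : left_id 1 qscale.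
Proof. by move=> u; have [x <-] := qcls_fun_surj u; rewrite qscaleE scale1r. Qed.
Fact qscaleDr : right_distributive qscale +%R.
Proof.
move=> a u v; have [x <-] := qcls_fun_surj u; have [y <-] := qcls_fun_surj v.
by rewrite -qcls_funD !qscaleE scalerDr qcls_funD.
Qed.
Fact qscaleDl u : {morph qscale^~ u : a b / a + b}.
Proof.
move=> a b; have [x <-] := qcls_fun_surj u.
by rewrite !qscaleE scalerDl qcls_funD.
Qed.
HB.instance Definition _ := GRing.Zmodule_isLmodule.Build R (qmod S)
  qscaleA qscale1 qscaleDr qscaleDl.

Fact qcls_linear : linear qcls_fun.
Proof. by move=> a x y; rewrite qcls_funD -qscaleE. Qed.
HB.instance Definition _ := GRing.isLinear.Build R M (qmod S) *:%R qcls_fun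
  qcls_linear.
End QuotientType.

Definition qcls (R : comNzRingType) (M : lmodType R) (S : submod M) :
  {linear M -> qmod S} := @qcls_fun R M S.

Section LinearSubmodules.
Variables (R : comNzRingType) (M M' : lmodType R).
Implicit Types (f : {linear M -> M'}).

Program Definition ker f : submod M := @Submod R M (fun x => f x = 0) _ _.
Next Obligation. by move=> f /=; rewrite raddf0. Qed.
Next Obligation. by move=> f a x y /= fx fy; rewrite linearP fx fy scaler0 addr0. Qed.

Program Definition image f (S : submod M) : submod M' :=
  @Submod R M' (fun y => exists2 x, S x & y = f x) _ _.
Next Obligation. by move=> f S; exists 0; [exact: submod0|rewrite raddf0]. Qed.
Next Obligation.
move=> f S a _ _ [x Sx ->] [y Sy ->]; exists (a *: x + y); first exact: submodZD.
by rewrite linearP.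
Qed.

Program Definition preimage f (S : submod M') : submod M :=
  @Submod R M (fun x => S (f x)) _ _.
Next Obligation. by move=> f S /=; rewrite raddf0; exact: submod0. Qed.
Next Obligation. by move=> f S a x y /= Sx Sy; rewrite linearP; exact: submodZD. Qed.

Definition range f := image f (submod_full M).
End LinearSubmodules.

Definition smod_incl (R : comNzRingType) (M : lmodType R) (S : submod M) :
  {linear smod S -> M} := val.

(* Z / (Z :&: B); the usual subquotient Z / B when B is contained in Z *)
Definition subquot (R : comNzRingType) (M : lmodType R) (Z B : submod M) :
  lmodType R := qmod (preimage (smod_incl Z) B).

Definition sqcls (R : comNzRingType) (M : lmodType R) (Z B : submod M) :
  {linear smod Z -> subquot Z B} := qcls (preimage (smod_incl Z) B).

Section SubquotTheory.
Variables (R : comNzRingType) (M : lmodType R) (Z B : submod M).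

Lemma sqcls_surj (u : subquot Z B) : exists x, sqcls Z B x = u.
Proof. exact: qcls_fun_surj. Qed.

Lemma sqclsP x y : sqcls Z B x = sqcls Z B y <-> B (val x - val y).
Proof. exact: qcls_eq. Qed.

Lemma sqcls_eq0 x : sqcls Z B x = 0 <-> B (val x).
Proof. by rewrite -[0](raddf0 (sqcls Z B)) sqclsP subr0. Qed.
End SubquotTheory.

Section SubquotMap.
Variables (R : comNzRingType) (M M' : lmodType R) (f : {linear M -> M'}).
Variables (Z B : submod M) (Z' B' : submod M').
Hypothesis fZ : forall x, Z x -> Z' (f x).
Hypothesis fB : forall x, B x -> B' (f x).

Definition smap_fun (x : smod Z) : smod Z' := mk_smod (fZ (smodP x)).
Fact smap_linear : linear smap_fun.
Proof. by move=> a x y; apply: val_inj => /=; rewrite linearP. Qed.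
HB.instance Definition _ := GRing.isLinear.Build R (smod Z) (smod Z') *:%R
  smap_fun smap_linear.
Definition smap : {linear smod Z -> smod Z'} := smap_fun.

Definition sqmap_fun (u : subquot Z B) : subquot Z' B' :=
  sqcls Z' B' (smap (repr u)).

Lemma sqmap_funE x : sqmap_fun (sqcls Z B x) = sqcls Z' B' (smap x).
Proof.
apply/qcls_eq; rewrite -linearB; apply: fB.
by apply/(qcls_eq (preimage (smod_incl Z) B)); rewrite /qcls_fun reprK.
Qed.

Fact sqmap_linear : linear sqmap_fun.
Proof.
move=> a u v; have [x <-] := sqcls_surj u; have [y <-] := sqcls_surj v.
by rewrite -linearP !sqmap_funE -!linearP.
Qed.
HB.instance Definition _ := GRing.isLinear.Build R (subquot Z B) (subquot Z' B')
  *:%R sqmap_fun sqmap_linear.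
Definition sqmap : {linear subquot Z B -> subquot Z' B'} := sqmap_fun.

Lemma sqmapE x : sqmap (sqcls Z B x) = sqcls Z' B' (smap x).
Proof. exact: sqmap_funE. Qed.
End SubquotMap.

Section HomModule.
Variables (R : comNzRingType) (U V : lmodType R).
Implicit Types f g h : {linear U -> V}.

Lemma lin_eq f g : f =1 g -> f = g.
Proof.
case: f g => [f cf] [g cg] /= /funext fg; rewrite -{}fg in cg *.
case: cf cg => [[p] [q]] [[p'] [q']].
by congr GRing.Linear.Pack; congr GRing.Linear.Class; congr (_ _); exact: Prop_irrelevance.
Qed.

Definition hom0 : {linear U -> V} := \0.
Definition homN f : {linear U -> V} := \- f.
Definition homD f g : {linear U -> V} := f \+ g.
Definition homZ a f : {linear U -> V} := a \*: f.

Fact homA : associative homD.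
Proof. by move=> f g h; apply: lin_eq => x /=; rewrite addrA. Qed.
Fact homC : commutative homD.
Proof. by move=> f g; apply: lin_eq => x /=; rewrite addrC. Qed.
Fact hom0D : left_id hom0 homD.
Proof. by move=> f; apply: lin_eq => x /=; rewrite add0r. Qed.
Fact homND : left_inverse hom0 homN homD.
Proof. by move=> f; apply: lin_eq => x /=; rewrite addNr. Qed.
HB.instance Definition _ :=
  GRing.isZmodule.Build {linear U -> V} homA homC hom0D homND.

Fact homZA a b f : homZ a (homZ b f) = homZ (a * b) f.
Proof. by apply: lin_eq => x /=; rewrite scalerA. Qed.
Fact homZ1 : left_id 1 homZ.
Proof. by move=> f; apply: lin_eq => x /=; rewrite scale1r. Qed.
Fact homZDr : right_distributive homZ +%R.
Proof. by move=> a f g; apply: lin_eq => x /=; rewrite scalerDr. Qed.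
Fact homZDl f : {morph homZ^~ f : a b / a + b}.
Proof. by move=> a b; apply: lin_eq => x /=; rewrite scalerDl. Qed.
HB.instance Definition _ := GRing.Zmodule_isLmodule.Build R {linear U -> V}
  homZA homZ1 homZDr homZDl.

Lemma homDE f g x : (f + g) x = f x + g x. Proof. by []. Qed.
Lemma homZE a f x : (a *: f) x = a *: f x. Proof. by []. Qed.
End HomModule.

Definition homod (R : comNzRingType) (U V : lmodType R) : lmodType R :=
  {linear U -> V}.

Section HomFunctoriality.
Variables (R : comNzRingType) (U U' V V' : lmodType R).

Definition homl_fun (f : {linear U' -> U}) (g : homod U V) : homod U' V := g \o f.
Fact homl_linear f : linear (homl_fun f).
Proof. by move=> a g h; apply: lin_eq. Qed.
HB.instance Definition _ f := GRing.isLinear.Build R (homod U V) (homod U' V)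
  *:%R (homl_fun f) (homl_linear f).
Definition homl f : {linear homod U V -> homod U' V} := homl_fun f.

Definition homr_fun (f : {linear V -> V'}) (g : homod U V) : homod U V' := f \o g.
Fact homr_linear f : linear (homr_fun f).
Proof. by move=> a g h; apply: lin_eq => x /=; rewrite linearP. Qed.
HB.instance Definition _ f := GRing.isLinear.Build R (homod U V) (homod U V')
  *:%R (homr_fun f) (homr_linear f).
Definition homr f : {linear homod U V -> homod U V'} := homr_fun f.
End HomFunctoriality.

Definition dprod (R : comNzRingType) (T : Type) (X : T -> lmodType R) : Type :=
  forall i, X i.

Section Product.
Variables (R : comNzRingType) (T : Type) (X : T -> lmodType R).
Implicit Types x y z : dprod X.

HB.instance Definition _ := gen_eqMixin (dprod X).
HB.instance Definition _ := gen_choiceMixin (dprod X).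

Definition dprodD x y : dprod X := fun i => x i + y i.
Definition dprodN x : dprod X := fun i => - x i.
Definition dprod0 : dprod X := fun i => 0.
Definition dprodZ a x : dprod X := fun i => a *: x i.
Fact dprodA : associative dprodD.
Proof. by move=> x y z; apply: functional_extensionality_dep => i; exact: addrA. Qed.
Fact dprodC : commutative dprodD.
Proof. by move=> x y; apply: functional_extensionality_dep => i; exact: addrC. Qed.
Fact dprod0D : left_id dprod0 dprodD.
Proof. by move=> x; apply: functional_extensionality_dep => i; exact: add0r. Qed.
Fact dprodND : left_inverse dprod0 dprodN dprodD.
Proof. by move=> x; apply: functional_extensionality_dep => i; exact: addNr. Qed.
HB.instance Definition _ :=
  GRing.isZmodule.Build (dprod X) dprodA dprodC dprod0D dprodND.
Fact dprodZA a b x : dprodZ a (dprodZ b x) = dprodZ (a * b) x.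
Proof. by apply: functional_extensionality_dep => i; exact: scalerA. Qed.
Fact dprodZ1 : left_id 1 dprodZ.
Proof. by move=> x; apply: functional_extensionality_dep => i; exact: scale1r. Qed.
Fact dprodZDr : right_distributive dprodZ +%R.
Proof. by move=> a x y; apply: functional_extensionality_dep => i; exact: scalerDr. Qed.
Fact dprodZDl x : {morph dprodZ^~ x : a b / a + b}.
Proof. by move=> a b; apply: functional_extensionality_dep => i; exact: scalerDl. Qed.
HB.instance Definition _ := GRing.Zmodule_isLmodule.Build R (dprod X)
  dprodZA dprodZ1 dprodZDr dprodZDl.
End Product.

Record functor (R : comNzRingType) := Functor {
  fobj :> lmodType R -> lmodType R;
  fmap : forall A B : lmodType R, {linear A -> B} -> {linear fobj A -> fobj B};
  fmap_id : forall (A : lmodType R) x, fmap (idfun : {linear A -> A}) x = x;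
  fmap_comp : forall (A B C : lmodType R) (g : {linear B -> C})
    (f : {linear A -> B}) x, fmap (g \o f) x = fmap g (fmap f x);
  fmapD : forall (A B : lmodType R) (f g : {linear A -> B}),
    fmap (f + g) = fmap f + fmap g }.

Section Functors.
Variable R : comNzRingType.

Lemma fmap0 (F : functor R) (A B : lmodType R) (f : {linear A -> B}) :
  (forall x, f x = 0) -> forall x, fmap F f x = 0.
Proof.
move=> f0 x; have -> : f = 0 by apply: lin_eq => y; rewrite f0.
have /eqP := fmapD F (0 : {linear A -> B}) 0.
by rewrite addr0 -{1}[fmap F 0]addr0 (inj_eq (addrI _)) eq_sym => /eqP ->.
Qed.

Definition fcomp (F G : functor R) : functor R.
Proof.
apply: (@Functor R (fun A => F (G A)) (fun A B f => fmap F (fmap G f))).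
- move=> A x; have -> : fmap G (idfun : {linear A -> A}) = idfun.
    by apply: lin_eq => y; rewrite fmap_id.
  by rewrite fmap_id.
- move=> A B C g f x; rewrite -fmap_comp; congr (fmap F _ x).
  by apply: lin_eq => y; rewrite fmap_comp.
- by move=> A B f g; rewrite !fmapD.
Defined.

Definition homF (M : lmodType R) : functor R.
Proof.
apply: (@Functor R (fun N => homod M N) (fun A B f => homr M f)).
- by move=> A f; apply: lin_eq.
- by move=> A B C g f x; apply: lin_eq.
- by move=> A B f g; apply: lin_eq => h; apply: lin_eq.
Defined.

Definition iso (A B : lmodType R) := exists f : {linear A -> B}, bijective f.

Definition natural_equivalence (F G : functor R)
    (t : forall A, {linear F A -> G A}) :=
  (forall A, bijective (t A)) /\
  (forall (A B : lmodType R) (f : {linear A -> B}) x,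
     t B (fmap F f x) = fmap G f (t A x)).
End Functors.

Record dirsys (R : comNzRingType) := Dirsys {
  ds_obj :> nat -> lmodType R;
  ds_map : forall i j, (i <= j)%N -> {linear ds_obj i -> ds_obj j};
  ds_map_id : forall i (h : (i <= i)%N) x, ds_map h x = x;
  ds_map_comp : forall i j k (h : (i <= j)%N) (h' : (j <= k)%N)
    (h'' : (i <= k)%N) x, ds_map h'' x = ds_map h' (ds_map h x) }.

Arguments ds_map {R d i j}.
Arguments ds_map_comp {R d i j k}.

Section DirectLimit.
Variables (R : comNzRingType) (X : dirsys R).

Program Definition dl_threads : submod (dprod X) := @Submod R (dprod X)
  (fun x => exists n, forall i j (h : (i <= j)%N), (n <= i)%N ->
     x j = ds_map h (x i)) _ _.
Next Obligation. by exists 0%N => i j h _; rewrite raddf0. Qed.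
Next Obligation.
move=> a x y /= [n xn] [m ym]; exists (maxn n m) => i j h.
rewrite geq_max => /andP[ni mi].
by rewrite linearP -(xn _ _ _ ni) -(ym _ _ _ mi).
Qed.

Program Definition dl_null : submod (dprod X) := @Submod R (dprod X)
  (fun x => exists n, forall i, (n <= i)%N -> x i = 0) _ _.
Next Obligation. by exists 0%N. Qed.
Next Obligation.
move=> a x y /= [n xn] [m ym]; exists (maxn n m) => i.
rewrite geq_max => /andP[ni mi].
by rewrite -[LHS]/(a *: x i + y i) xn // ym // scaler0 addr0.
Qed.

(* The direct limit as the module of germs at infinity of threads
   (families that are eventually compatible with the transition maps).
   [dlim_in_comp], [dlim_surj] and [dlim_inP] characterize it, up to a unique
   isomorphism, as the direct limit. *)
Definition dlim : lmodType R := subquot dl_threads dl_null.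

Definition dl_thread n (x : X n) : dprod X :=
  fun k => if pselect (n <= k)%N is left h then ds_map h x else 0.

Lemma dl_threadE n (x : X n) k (h : (n <= k)%N) : dl_thread x k = ds_map h x.
Proof.
rewrite /dl_thread; case: pselect => [h'|] //.
by rewrite (bool_irrelevance h h').
Qed.

Fact dl_threadP n (x : X n) : dl_threads (dl_thread x).
Proof.
exists n => i j ij ni.
by rewrite (dl_threadE _ ni) (dl_threadE _ (leq_trans ni ij)); exact: ds_map_comp.
Qed.

Definition dlim_in_fun n (x : X n) : dlim :=
  sqcls dl_threads dl_null (mk_smod (dl_threadP x)).

Fact dlim_in_linear n : linear (@dlim_in_fun n).
Proof.
move=> a x y; rewrite /dlim_in_fun -linearP; congr (_ _); apply: val_inj => /=.
apply: functional_extensionality_dep => k.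
rewrite -[RHS]/(a *: dl_thread x k + dl_thread y k) /dl_thread.
by case: pselect => h; rewrite ?linearP // scaler0 addr0.
Qed.
HB.instance Definition _ n := GRing.isLinear.Build R (X n) dlim *:%R
  (@dlim_in_fun n) (@dlim_in_linear n).
Definition dlim_in n : {linear X n -> dlim} := @dlim_in_fun n.

Lemma dlim_inE n (x : X n) :
  dlim_in n x = sqcls dl_threads dl_null (mk_smod (dl_threadP x)).
Proof. by []. Qed.

Lemma dlim_surj (u : dlim) : exists n (x : X n), dlim_in n x = u.
Proof.
have [x <-] := sqcls_surj u; have [n xn] := smodP x.
exists n, (val x n); rewrite dlim_inE; apply/sqclsP.
exists n => i ni.
by rewrite -[LHS]/(dl_thread (val x n) i - val x i) (dl_threadE _ ni) -xn // subrr.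
Qed.

Lemma dlim_inP n (x : X n) :
  dlim_in n x = 0 <-> exists m (h : (n <= m)%N), ds_map h x = 0.
Proof.
rewrite dlim_inE; split=> [/sqcls_eq0[m xm]|[m [h xm]]].
  exists (maxn n m), (leq_maxl n m); have := xm _ (leq_maxr n m).
  by rewrite /= (dl_threadE _ (leq_maxl n m)).
apply/sqcls_eq0; exists m => i mi; have h' := leq_trans h mi.
by rewrite /= (dl_threadE _ h') (ds_map_comp h mi) xm raddf0.
Qed.

Lemma dlim_in_comp n m (h : (n <= m)%N) x : dlim_in m (ds_map h x) = dlim_in n x.
Proof.
rewrite !dlim_inE; apply/sqclsP; exists m => i mi; have h' := leq_trans h mi.
by rewrite -[LHS]/(dl_thread (ds_map h x) i - dl_thread x i)
  (dl_threadE _ mi) (dl_threadE _ h') -ds_map_comp subrr.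
Qed.
End DirectLimit.

Section DirectLimitMap.
Variables (R : comNzRingType) (X Y : dirsys R).
Variable f : forall n, {linear X n -> Y n}.
Hypothesis fP : forall i j (h : (i <= j)%N) x, f j (ds_map h x) = ds_map h (f i x).

Definition dprod_map (x : dprod X) : dprod Y := fun n => f n (x n).
Fact dprod_map_linear : linear dprod_map.
Proof.
move=> a x y; apply: functional_extensionality_dep => n.
by rewrite -[RHS]/(a *: f n (x n) + f n (y n)) -linearP.
Qed.
HB.instance Definition _ := GRing.isLinear.Build R (dprod X) (dprod Y) *:%R
  dprod_map dprod_map_linear.

Fact dprod_map_threads x : dl_threads X x -> dl_threads Y (dprod_map x).
Proof. by move=> [n xn]; exists n => i j h ni; rewrite /dprod_map -fP -xn. Qed.
Fact dprod_map_null x : dl_null X x -> dl_null Y (dprod_map x).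
Proof. by move=> [n xn]; exists n => i ni; rewrite /dprod_map xn // raddf0. Qed.

Definition dlim_map : {linear dlim X -> dlim Y} :=
  sqmap dprod_map_threads dprod_map_null.

Lemma dlim_mapE n x : dlim_map (dlim_in X n x) = dlim_in Y n (f n x).
Proof.
rewrite /dlim_map !dlim_inE sqmapE; apply/sqclsP; exists n => i ni.
rewrite -[LHS]/(f i (dl_thread x i) - dl_thread (f n x) i).
by rewrite !(dl_threadE _ ni) fP subrr.
Qed.
End DirectLimitMap.

Section IdealTransform.
Variable R : comNzRingType.
Implicit Types (I : ideal R) (M N : lmodType R).

(* I S, the submodule generated by the products of elements of I and S *)
Definition ideal_mul I M (S : submod M) : submod M :=
  span [set z | exists (a : R) (x : M), [/\ I a, S x & z = a *: x]].

Fixpoint ideal_pow I n : ideal R :=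
  if n is m.+1 then ideal_mul I (ideal_pow I m) else submod_full (R^o : lmodType R).

Definition ideal_pow_mul I n M : submod M := ideal_mul (ideal_pow I n) (submod_full M).

Lemma span_mono M (A B : set M) : (forall x, A x -> B x) ->
  forall x, span A x -> span B x.
Proof. by move=> AB x Ax S BS; apply: Ax => y /AB; exact: BS. Qed.

Lemma ideal_pow_anti I i j : (i <= j)%N -> forall x, ideal_pow I j x -> ideal_pow I i x.
Proof.
have mulS (K J : ideal R) x : ideal_mul K J x -> J x.
  by apply=> _ [a [y [_ Jy ->]]]; exact: submodZ.
move=> /subnK <-; elim: (j - i)%N => [|k IHk] x //= /mulS; exact: IHk.
Qed.

Lemma ideal_pow_mul_anti I M i j : (i <= j)%N ->
  forall x, ideal_pow_mul I j M x -> ideal_pow_mul I i M x.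
Proof.
move=> ij; apply: span_mono => z [a [x [Ia Sx ->]]].
by exists a, x; split=> //; exact: ideal_pow_anti Ia.
Qed.

Definition it_incl I M i j (h : (i <= j)%N) :
    {linear smod (ideal_pow_mul I j M) -> smod (ideal_pow_mul I i M)} :=
  smap (f := idfun) (ideal_pow_mul_anti (I := I) (M := M) h).

Definition it_sys I M N : dirsys R.
Proof.
apply: (@Dirsys R (fun n => homod (smod (ideal_pow_mul I n M)) N)
  (fun i j h => homl N (it_incl I M h))).
- by move=> i h f; apply: lin_eq => x /=; congr (f _); apply: val_inj.
- by move=> i j k h h' h'' f; apply: lin_eq => x /=; congr (f _); apply: val_inj.
Defined.

Definition git_dirsys_map_comm I M N N' (f : {linear N -> N'}) i j
    (h : (i <= j)%N) (x : it_sys I M N i) :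
  homr _ f (ds_map h x) = ds_map (d := it_sys I M N') h (homr _ f x).
Proof. exact: lin_eq. Qed.

Definition gen_ideal_transform_map I M N N' (f : {linear N -> N'}) :
    {linear dlim (it_sys I M N) -> dlim (it_sys I M N')} :=
  dlim_map (X := it_sys I M N) (Y := it_sys I M N')
    (git_dirsys_map_comm (M := M) f).

Lemma gen_ideal_transform_mapE I M N N' (f : {linear N -> N'}) n
    (x : it_sys I M N n) :
  gen_ideal_transform_map I M f (dlim_in _ n x) = dlim_in (it_sys I M N') n (homr _ f x).
Proof. exact: dlim_mapE. Qed.

Definition gen_ideal_transform I M : functor R.
Proof.
apply: (@Functor R (fun N => dlim (it_sys I M N))
  (fun N N' f => gen_ideal_transform_map I M f)).
- move=> A u; have [n [x <-]] := dlim_surj u.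
  by rewrite gen_ideal_transform_mapE; congr (dlim_in _ _ _); apply: lin_eq.
- move=> A B C g f u; have [n [x <-]] := dlim_surj u.
  by rewrite !gen_ideal_transform_mapE; congr (dlim_in _ _ _); apply: lin_eq.
- move=> A B f g; apply: lin_eq => u; have [n [x <-]] := dlim_surj u.
  rewrite homDE !gen_ideal_transform_mapE -linearD.
  by congr (dlim_in _ _ _); apply: lin_eq.
Defined.

(* D_I(N) = D_I(R, N) *)
Definition ideal_transform I : functor R := gen_ideal_transform I (R^o).
End IdealTransform.

Definition injective_mod (R : comNzRingType) (E : lmodType R) :=
  forall (A B : lmodType R) (i : {linear A -> B}) (f : {linear A -> E}),
    injective i -> exists g : {linear B -> E}, forall a, g (i a) = f a.

(* Every module embeds in an injective one: the group Q/Z is divisible, hence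
   injective over Z, so that the R-modules Hom_Z(R, Q/Z)^K are injective. *)
Definition rat_int : {pred rat} := fun x => x \is a Num.int.
Fact rat_int_zmod : zmod_closed rat_int.
Proof.
split=> [|x y]; rewrite !unfold_in; first exact: rpred0.
exact: rpredB.
Qed.
HB.instance Definition _ := GRing.isZmodClosed.Build rat rat_int rat_int_zmod.

Definition QZ : Type := Quotient.quot rat_int.
HB.instance Definition _ := GRing.Zmodule.on QZ.

Section QmodZ.
Let cls (x : rat) : QZ := \pi_(Quotient.quot rat_int)%qT x.

Let clsM x n : cls (x *+ n) = cls x *+ n. Proof. exact: raddfMn. Qed.

Let cls_eq0 x : (cls x == 0) = (x \is a Num.int).
Proof.
have <- : cls 0 = 0 by exact: raddf0.
by rewrite /cls -Quotient.idealrBE subr0.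
Qed.

Lemma QZ_divisible (u : QZ) n : exists v : QZ, v *+ n.+1 = u.
Proof.
have [x <-] : exists x, cls x = u by exists (repr u); rewrite /cls reprK.
exists (cls (x / n.+1%:R)).
by rewrite -clsM -(mulr_natr (x / _)) divfK // pnatr_eq0.
Qed.

Lemma QZ_torsion n : exists2 u : QZ, u != 0 & u *+ n.+2 = 0.
Proof.
exists (cls (n.+2%:R^-1)).
  rewrite cls_eq0; apply/negP => /norm_intr_ge1.
  rewrite invr_eq0 pnatr_eq0 ger0_norm ?invr_ge0 ?ler0n // => /(_ isT).
  by rewrite invr_ge1 ?unitfE ?pnatr_eq0 ?ltr0n // lern1.
by rewrite -clsM -(mulr_natr (_^-1)) mulVf ?pnatr_eq0 //; apply/eqP; rewrite cls_eq0.
Qed.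
End QmodZ.

Section ExtendCharacter.
Variable B : zmodType.
Implicit Types (G : set (B * QZ)).

Definition partial_char G :=
  (forall x y d e, G (x, d) -> G (y, e) -> G (x - y, d - e)) /\
  (forall d, G (0, d) -> d = 0).

Section PartialChar.
Variable G : set (B * QZ).
Hypotheses (GP : partial_char G) (G00 : G (0, 0)).

Lemma pcharN x d : G (x, d) -> G (- x, - d).
Proof. by rewrite -[- x]add0r -[- d]add0r; exact: GP.1. Qed.

Lemma pcharD x y d e : G (x, d) -> G (y, e) -> G (x + y, d + e).
Proof.
by move=> Gx /pcharN Gy; have := GP.1 _ _ _ _ Gx Gy; rewrite !opprK.
Qed.

Lemma pcharM x d k : G (x, d) -> G (x *+ k, d *+ k).
Proof.
move=> Gx; elim: k => [|k IHk]; first by rewrite !mulr0n.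
by rewrite !mulrS; exact: pcharD.
Qed.

Lemma pcharZ x d (k : int) : G (x, d) -> G (x *~ k, d *~ k).
Proof.
move=> Gx; case: k => k; first by rewrite -!pmulrn; exact: pcharM.
by rewrite NegzE !mulrNz -!pmulrn; apply: pcharN; exact: pcharM.
Qed.

Lemma pchar_fun x d e : G (x, d) -> G (x, e) -> d = e.
Proof.
move=> Gd Ge; apply/eqP; rewrite -subr_eq0; apply/eqP/GP.2.
by rewrite -(subrr x); exact: GP.1.
Qed.

Lemma pchar_extend1 b : exists d0 : QZ,
  forall (k : int) e, G (b *~ k, e) -> e = d0 *~ k.
Proof.
have [[n [e Gn]]|noG] := pselect (exists n e, G (b *+ n.+1, e)); last first.
  exists 0 => k e Gk; rewrite mul0rz.
  have [k0|k0] := eqVneq k 0; first by apply: GP.2; rewrite k0 in Gk.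
  exfalso; apply: noG; exists `|k|%N.-1; rewrite prednK ?absz_gt0 //.
  have := pcharZ (sgz k) Gk; rewrite -mulrzA mulrC -abszEsg -pmulrn => Gk'.
  by exists (e *~ sgz k).
have exn : exists m, `[< exists e, G (b *+ m.+1, e) >].
  by exists n; apply/asboolP; exists e.
case: (ex_minnP exn) => m /asboolP[c Gm] minm.
have [d0 d0m] := QZ_divisible c m; exists d0 => k e' Gk.
have [q [r [kE r0 rm]]] :
    exists q r : int, [/\ k = q * m.+1%:Z + r, 0 <= r & r < m.+1%:Z].
  exists (k %/ m.+1%:Z)%Z, (k %% m.+1%:Z)%Z; split; first exact: divz_eq.
    exact: modz_ge0.
  exact: ltz_pmod.
have Gr : G (b *~ r, e' - c *~ q).
  have -> : b *~ r = b *~ k - (b *+ m.+1) *~ q.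
    by rewrite kE mulrzDr pmulrn -mulrzA [_ * q]mulrC addrAC subrr add0r.
  exact: (GP.1 _ _ _ _ Gk (pcharZ q Gm)).
have rE : r = 0.
  apply/eqP; apply/negPn/negP => rn0.
  have r1 : (0 < `|r|)%N by rewrite absz_gt0.
  have rabs : r = `|r|%N :> int by rewrite gez0_abs.
  have : (m <= `|r|.-1)%N.
    apply: minm; apply/asboolP; exists (e' - c *~ q).
    by rewrite prednK // pmulrn -rabs.
  rewrite -ltnS prednK // leqNgt => /negP; apply.
  by rewrite -ltz_nat -rabs.
rewrite rE mulr0z in Gr; have /eqP := GP.2 _ Gr; rewrite subr_eq0 => /eqP ->.
by rewrite kE rE addr0 -d0m pmulrn -mulrzA mulrC.
Qed.
End PartialChar.

Lemma extend_char G : partial_char G -> G (0, 0) ->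
  exists2 h : B -> QZ, zmod_morphism h & forall x d, G (x, d) -> h x = d.
Proof.
move=> GP G00.
pose P : set (set (B * QZ)) :=
  [set H | partial_char H /\ ((exists z, H z) -> G `<=` H)].
have [|H [[HP GH] Hmax]] := @Zorn_bigcup _ P.
  move=> F FP Ftot; split; first split.
  - move=> x y d e [X FX Xx] [Y FY Yy].
    have [XY|YX] := Ftot _ _ FX FY.
      by exists Y => //; apply: (FP _ FY).1.1 => //; exact: XY.
    by exists X => //; apply: (FP _ FX).1.1 => //; exact: YX.
  - by move=> d [X FX Xd]; exact: (FP _ FX).1.2.
  move=> [z [X FX Xz]] w Gw; exists X => //.
  by apply: (FP _ FX).2 => //; exists z.
have {}GH : G `<=` H.
  apply: contrapT => nGH.
  have H0 z : ~ H z by move=> Hz; apply: nGH; apply: GH; exists z.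
  apply: (Hmax G); last by split=> // _ w.
  by split=> [z /H0|GsubH] //; exact: (H0 _ (GsubH _ G00)).
have H00 := GH _ G00.
have tot b : exists d, H (b, d).
  apply: contrapT => nb.
  have [d0 d0P] := pchar_extend1 HP H00 b.
  pose K : set (B * QZ) := [set z | exists x d (k : int),
    H (x, d) /\ z = (x + b *~ k, d + d0 *~ k)].
  have HK : H `<=` K.
    by move=> [x d] Hx; exists x, d, 0; rewrite !mulr0z !addr0.
  apply: (Hmax K).
    split=> // KH; apply: nb; exists d0; apply: KH.
    by exists 0, 0, 1; rewrite !add0r.
  split; last by move=> _; exact: subset_trans GH HK.
  split.
    move=> _ _ _ _ [x [d [k [Hx [-> ->]]]]] [y [e [l [Hy [-> ->]]]]].
    exists (x - y), (d - e), (k - l); split; first exact: HP.1.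
    by rewrite !mulrzBr !opprD !addrA; congr (_, _); rewrite -!addrA;
      congr (_ + _); rewrite addrCA.
  move=> _ [x [d [k [Hx [x0 ->]]]]].
  have xE : b *~ k = - x by apply/eqP; rewrite -addr_eq0 addrC -x0.
  have := d0P k (- d); rewrite xE => /(_ (pcharN HP H00 Hx)) <-.
  by rewrite subrr.
have [h hP] := choice tot; exists h.
  by move=> x y; apply: (pchar_fun HP) (hP _) _; exact: HP.1.
by move=> x d /GH Hx; exact: (pchar_fun HP).
Qed.

Lemma char_separates (b : B) : b != 0 ->
  exists2 h : B -> QZ, zmod_morphism h & h b != 0.
Proof.
move=> b0.
have [d d0 dP] : exists2 d : QZ, d != 0 & forall k : int, b *~ k = 0 -> d *~ k = 0.
  have [[n bn]|nb] := pselect (exists n, b *+ n.+1 = 0); last first.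
    have [d d0 _] := QZ_torsion 0; exists d => // k bk.
    have [->|k0] := eqVneq k 0; first by rewrite mulr0z.
    exfalso; apply: nb; exists `|k|%N.-1; rewrite prednK ?absz_gt0 //.
    by rewrite pmulrn abszEsg mulrC mulrzA bk mul0rz.
  have exn : exists m, b *+ m.+1 == 0 by exists n; exact/eqP.
  case: (ex_minnP exn) => -[|m] /eqP bm minm.
    by rewrite mulr1n in bm; rewrite bm eqxx in b0.
  have [d d0 dm] := QZ_torsion m; exists d => // k bk.
  have [q [r [kE r0 rm]]] :
      exists q r : int, [/\ k = q * m.+2%:Z + r, 0 <= r & r < m.+2%:Z].
    exists (k %/ m.+2%:Z)%Z, (k %% m.+2%:Z)%Z; split; first exact: divz_eq.
      exact: modz_ge0.
    exact: ltz_pmod.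
  have br : b *~ r = 0.
    move: bk; rewrite kE mulrzDr [q * _]mulrC mulrzA -pmulrn bm mul0rz.
    by rewrite add0r.
  have rE : r = 0.
    apply/eqP; apply/negPn/negP => rn0.
    have r1 : (0 < `|r|)%N by rewrite absz_gt0.
    have rabs : r = `|r|%N :> int by rewrite gez0_abs.
    have : (m.+1 <= `|r|.-1)%N.
      by apply: minm; rewrite prednK // pmulrn -rabs br.
    rewrite -ltnS prednK // leqNgt => /negP; apply.
    by rewrite -ltz_nat -rabs.
  by rewrite kE rE addr0 mulrC mulrzA -pmulrn dm mul0rz.
pose G : set (B * QZ) := [set z | exists k : int, z = (b *~ k, d *~ k)].
have GP : partial_char G.
  split=> [_ _ _ _ [k [-> ->]] [l [-> ->]]|_ [k [/esym bk ->]]].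
    by exists (k - l); rewrite !mulrzBr.
  exact: dP.
have [|h hM hG] := extend_char GP; first by exists 0; rewrite !mulr0z.
by exists h => //; rewrite (hG b d) //; exists 1.
Qed.
End ExtendCharacter.

Lemma zmod_morphism_add (U V : zmodType) (h : U -> V) : zmod_morphism h ->
  {morph h : x y / x + y}.
Proof.
move=> hB x y; have h0 : h 0 = 0 by rewrite -[X in h X](subrr 0) hB subrr.
by rewrite -{1}[y]opprK hB -[- y]sub0r hB h0 sub0r opprK.
Qed.

(* The functions F : K -> R -> Q/Z with every F k additive, R acting by
   (a F) k r = F k (a r) *)
Definition cofree (R : comNzRingType) (K : Type) : Type :=
  {F : K -> R -> QZ | `[< forall k, zmod_morphism (F k) >]}.

Section Cofree.
Variables (R : comNzRingType) (K : Type).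
Implicit Types F G : cofree R K.

HB.instance Definition _ := gen_eqMixin (cofree R K).
HB.instance Definition _ := gen_choiceMixin (cofree R K).

Lemma cofreeP F k : zmod_morphism (sval F k).
Proof. by case: F => F /= /asboolP. Qed.

Definition mk_cofree (F : K -> R -> QZ) (FP : forall k, zmod_morphism (F k)) :
  cofree R K := exist _ F (introT (asboolP _) FP).

Lemma cofree_eq F G : (forall k r, sval F k r = sval G k r) -> F = G.
Proof.
case: F G => [F FP] [G GP] /= FG; apply: eq_exist; apply/funext => k; apply/funext => r; exact: FG.
Qed.

Fact cofree0P k : zmod_morphism ((fun (_ : K) (_ : R) => 0 : QZ) k).
Proof. by move=> x y; rewrite subr0. Qed.
Fact cofreeNP F k : zmod_morphism ((fun k r => - sval F k r) k).
Proof. by move=> x y /=; rewrite cofreeP opprB opprK addrC. Qed.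
Fact cofreeDP F G k : zmod_morphism ((fun k r => sval F k r + sval G k r) k).
Proof. by move=> x y /=; rewrite !cofreeP opprD addrACA. Qed.
Fact cofreeZP a F k : zmod_morphism ((fun k r => sval F k (a * r)) k).
Proof. by move=> x y /=; rewrite mulrBr cofreeP. Qed.

Definition cofree0 := mk_cofree cofree0P.
Definition cofreeN F := mk_cofree (cofreeNP F).
Definition cofreeD F G := mk_cofree (cofreeDP F G).
Definition cofreeZ a F := mk_cofree (cofreeZP a F).

Fact cofreeA : associative cofreeD.
Proof. by move=> F G H; apply: cofree_eq => k r /=; rewrite addrA. Qed.
Fact cofreeC : commutative cofreeD.
Proof. by move=> F G; apply: cofree_eq => k r /=; rewrite addrC. Qed.
Fact cofree0D : left_id cofree0 cofreeD.
Proof. by move=> F; apply: cofree_eq => k r /=; rewrite add0r. Qed.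
Fact cofreeND : left_inverse cofree0 cofreeN cofreeD.
Proof. by move=> F; apply: cofree_eq => k r /=; rewrite addNr. Qed.
HB.instance Definition _ :=
  GRing.isZmodule.Build (cofree R K) cofreeA cofreeC cofree0D cofreeND.

Fact cofreeZA a b F : cofreeZ a (cofreeZ b F) = cofreeZ (a * b) F.
Proof. by apply: cofree_eq => k r /=; rewrite mulrCA mulrA. Qed.
Fact cofreeZ1 : left_id 1 cofreeZ.
Proof. by move=> F; apply: cofree_eq => k r /=; rewrite mul1r. Qed.
Fact cofreeZDr : right_distributive cofreeZ +%R.
Proof. by move=> a F G; apply: cofree_eq. Qed.
Fact cofreeZDl F : {morph cofreeZ^~ F : a b / a + b}.
Proof.
move=> a b; apply: cofree_eq => k r /=; rewrite mulrDl.
exact: (zmod_morphism_add (cofreeP F k)).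
Qed.
HB.instance Definition _ := GRing.Zmodule_isLmodule.Build R (cofree R K)
  cofreeZA cofreeZ1 cofreeZDr cofreeZDl.

Lemma cofree_injective : injective_mod (cofree R K).
Proof.
move=> A B i f i_inj.
have ext k : exists2 h : B -> QZ, zmod_morphism h &
    forall a, h (i a) = sval (f a) k 1.
  pose G : set (B * QZ) := [set z | exists a, z = (i a, sval (f a) k 1)].
  have fB a b : sval (f (a - b)) k 1 = sval (f a) k 1 - sval (f b) k 1.
    by rewrite linearB.
  have [||h hM hG] := @extend_char B G.
  - split=> [_ _ _ _ [a [-> ->]] [b [-> ->]]|_ [a [/esym ia0 ->]]].
      by exists (a - b); rewrite fB linearB.
    have -> : a = 0 by apply: i_inj; rewrite ia0 raddf0.
    by rewrite raddf0.
  - by exists 0; rewrite !raddf0.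
  by exists h => // a; apply: hG; exists a.
have [h hP] : exists h : K -> B -> QZ, forall k, zmod_morphism (h k) /\
    forall a, h k (i a) = sval (f a) k 1.
  suff /choice[h] : forall k, exists h : B -> QZ, zmod_morphism h /\
    forall a, h (i a) = sval (f a) k 1 by exists h.
  by move=> k; have [h] := ext k; exists h.
have gP b k : zmod_morphism ((fun k r => h k (r *: b)) k).
  by move=> x y /=; rewrite scalerBl (hP k).1.
pose g b : cofree R K := mk_cofree (gP b).
have hD k := zmod_morphism_add (hP k).1.
have g_lin : linear g.
  move=> a x y; apply: cofree_eq => k r /=.
  by rewrite scalerDr scalerA hD mulrC.
pose gL := GRing.isLinear.Build R B (cofree R K) *:%R g g_lin.
exists (HB.pack_for {linear B -> cofree R K} g gL) => a.
apply: cofree_eq => k r /=.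
by rewrite -linearZ (hP k).2 linearZ /= mulr1.
Qed.
End Cofree.

Section InjectiveEmbedding.
Variables (R : comNzRingType) (N : lmodType R).

(* an injective module containing N, far from minimal *)
Definition inj_env : lmodType R := cofree R {h : N -> QZ | `[< zmod_morphism h >]}.

Fact to_inj_envP (x : N) (h : {h : N -> QZ | `[< zmod_morphism h >]}) :
  zmod_morphism ((fun h r => sval h (r *: x)) h).
Proof. by move=> a b /=; rewrite scalerBl; case: h => h /= /asboolP ->. Qed.

Definition to_inj_env_fun (x : N) : inj_env := mk_cofree (to_inj_envP x).
Fact to_inj_env_linear : linear to_inj_env_fun.
Proof.
move=> a x y; apply: cofree_eq => -[h hP'] r /=; have /asboolP hP := hP'.
by rewrite scalerDr scalerA mulrC (zmod_morphism_add hP).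
Qed.
HB.instance Definition _ := GRing.isLinear.Build R N inj_env *:%R
  to_inj_env_fun to_inj_env_linear.
Definition to_inj_env : {linear N -> inj_env} := to_inj_env_fun.

Lemma inj_env_injective : injective_mod inj_env.
Proof. exact: cofree_injective. Qed.

Lemma to_inj_env_inj : injective to_inj_env.
Proof.
apply: raddf_inj => x x0; apply/eqP; apply/negPn/negP => /char_separates[h hM].
have := congr1 (fun F : inj_env => sval F (exist _ h (introT (asboolP _) hM)) 1) x0.
by rewrite /= scale1r => ->; rewrite eqxx.
Qed.
End InjectiveEmbedding.

Record cochain (R : comNzRingType) := Cochain {
  cc_obj :> nat -> lmodType R;
  cc_d : forall n, {linear cc_obj n -> cc_obj n.+1};
  cc_dd : forall n x, cc_d n.+1 (cc_d n x) = 0 }.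
Arguments cc_d {R} c n.

Section Cochains.
Variables (R : comNzRingType) (A : cochain R).

Definition cocycle n : submod (A n) := ker (cc_d A n).

Definition coboundary n : submod (A n) :=
  match n with
  | 0 => submod_zero (A 0%N)
  | m.+1 => range (cc_d A m)
  end.

Definition cohomology n : lmodType R := subquot (cocycle n) (coboundary n).
End Cochains.

Definition map_cochain (R : comNzRingType) (F : functor R) (A : cochain R) :
  cochain R.
Proof.
apply: (@Cochain R (fun n => F (A n)) (fun n => fmap F (cc_d A n))) => n x.
by rewrite -fmap_comp; apply: fmap0 => y; exact: cc_dd.
Defined.

(* 0 -> N -> J 0 -> J 1 -> ... is exact with every J n injective *)
Record is_inj_resolution (R : comNzRingType) (N : lmodType R) (J : cochain R)
    (aug : {linear N -> J 0%N}) : Prop := IsInjResolution {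
  ir_injective : forall n, injective_mod (J n);
  ir_aug_inj : injective aug;
  ir_exact0 : forall x, cocycle J 0 x <-> range aug x;
  ir_exactS : forall n x, cocycle J n.+1 x <-> range (cc_d J n) x }.

Section StandardResolution.
Variables (R : comNzRingType) (N : lmodType R).

Fixpoint cosyz n : lmodType R :=
  if n is m.+1 then qmod (range (to_inj_env (cosyz m))) else N.

Definition inj_res : cochain R.
Proof.
apply: (@Cochain R (fun n => inj_env (cosyz n))
  (fun n => to_inj_env (cosyz n.+1) \o qcls (range (to_inj_env (cosyz n))))).
move=> n x /=; set y := qcls _ (to_inj_env _ _).
suff -> : y = 0 by rewrite raddf0.
rewrite /y -[RHS](raddf0 (qcls _)); apply/qcls_eq; rewrite subr0.
by exists (qcls _ x).
Defined.

Definition inj_res_aug : {linear N -> inj_res 0%N} := to_inj_env N.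

Lemma inj_resP : is_inj_resolution inj_res_aug.
Proof.
have cocycleE n (x : inj_res n) :
    cocycle inj_res n x <-> range (to_inj_env (cosyz n)) x.
  rewrite /cocycle /=; split.
    move=> x0.
    have : qcls (range (to_inj_env (cosyz n))) x = qcls _ 0.
      apply: (@to_inj_env_inj _ (cosyz n.+1)); rewrite !raddf0; exact: x0.
    by move=> /qcls_eq; rewrite subr0.
  move=> xr; have -> : qcls (range (to_inj_env (cosyz n))) x = qcls _ 0.
    by apply/qcls_eq; rewrite subr0.
  by rewrite !raddf0.
split.
- by move=> n; exact: inj_env_injective.
- exact: to_inj_env_inj.
- exact: cocycleE.
move=> n x; rewrite cocycleE; split=> [[y _ ->]|[y _ ->]].
  by have [z <-] := qcls_fun_surj y; exists z.
by exists (qcls _ y).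
Qed.
End StandardResolution.

(* Computed with the standard resolution [inj_res]; any other injective
   resolution of N gives an isomorphic module. *)
Definition right_derived (R : comNzRingType) (F : functor R) (n : nat)
  (N : lmodType R) : lmodType R := cohomology (map_cochain F (inj_res N)) n.

Definition Ext (R : comNzRingType) (n : nat) (M N : lmodType R) : lmodType R :=
  right_derived (homF M) n N.

(* The squares commute; the sign is put in the total differential [tot_d]. *)
Record bicomplex (R : comNzRingType) := Bicomplex {
  bc_obj :> nat -> nat -> lmodType R;
  bc_dh : forall p q, {linear bc_obj p q -> bc_obj p.+1 q};
  bc_dv : forall p q, {linear bc_obj p q -> bc_obj p q.+1};
  bc_dhdh : forall p q x, bc_dh p.+1 q (bc_dh p q x) = 0;
  bc_dvdv : forall p q x, bc_dv p q.+1 (bc_dv p q x) = 0;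
  bc_comm : forall p q x, bc_dv p.+1 q (bc_dh p q x) = bc_dh p q.+1 (bc_dv p q x) }.
Arguments bc_dh {R} b p q.
Arguments bc_dv {R} b p q.

Definition map_bicomplex (R : comNzRingType) (F : functor R) (C : bicomplex R) :
  bicomplex R.
Proof.
apply: (@Bicomplex R (fun p q => F (C p q)) (fun p q => fmap F (bc_dh C p q))
  (fun p q => fmap F (bc_dv C p q))) => p q x.
- by rewrite -fmap_comp; apply: fmap0 => y; exact: bc_dhdh.
- by rewrite -fmap_comp; apply: fmap0 => y; exact: bc_dvdv.
rewrite -!fmap_comp; congr (fmap F _ x).
by apply: lin_eq => y; exact: bc_comm.
Defined.

Definition sq_cochain (R : comNzRingType) (X : cochain R)
    (Z B : forall p, submod (X p))
    (dZ : forall p x, Z p x -> Z p.+1 (cc_d X p x))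
    (dB : forall p x, B p x -> B p.+1 (cc_d X p x)) : cochain R.
Proof.
apply: (@Cochain R (fun p => subquot (Z p) (B p))
  (fun p => sqmap (dZ p) (dB p))) => p u.
have [x <-] := sqcls_surj u; rewrite !sqmapE; apply/sqcls_eq0 => /=.
by rewrite cc_dd; exact: submod0.
Defined.

Section CartanEilenberg.
Variables (R : comNzRingType) (A : cochain R) (C : bicomplex R).

Definition bc_row q : cochain R :=
  @Cochain R (fun p => C p q) (fun p => bc_dh C p q) (fun p => @bc_dhdh R C p q).

Definition bc_col p : cochain R :=
  @Cochain R (fun q => C p q) (fun q => bc_dv C p q) (fun q => @bc_dvdv R C p q).

Fact row_cocycle q p x : cocycle (bc_col p) q x ->
  cocycle (bc_col p.+1) q (bc_dh C p q x).
Proof.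
by rewrite /cocycle /= => x0; rewrite bc_comm [bc_dv _ _ _ _]x0 raddf0.
Qed.

Fact row_coboundary q p x : coboundary (bc_col p) q x ->
  coboundary (bc_col p.+1) q (bc_dh C p q x).
Proof.
case: q x => [|q] x /=; first by move=> ->; rewrite raddf0.
by move=> [y _ ->]; exists (bc_dh C p q y) => //; rewrite -bc_comm.
Qed.

Fact row_zero q p (x : C p q) : submod_zero (C p q) x ->
  submod_zero (C p.+1 q) (bc_dh C p q x).
Proof. by move=> /= ->; rewrite raddf0. Qed.

(* p |-> Z^q, B^q, H^q of the column C p *)
Definition row_Z q : cochain R :=
  sq_cochain (X := bc_row q) (@row_cocycle q) (@row_zero q).
Definition row_B q : cochain R :=
  sq_cochain (X := bc_row q) (@row_coboundary q) (@row_zero q).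
Definition row_H q : cochain R :=
  sq_cochain (X := bc_row q) (@row_cocycle q) (@row_coboundary q).

Variable aug : forall q, {linear A q -> C 0%N q}.
Hypothesis aug_d : forall q x, bc_dv C 0 q (aug q x) = aug q.+1 (cc_d A q x).

Fact aug_cocycle q x : cocycle A q x -> cocycle (bc_col 0) q (aug q x).
Proof. by rewrite /cocycle /= => x0; rewrite [LHS]aug_d x0 raddf0. Qed.

Fact aug_coboundary q x : coboundary A q x -> coboundary (bc_col 0) q (aug q x).
Proof.
case: q x => [|q] x /=; first by move=> ->; rewrite raddf0.
by move=> [y _ ->]; exists (aug q y) => //; rewrite -aug_d.
Qed.

Fact aug_zero q x : submod_zero (A q) x -> submod_zero (C 0%N q) (aug q x).
Proof. by move=> /= ->; rewrite raddf0. Qed.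

Record is_CE_resolution : Prop := IsCEResolution {
  ce_row : forall q, is_inj_resolution (J := bc_row q) (aug q);
  ce_Z : forall q, is_inj_resolution (J := row_Z q)
    (sqmap (@aug_cocycle q) (@aug_zero q));
  ce_B : forall q, is_inj_resolution (J := row_B q)
    (sqmap (@aug_coboundary q) (@aug_zero q));
  ce_H : forall q, is_inj_resolution (J := row_H q)
    (sqmap (@aug_cocycle q) (@aug_coboundary q)) }.
End CartanEilenberg.

Section TotalComplex.
Variables (R : comNzRingType) (C : bicomplex R).

(* The degree n part of the total complex is [tot_part s n] for any s <= 0. *)
Definition tot : lmodType R := dprod (fun p => (dprod (C p) : lmodType R)).

Definition tot_d_fun (x : tot) : tot := fun p q =>
  match p return C p q with
  | 0 => 0
  | p'.+1 => bc_dh C p' q (x p' q)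
  end + (-1) ^+ p *:
  match q return C p q with
  | 0 => 0
  | q'.+1 => bc_dv C p q' (x p q')
  end.

Fact tot_d_linear : linear tot_d_fun.
Proof.
move=> a x y; apply: functional_extensionality_dep => p.
apply: functional_extensionality_dep => q.
rewrite -[RHS]/(a *: tot_d_fun x p q + tot_d_fun y p q) /tot_d_fun.
have dh p' : bc_dh C p' q ((a *: x + y) p' q) =
    a *: bc_dh C p' q (x p' q) + bc_dh C p' q (y p' q) by rewrite -linearP.
have dv q' : bc_dv C p q' ((a *: x + y) p q') =
    a *: bc_dv C p q' (x p q') + bc_dv C p q' (y p q') by rewrite -linearP.
case: p q dh dv => [|p] [|q] dh dv; rewrite ?dh ?dv ?(scaler0, addr0, add0r) //.
  by rewrite scalerDr !scalerA mulrC.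
by rewrite !scalerDr !scalerA [_ * a]mulrC addrACA.
Qed.
HB.instance Definition _ := GRing.isLinear.Build R tot tot *:%R tot_d_fun
  tot_d_linear.
Definition tot_d : {linear tot -> tot} := tot_d_fun.

(* F^s Tot^n, where F is the filtration by the first index *)
Program Definition tot_part (s n : int) : submod tot := @Submod R tot
  (fun x => forall p q : nat,
     ~~ ((s <= p%:Z) && (p%:Z + q%:Z == n)) -> x p q = 0) _ _.
Next Obligation. by []. Qed.
Next Obligation.
move=> s n a x y /= x0 y0 p q pq.
by rewrite -[LHS]/(a *: x p q + y p q) x0 // y0 // scaler0 addr0.
Qed.

(* Z_r^s = {x in F^s Tot^n | d x in F^(s+r) Tot^(n+1)} *)
Program Definition bc_cycle (r s n : int) : submod tot := @Submod R tot
  (fun x => tot_part s n x /\ tot_part (s + r) (n + 1) (tot_d x)) _ _.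
Next Obligation.
by move=> r s n; split; [|rewrite (raddf0 tot_d)]; exact: submod0.
Qed.
Next Obligation.
move=> r s n a x y [x1 x2] [y1 y2].
by split; [|rewrite (linearP tot_d)]; exact: submodZD.
Qed.

(* E_r^{p,q} = Z_r^p / (Z_{r-1}^{p+1} + d Z_{r-1}^{p-r+1}) *)
Definition bc_page (r p q : int) : lmodType R :=
  subquot (bc_cycle r p (p + q))
    (submod_sum (bc_cycle (r - 1) (p + 1) (p + q))
       (image tot_d (bc_cycle (r - 1) (p - r + 1) (p + q - 1)))).

Definition bc_page_cls r p q (x : smod (bc_cycle r p (p + q))) : bc_page r p q :=
  sqcls _ _ x.
End TotalComplex.

(* First quadrant and cohomological; only the pages r >= 2 are meaningful. *)
Record spectral_sequence (R : comNzRingType) := SpectralSequence {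
  ss_page :> nat -> int -> int -> lmodType R;
  ss_d : forall r p q,
    {linear ss_page r p q -> ss_page r (p + r%:Z) (q - r%:Z + 1)};
  ss_quadrant : forall r p q, (2 <= r)%N -> (p < 0) || (q < 0) ->
    forall x : ss_page r p q, x = 0;
  ss_dd : forall r p q x, (2 <= r)%N -> ss_d r _ _ (ss_d r p q x) = 0;
  ss_next : forall r p q, (2 <= r)%N ->
    iso (ss_page r.+1 (p + r%:Z) (q - r%:Z + 1))
      (subquot (ker (ss_d r (p + r%:Z) (q - r%:Z + 1))) (range (ss_d r p q))) }.
Arguments ss_d {R} s r p q.

Section SpectralSequences.
Variable R : comNzRingType.
Implicit Types (E : spectral_sequence R) (F G : functor R).

(* E_r^{p,q} =>_p H^{p+q}. In the first quadrant E_r^{p,q} is stationary, equal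
   to E_oo^{p,q}, as soon as r >= p + q + 2. *)
Definition converges E (H : nat -> lmodType R) :=
  forall n, exists Phi : nat -> submod (H n),
    [/\ forall x, Phi 0%N x,
        forall p x, Phi p.+1 x -> Phi p x,
        forall x, Phi n.+1 x -> x = 0 &
        forall p q r, (p + q)%N = n -> (p + q + 2 <= r)%N ->
          iso (E r p%:Z q%:Z) (subquot (Phi p) (Phi p.+1))].

Definition is_bicomplex_ss E (C : bicomplex R) :=
  exists phi : forall (r : nat) (p q : int), {linear bc_page C r p q -> E r p q},
    (forall r p q, (2 <= r)%N -> bijective (phi r p q)) /\
    (forall (r : nat) p q (x : smod (bc_cycle C r p (p + q)))
       (y : smod (bc_cycle C r (p + r%:Z) (p + r%:Z + (q - r%:Z + 1)))),
       (2 <= r)%N -> val y = tot_d C (val x) ->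
       ss_d E r p q (phi r p q (bc_page_cls x)) = phi r _ _ (bc_page_cls y)).

(* The spectral sequence of F C filtered by the resolution degree, where C is
   a Cartan-Eilenberg resolution of G J and J an injective resolution of N. *)
Definition is_grothendieck_ss F G (N : lmodType R) E :=
  exists (C : bicomplex R)
    (aug : forall q, {linear map_cochain G (inj_res N) q -> C 0%N q})
    (aug_d : forall q x, bc_dv C 0 q (aug q x) =
       aug q.+1 (cc_d (map_cochain G (inj_res N)) q x)),
    is_CE_resolution aug_d /\ is_bicomplex_ss E (map_bicomplex F C).
End SpectralSequences.

Definition noetherian_ring (R : comNzRingType) :=
  forall I : ideal R, fin_gen_submod I.

Definition fin_gen_module (R : comNzRingType) (M : lmodType R) :=
  fin_gen_submod (submod_full M).

Record spec (R : comNzRingType) := Spec {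
  spec_ideal :> submod (R^o : lmodType R);
  spec_proper : ~ spec_ideal 1;
  spec_prime : forall a b : R, spec_ideal (a * b) -> spec_ideal a \/ spec_ideal b }.

Section AssSupp.
Variables (R : comNzRingType) (M : lmodType R).

Definition Ass : set (spec R) :=
  [set P : spec R | exists x : M, forall a : R, P a <-> a *: x = 0].

Section Localization.
Variable P : spec R.

Definition fracs : Type := (M * {s : R | `[< ~ P s >]})%type.

(* x / s = y / t iff u (t x - s y) = 0 for some u not in P *)
Definition frac_eq (f g : fracs) : bool :=
  `[< exists u : R, ~ P u /\ u *: (val g.2 *: f.1 - val f.2 *: g.1) = 0 >].

Fact frac_eq_equiv : equiv_class_of frac_eq.
Proof.
have den (f : fracs) : ~ P (val f.2) by case: f => x [s /=] /asboolP.
split=> [f|f g|g f h].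
- apply/asboolP; exists 1; split; first exact: spec_proper.
  by rewrite subrr scaler0.
- by apply/asboolP/asboolP => -[u [Pu E]]; exists u; split=> //;
    rewrite -opprB scalerN E oppr0.
move=> /asboolP[u [Pu E]] /asboolP[v [Pv E']]; apply/asboolP.
exists (u * v * val g.2); split.
  by move=> /spec_prime[/spec_prime[]|] //; exact: den.
move: E E'; case: f g h => [x [s Ps]] [y [t Pt]] [z [w Pw]] /=.
rewrite !scalerBr !scalerA => /eqP; rewrite subr_eq0 => /eqP E.
move=> /eqP; rewrite subr_eq0 => /eqP E'.
have -> : u * v * t * w = (v * w) * (u * t) by ring.
have -> : u * v * t * s = (u * s) * (v * t) by ring.
by rewrite -(scalerA (v * w)) E -(scalerA (u * s)) -E' !scalerA
  [X in X *: _ - _]mulrC subrr.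
Qed.

Canonical frac_eq_rel := EquivRelPack frac_eq_equiv.
Canonical frac_eq_enc := defaultEncModRel frac_eq.

(* the set underlying the localization of M at P *)
Definition localization : Type := {eq_quot frac_eq}%qT.
Definition frac (x : M) (s : R) (Ps : ~ P s) : localization :=
  \pi_(localization)%qT ((x, exist _ s (introT (asboolP _) Ps)) : fracs).
Definition loc0 : localization := frac 0 (spec_proper (s := P)).

Lemma fracP x y s t (Ps : ~ P s) (Pt : ~ P t) :
  frac x Ps = frac y Pt <-> exists u : R, ~ P u /\ u *: (t *: x - s *: y) = 0.
Proof.
rewrite /frac; split=> [/eqP|E]; last by apply/eqP; rewrite piE; exact/asboolP.
by rewrite piE => /asboolP.
Qed.
End Localization.

Definition Supp : set (spec R) :=
  [set P : spec R | exists u : localization P, u <> loc0 P].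
End AssSupp.

(* Main.v *)
Require Import Defs.
From HB Require Import structures.
From mathcomp Require Import all_boot all_order all_algebra.
From mathcomp Require Import all_classical ring zify.

Set Implicit Arguments.
Unset Strict Implicit.
Unset Printing Implicit Defensive.

(* Artin-Rees for the relation module of M shows that D_I(M, -) is
   Hom(M, D_I(-)). Applied to the ideals of R, this turns Baer's criterion for
   D_I(J) into the extension property of J along I^n K -> I^n, so that D_I(J) is
   injective when J is. Hence, if C is a Cartan-Eilenberg resolution of
   D_I(inj_res N), the rows of Hom(M, C) are exact and its total cohomology is
   R^n D_I(M, N), while its columns split and its second page consists of the
   modules Ext^p(M, R^q D_I(N)). The statements on Ass and Supp hold for any
   finite filtration with the given graded pieces; for Ass, the piece i = 0
   embeds in the second page since no differential enters the column p = 0. *)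

(* [image], [preimage] and [range] are those of submodules from here on. *)
Import Defs Order.TTheory GRing.Theory Num.Theory.
Local Open Scope ring_scope.
Local Open Scope classical_set_scope.

(** The obstacle in identifying D_I(M, -) with Hom(M, D_I(-)) is surjectivity. Write M as R^r / K. A
    map from M to D_I(A) gives r germs of maps I^n -> A, and a relation in K is respected only after
    multiplication by some I^l, so that only I^l K is killed. A map on I^k M has to kill the
    intersection of I^k R^r with K, which can be larger than I^k K; Artin-Rees puts it inside I^l K
    for large k.

    Injectivity of D_I(J), rather than mere acyclicity for Hom(M, -), keeps the rest elementary: an
    injective resolution of an injective module splits, and a splitting survives every additive
    functor. For the same reason the Cartan-Eilenberg resolution is made of explicit products: its
    projections and inclusions are linear maps to which Hom(M, -) applies. *)

Lemma dependent_choice (T : nat -> Type) (P : forall n, T n -> Prop)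
    (S : forall n, T n -> T n.+1 -> Prop) (x0 : T 0%N) : P 0%N x0 ->
  (forall n x, P n x -> exists2 y, S n x y & P n.+1 y) ->
  exists f : forall n, T n,
    [/\ f 0%N = x0, forall n, P n (f n) & forall n, S n (f n) (f n.+1)].
Proof.
move=> P0 PS.
have st n (x : {x | P n x}) : {y : {y | P n.+1 y} | S n (sval x) (sval y)}.
  apply: cid; have [y Sy Py] := PS n _ (svalP x); by exists (exist _ y Py).
pose g := fix g n : {x | P n x} :=
  if n is m.+1 then sval (st m (g m)) else exist _ x0 P0.
exists (fun n => sval (g n)); split=> // n; first exact: (svalP (g n)).
exact: (svalP (st n (g n))).
Qed.

(** * Linear maps and injective modules *)

Section LinearMaps.
Variable R : comNzRingType.

Definition lin_of (U V : lmodType R) (f : U -> V) (f_lin : linear f) :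
    {linear U -> V} :=
  HB.pack_for {linear U -> V} f (GRing.isLinear.Build R U V *:%R f f_lin).

Lemma bijP (T U : Type) (f : T -> U) : injective f ->
  (forall y, exists x, f x = y) -> bijective f.
Proof.
move=> f_inj f_surj; have [g gK] := choice f_surj.
by exists g => // x; apply: f_inj; rewrite gK.
Qed.

Lemma bij_surj (T U : Type) (f : T -> U) : bijective f ->
  forall y, exists x, f x = y.
Proof. by move=> [g _ gK] y; exists (g y). Qed.

Lemma lin_surj_factor (U V W : lmodType R) (f : {linear U -> V})
    (g : {linear U -> W}) : (forall y, exists x, f x = y) ->
  (forall x, f x = 0 -> g x = 0) ->
  exists h : {linear V -> W}, forall x, h (f x) = g x.
Proof.
move=> f_surj fg; have [s sK] := choice f_surj.
have E x y : f x = f y -> g x = g y.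
  move=> fxy; apply/eqP; rewrite -subr_eq0 -raddfB; apply/eqP/fg.
  by rewrite linearB fxy subrr.
have h_lin : linear (g \o s).
  by move=> a x y /=; rewrite -linearP; apply: E; rewrite sK linearP !sK.
by exists (lin_of h_lin) => x /=; apply: E; rewrite sK.
Qed.

Lemma lin_inverse (U V : lmodType R) (f : {linear U -> V}) : bijective f ->
  exists g : {linear V -> U}, cancel f g /\ cancel g f.
Proof.
move=> fb; have f_inj := bij_inj fb.
have [||g gK] := @lin_surj_factor U V U f idfun.
- exact: bij_surj.
- by move=> x fx; apply: f_inj; rewrite fx raddf0.
exists g; split=> // y; have [x <-] := bij_surj fb y; by rewrite gK.
Qed.

Lemma iso_sym (U V : lmodType R) : iso U V -> iso V U.
Proof.
by move=> [f fb]; have [g [fK gK]] := lin_inverse fb; exists g; exists f.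
Qed.

Lemma iso_trans (U V W : lmodType R) : iso U V -> iso V W -> iso U W.
Proof. by move=> [f fb] [g gb]; exists (g \o f); exact: bij_comp. Qed.

Lemma subquot_iso (U V : lmodType R) (Z B : submod U) (f : {linear smod Z -> V}) :
  (forall y, exists x, f x = y) -> (forall x, f x = 0 <-> B (val x)) ->
  iso (subquot Z B) V.
Proof.
move=> f_surj fB.
have [||h hE] := @lin_surj_factor _ _ _ (sqcls Z B) f.
- exact: sqcls_surj.
- by move=> x /sqcls_eq0 /fB.
exists h; apply: bijP.
  apply: raddf_inj => u; have [x <-] := sqcls_surj u.
  by move=> hx; apply/sqcls_eq0/fB; rewrite -hE; exact: hx.
by move=> y; have [x <-] := f_surj y; exists (sqcls Z B x).
Qed.

(** [f] need not be injective: [g] descends to the image of [f], a submodule of [V], and is extended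
    from there. In this form injectivity produces maps along the differentials of an exact
    complex. *)
Lemma injective_factor (U V E : lmodType R) (f : {linear U -> V})
    (g : {linear U -> E}) : injective_mod E ->
  (forall x, f x = 0 -> g x = 0) ->
  exists h : {linear V -> E}, forall x, h (f x) = g x.
Proof.
move=> E_inj fg.
have fP x : range f (f x) by exists x.
have f1_lin : linear (fun x => @mk_smod R V (range f) _ (fP x)).
  by move=> a x y; apply: val_inj; rewrite /= linearP.
have [||g1 g1E] := @lin_surj_factor U (smod (range f)) E (lin_of f1_lin) g.
- by move=> y; have [x _ yE] := smodP y; exists x; apply: val_inj.
- by move=> x /(congr1 val) /= /fg.
have [|h hE] := E_inj _ _ (smod_incl (range f)) g1; first exact: val_inj.
by exists h => x; rewrite -g1E -hE.
Qed.

Lemma injective_prod (E E' : lmodType R) : injective_mod E -> injective_mod E' ->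
  injective_mod (E * E')%type.
Proof.
move=> E_inj E'_inj A B i f i_inj.
have f1_lin : linear (fun x => (f x).1) by move=> a x y; rewrite linearP.
have f2_lin : linear (fun x => (f x).2) by move=> a x y; rewrite linearP.
have [g1 g1E] := E_inj _ _ i (lin_of f1_lin) i_inj.
have [g2 g2E] := E'_inj _ _ i (lin_of f2_lin) i_inj.
have g_lin : linear (fun x => (g1 x, g2 x)).
  by move=> a x y; rewrite !linearP.
by exists (lin_of g_lin) => a /=; rewrite g1E g2E /=; case: (f a).
Qed.

Lemma span_sub (U : lmodType R) (A : set U) x : A x -> span A x.
Proof. by move=> Ax S; apply. Qed.

Lemma span_min (U : lmodType R) (A : set U) (S : submod U) :
  (forall x, A x -> S x) -> forall x, span A x -> S x.
Proof. by move=> AS x; apply. Qed.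

End LinearMaps.

(** * Noetherian modules and the Artin-Rees lemma *)

Section Noetherian.
Variable R : comNzRingType.

Definition noetherian_mod (U : lmodType R) :=
  forall S : submod U, fin_gen_submod S.

Lemma noetherian_acc (U : lmodType R) (S : nat -> submod U) : noetherian_mod U ->
  (forall n x, S n x -> S n.+1 x) -> exists k, forall n x, S n x -> S k x.
Proof.
move=> noethU Sinc.
have Sle m n x : (m <= n)%N -> S m x -> S n x.
  by move=> /subnK <- Sx; elim: (n - m)%N => [|k IHk] //; exact: Sinc.
have T0 : (fun x => exists n, S n x) 0 by exists 0%N; exact: submod0.
have TP a x y : (exists n, S n x) -> (exists n, S n y) ->
    exists n, S n (a *: x + y).
  move=> [m Sx] [n Sy]; exists (maxn m n); apply: submodZD.
    exact: Sle (leq_maxl _ _) Sx.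
  exact: Sle (leq_maxr _ _) Sy.
have [s sE] := noethU (Submod T0 TP).
have [k kP] : exists k, forall x, x \in s -> S k x.
  have sT x : x \in s -> exists n, S n x.
    move=> xs; have : Submod T0 TP x by rewrite sE; exact: span_sub.
    by [].
  elim: s {sE} sT => [|x s IHs] sT; first by exists 0%N.
  have [|k kP] := IHs; first by move=> y ys; apply: sT; rewrite inE ys orbT.
  have [n Sx] := sT x (mem_head _ _).
  exists (maxn n k) => y; rewrite inE => /orP[/eqP ->|/kP].
    exact: Sle (leq_maxl _ _) Sx.
  exact: Sle (leq_maxr _ _).
exists k => n x Sx; have : Submod T0 TP x by exists n.
by rewrite sE; apply: span_min.
Qed.

Lemma noetherian_max (U : lmodType R) (P : submod U -> Prop) (S0 : submod U) :
  noetherian_mod U -> P S0 -> exists2 S : submod U, P S &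
    forall T : submod U, P T -> (forall x, S x -> T x) -> forall x, T x -> S x.
Proof.
move=> noethU P0; apply: contrapT => nmax.
have [S x PSx|f [_ Pf fS]] := @dependent_choice (fun=> submod U) (fun=> P)
  (fun _ S T => (forall x, S x -> T x) /\ exists2 x, T x & ~ S x) S0 P0.
  apply: contrapT => nT; apply: nmax; exists x => // T PT ST y Ty.
  by apply: contrapT => nSy; apply: nT; exists T => //; split=> //; exists y.
have [k kP] := noetherian_acc noethU (fun n => (fS n).1).
by have [_ [x fx nfx]] := fS k; apply: nfx; exact: kP fx.
Qed.

Hypothesis R_noeth : noetherian_ring R.

(** Induction on the number [k] of leading coordinates that may be nonzero. The last of them sends
    [S] onto an ideal of R, which is finitely generated; lifts of its generators, with generators of
    the part of [S] where that coordinate vanishes, generate [S]. *)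
Lemma noetherian_row n : noetherian_mod 'rV[R]_n.
Proof.
move=> S0; suff main k : forall S : submod 'rV[R]_n,
    (forall v, S v -> forall i : 'I_n, (k <= i)%N -> v 0 i = 0) -> fin_gen_submod S.
  apply: (main n) => v _ i; by rewrite leqNgt ltn_ord.
elim: k => [|k IHk] S Sk.
  exists [::]; apply: submodP => v; split; last first.
    by apply: span_min => x; rewrite /= in_nil.
  move=> /Sk v0; have -> : v = 0 by apply/rowP => i; rewrite mxE v0.
  exact: submod0.
have [ltkn|lenk] := ltnP k n; last first.
  apply: IHk => v /Sk vk i ki; have := leq_trans lenk ki.
  by rewrite leqNgt ltn_ord.
pose i0 := Ordinal ltkn.
have c_lin : linear (fun v : 'rV[R]_n => v 0 i0 : R^o).
  by move=> a u v; rewrite !mxE.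
pose c : {linear 'rV[R]_n -> R^o} := lin_of c_lin.
have [s sE] := R_noeth (image c S).
have [t tS tP] : exists2 t : seq 'rV[R]_n, forall v, v \in t -> S v &
    forall a, a \in s -> exists2 v, v \in t & c v = a.
  have : forall a, a \in s -> image c S a by move=> a; rewrite sE; exact: span_sub.
  elim: s {sE} => [|a s IHs] sP; first by exists [::].
  have [|t tS tP] := IHs; first by move=> b bs; apply: sP; rewrite inE bs orbT.
  have [v Sv av] := sP a (mem_head _ _); exists (v :: t) => [w|b].
    by rewrite inE => /orP[/eqP ->|/tS].
  rewrite inE => /orP[/eqP ->|/tP[w wt <-]]; first by exists v; rewrite ?mem_head.
  by exists w; rewrite // inE wt orbT.
pose K : submod 'rV[R]_n := @Submod R _ (fun v => S v /\ c v = 0)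
  (conj (submod0 S) (raddf0 c))
  (fun a u v Su Sv => conj (submodZD a Su.1 Sv.1)
     (etrans (linearP c a u v) (etrans (congr2 (fun x y => a *: x + y) Su.2 Sv.2)
       (etrans (addr0 _) (scaler0 _ a))))).
have [|r rE] := IHk K.
  move=> v [Sv cv] i; rewrite leq_eqVlt => /orP[/eqP ki|]; last exact: Sk.
  by rewrite -[RHS]cv /=; congr (v _ _); apply: val_inj.
have rK v : v \in r -> K v by move=> vr; rewrite rE; exact: span_sub.
exists (t ++ r); apply: submodP => v; split; last first.
  apply: span_min => w /=; rewrite mem_cat => /orP[/tS //|/rK []] //.
move=> Sv.
have [w wt cw] : exists2 w, span [set` t] w & c w = c v.
  have : image c S (c v) by exists v.
  rewrite sE => /(_ (image c (span [set` t])))[a /tP[w wt <-]|w wt ->].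
    by exists w => //; exact: span_sub.
  by exists w.
have Sw : S w by exact: span_min wt.
have tr (x : seq 'rV[R]_n) : {subset x <= t ++ r} ->
    forall u, span [set` x] u -> span [set` t ++ r] u.
  by move=> xtr; apply: span_mono => u /=; exact: xtr.
rewrite -[v](subrK w); apply: submodD.
  apply: (tr r) => [u ur|]; first by rewrite mem_cat ur orbT.
  rewrite -rE; split; first exact: submodB.
  by rewrite linearB cw subrr.
by apply: (tr t) wt => u ut; rewrite mem_cat ut.
Qed.
End Noetherian.

Section ArtinRees.
Variable R : comNzRingType.
Implicit Types (I J : ideal R) (U : lmodType R).

Lemma ideal_mul_sub I U (S T : submod U) :
  (forall a x, I a -> S x -> T (a *: x)) -> forall x, ideal_mul I S x -> T x.
Proof. by move=> IST; apply: span_min => _ [a [x [Ia Sx ->]]]; exact: IST. Qed.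

Lemma ideal_mul_mem I U (S : submod U) a x : I a -> S x -> ideal_mul I S (a *: x).
Proof. by move=> Ia Sx; apply: span_sub; exists a, x. Qed.

Lemma ideal_pow_exp I (a : R) n : I a -> ideal_pow I n (a ^+ n).
Proof.
by move=> Ia; elim: n => [|n IHn] //=; rewrite exprS; exact: ideal_mul_mem.
Qed.

Lemma mulr_regular_linear (x : R) : linear (fun a : R^o => a * x : R^o).
Proof. by move=> a b c; rewrite mulrDl -[a *: b]/(a * b) -mulrA. Qed.

Definition principal (x : R) : ideal R := range (lin_of (@mulr_regular_linear x)).

Lemma span_cons_split (x : R) (s : seq R) a : span [set` (x :: s : seq R^o)] a ->
  submod_sum (principal x) (span [set` (s : seq R^o)]) a.
Proof.
apply: span_min => y /=; rewrite inE => /orP[/eqP ->|ys].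
  exists x, 0; split; [by exists 1; rewrite //= mul1r| |].
  exact: (submod0 (span _)).
  by rewrite addr0.
exists 0, y; split; [|exact: span_sub|by rewrite add0r].
exact: (submod0 (principal x)).
Qed.

(* A monomial of degree [k + m] has degree at least [k] in [x], or at least [m]
   in the other generators. *)
Lemma ideal_pow_cons (x : R) (s : seq R) k m a :
  ideal_pow (span [set` (x :: s : seq R^o)]) (k + m) a ->
  submod_sum (principal (x ^+ k)) (ideal_pow (span [set` (s : seq R^o)]) m) a.
Proof.
set I' := span [set` (s : seq R^o)].
suff main j : forall k m, (k + m)%N = j -> forall a,
    ideal_pow (span [set` (x :: s : seq R^o)]) j a ->
    submod_sum (principal (x ^+ k)) (ideal_pow I' m) a by exact: main.
elim: j {k m a} => [|j IHj] k m.
  move/eqP; rewrite addn_eq0 => /andP[/eqP -> /eqP ->] a _.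
  by exists 0, a; split; [exact: (submod0 (principal _))| |rewrite add0r].
case: k => [_|k].
  move=> a _; exists a, 0; split; [|exact: (submod0 (ideal_pow _ _))|by rewrite addr0].
  by exists a; rewrite //= mulr1.
case: m => [_ a _|m].
  by exists 0, a; split; [exact: (submod0 (principal _))| |rewrite add0r].
move=> kmj; apply: ideal_mul_sub.
move=> _ y /span_cons_split[_ [a' [[c _ ->] sa' ->]]] Iy.
have [|_ [b1 [[r1 _ ->] sb1 y1]]] := IHj k m.+1 _ y Iy.
  by move: kmj; case.
have [|_ [b2 [[r2 _ ->] sb2 y2]]] := IHj k.+1 m _ y Iy.
  by move: kmj; rewrite addnS; case.
rewrite scalerDl; apply: (submodD (S := submod_sum _ _)).
  exists (c * r1 * x ^+ k.+1), (c * x * b1); split; first by exists (c * r1).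
    exact: (submodZ (S := ideal_pow I' m.+1)).
  rewrite y1 -[_ *: _]/(c * x * (r1 * x ^+ k + b1)) mulrDr exprS !mulrA.
  by congr (_ * _ + _); rewrite -!mulrA; congr (_ * _); rewrite mulrC.
exists (a' * r2 * x ^+ k.+1), (a' * b2); split; first by exists (a' * r2).
  exact: (ideal_mul_mem (S := ideal_pow I' m)).
by rewrite y2 -[_ *: _]/(a' * (r2 * x ^+ k.+1 + b2)) mulrDr mulrA.
Qed.

(** Exponents add up over the generators: by [ideal_pow_cons], if [k] serves for [x] and [m] for the
    ideal of the others, then [k + m] serves for all. *)
Lemma ideal_pow_radical (s : seq R) J :
  (forall x, x \in s -> exists k, J (x ^+ k)) ->
  exists n, forall a, ideal_pow (span [set` (s : seq R^o)]) n a -> J a.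
Proof.
elim: s => [|x s IHs] sJ.
  (* The ideal of the empty list is zero, but its power 0 is the whole ring; hence the exponent
     1. *)
  exists 1%N; apply: ideal_mul_sub => a y sa _.
  have -> : a = 0.
    by apply: (span_min (S := submod_zero R^o)) sa => z /=; rewrite in_nil.
  by rewrite scale0r; exact: submod0.
have [|m mP] := IHs; first by move=> y ys; apply: sJ; rewrite inE ys orbT.
have [k Jk] := sJ x (mem_head _ _).
exists (k + m)%N => a /ideal_pow_cons[_ [b [[r _ ->] /mP Jb ->]]].
by apply: submodD => //; exact: (submodZ (S := J)).
Qed.

(* Take [L] maximal with [L :&: K] inside [I^n K]. For [y] in [I], the chain of
   the [(L : y^j)] is stationary, from which [L + y^k U] has the same property
   for large [k], so that [y^k U] lies in [L]. *)
Lemma artin_rees (U : lmodType R) I (K : submod U) n :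
  noetherian_ring R -> noetherian_mod U ->
  exists k, forall v, ideal_pow_mul I k U v -> K v ->
    ideal_mul (ideal_pow I n) K v.
Proof.
move=> R_noeth U_noeth; pose K0 := ideal_mul (ideal_pow I n) K.
have [|L LK Lmax] := @noetherian_max R U
  (fun L => forall v, L v -> K v -> K0 v) (submod_zero U) U_noeth.
  by move=> v -> _; exact: submod0.
(* [L] absorbs I^n K because [L + K0] still meets [K] inside [K0]: if l + z is in [K] with [z] in
   [K0], then [l] is in [K] too. *)
have K0L v : submod_sum L K0 v -> L v.
  apply: (Lmax) => [x [l [z [Ll Kz xE]]] Kx|x Lx]; last first.
    by exists x, 0; split; [|exact: submod0|rewrite addr0].
  rewrite xE; apply: submodD => //; apply: LK => //.
  have -> : l = x - z by rewrite xE addrK.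
  by apply: submodB => //; apply: ideal_mul_sub Kz => a w _; exact: submodZ.
have powL (y : R) : I y -> exists k, forall v, L (y ^+ k *: v).
  move=> Iy.
  have mul_lin j : linear (fun v : U => y ^+ j *: v).
    by move=> a u v; rewrite scalerDr !scalerA mulrC.
  have [|k kP] := @noetherian_acc R U
    (fun j => preimage (lin_of (mul_lin j)) L) U_noeth.
    by move=> j v /= Lv; rewrite exprS -scalerA; exact: submodZ.
  exists (k + n)%N.
  pose T := submod_sum L (range (lin_of (mul_lin (k + n)%N))).
  suff TL v : T v -> L v.
    by move=> v; apply: TL; exists 0, (y ^+ (k + n) *: v); split;
      [exact: submod0|exists v|rewrite add0r].
  apply: (Lmax); last first.
    by move=> u Lu; exists u, 0; split; [|exact: submod0|rewrite addr0].
  move=> z Tz Kz; apply: (LK) => //; move: Tz => [l [_ [Ll [u _ ->] zE]]] /=.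
  rewrite zE; apply: submodD => //=.
  (* As [z] is in [K], [y ^+ n *: z] is in I^n K, hence in [L]. This puts a high power of [y] times
     [u] in [L], and stationarity of the chain lowers the power to [k]. *)
  have : L (y ^+ (n + (k + n)) *: u).
    have -> : y ^+ (n + (k + n)) *: u = y ^+ n *: z - y ^+ n *: l.
      by rewrite zE /= scalerDr addrAC subrr add0r scalerA -exprD.
    apply: submodB; last exact: submodZ.
    apply: K0L; exists 0, (y ^+ n *: z); split; [exact: submod0| |by rewrite add0r].
    by apply: ideal_mul_mem => //; exact: ideal_pow_exp.
  by move=> /(kP (n + (k + n))%N u) /= Lu; rewrite addnC exprD -scalerA; exact: submodZ.
(* The [a] with a U inside [L] form an ideal that contains a power of every generator of [I], hence
   a power of [I]. *)
have A0 : (fun a : R^o => forall v, L (a *: v)) 0.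
  by move=> v; rewrite scale0r; exact: submod0.
have AP c (a b : R^o) : (forall v, L (a *: v)) -> (forall v, L (b *: v)) ->
    forall v, L ((c *: a + b) *: v).
  move=> La Lb v; rewrite scalerDl; apply: submodD => //.
  by rewrite -scalerA; exact: submodZ.
have [s sE] := R_noeth I.
have [|k kP] := @ideal_pow_radical s (Submod A0 AP).
  by move=> y ys; apply: powL; rewrite sE; exact: span_sub.
rewrite -sE in kP; exists k => v Iv Kv; apply: LK => //.
by apply: ideal_mul_sub Iv => a u /kP /= + _; exact.
Qed.
End ArtinRees.

(** * The equivalence of D_I(M, -) with Hom(M, D_I(-)) *)

Section DirectLimitUniversal.
Variables (R : comNzRingType) (X : dirsys R).

Lemma dlim_in_common (u v : dlim X) :
  exists n x y, dlim_in X n x = u /\ dlim_in X n y = v.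
Proof.
have [n [x <-]] := dlim_surj u; have [m [y <-]] := dlim_surj v.
exists (maxn n m), (ds_map (leq_maxl n m) x), (ds_map (leq_maxr n m) y).
by rewrite !dlim_in_comp.
Qed.

Variables (Q : lmodType R) (f : forall n, {linear X n -> Q}).
Hypothesis fP : forall i j (h : (i <= j)%N) x, f j (ds_map h x) = f i x.

Lemma dlim_desc : exists g : {linear dlim X -> Q},
  forall n x, g (dlim_in X n x) = f n x.
Proof.
have f0 n x : dlim_in X n x = 0 -> f n x = 0.
  by move=> /dlim_inP[m [h x0]]; rewrite -(fP h) x0 raddf0.
have /choice[g gP] (u : dlim X) : exists q, forall n x, dlim_in X n x = u -> f n x = q.
  have [n [x xu]] := dlim_surj u; exists (f n x) => m y yu.
  pose k := maxn n m; pose hn : (n <= k)%N := leq_maxl n m.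
  pose hm : (m <= k)%N := leq_maxr n m.
  rewrite -(fP hn) -(fP hm); apply/eqP; rewrite -subr_eq0 -linearB; apply/eqP/f0.
  by rewrite linearB !dlim_in_comp xu yu subrr.
have g_lin : linear g.
  move=> a u v; have [n [x [y [<- <-]]]] := dlim_in_common u v.
  rewrite -(gP _ n x erefl) -(gP _ n y erefl) -linearP.
  by rewrite -(gP _ n (a *: x + y)) // linearP.
by exists (lin_of g_lin) => n x; rewrite /= (gP _ n x erefl).
Qed.
End DirectLimitUniversal.

Lemma common_bound (T : eqType) (P : T -> nat -> Prop) (s : seq T) :
  (forall x m n, (m <= n)%N -> P x m -> P x n) ->
  (forall x, x \in s -> exists n, P x n) ->
  exists n, forall x, x \in s -> P x n.
Proof.
move=> Pmono; elim: s => [|x s IHs] sP; first by exists 0%N.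
have [|n nP] := IHs; first by move=> y ys; apply: sP; rewrite inE ys orbT.
have [m mP] := sP x (mem_head _ _); exists (maxn n m) => y.
rewrite inE => /orP[/eqP ->|/nP]; first exact: Pmono (leq_maxr _ _) mP.
exact: Pmono (leq_maxl _ _).
Qed.

Lemma lincomb_eq (R : comNzRingType) (U V W : lmodType R) (f : {linear U -> W})
    (g : {linear V -> W}) r (a : 'I_r -> R) (x : 'I_r -> U) (y : 'I_r -> V) :
  (forall i, f (x i) = g (y i)) ->
  f (\sum_i a i *: x i) = g (\sum_i a i *: y i).
Proof.
by move=> fg; rewrite !linear_sum; apply: eq_bigr => i _; rewrite !linearZ fg.
Qed.

Lemma hom_sumE (R : comNzRingType) (U V : lmodType R) (T : Type) (s : seq T)
    (P : pred T) (f : T -> {linear U -> V}) x :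
  (\sum_(i <- s | P i) f i) x = \sum_(i <- s | P i) f i x.
Proof. by elim/big_rec2: _ => // i y z _ <-. Qed.

Section TransformHom.
Variables (R : comNzRingType) (I : ideal R) (M : lmodType R).

Lemma act_linear (m : M) : linear (fun a : R^o => a *: m).
Proof. by move=> a b c; rewrite scalerDl -scalerA. Qed.

Lemma act_pow n (m : M) (a : R^o) : ideal_pow_mul I n R^o a ->
  ideal_pow_mul I n M (lin_of (act_linear m) a).
Proof.
apply: (span_min (S := preimage (lin_of (act_linear m)) (ideal_pow_mul I n M))).
move=> _ [b [x [Ib _ ->]]].
rewrite -[preimage _ _ _]/(ideal_pow_mul I n M ((b * x) *: m)).
by rewrite -scalerA; exact: ideal_mul_mem.
Qed.

Definition act n (m : M) :
    {linear smod (ideal_pow_mul I n R^o) -> smod (ideal_pow_mul I n M)} :=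
  smap (@act_pow n m).

Lemma theta_exists (A : lmodType R) :
  exists t : {linear gen_ideal_transform I M A -> homod M (ideal_transform I A)},
  forall n (f : it_sys I M A n) m,
    t (dlim_in _ n f) m = dlim_in (it_sys I R^o A) n (homl A (act n m) f).
Proof.
have t_lin n (f : it_sys I M A n) :
    linear (fun m => dlim_in (it_sys I R^o A) n (homl A (act n m) f)).
  move=> a x y; rewrite -linearP; congr (dlim_in _ n _); apply: lin_eq => b.
  rewrite -[RHS]/(a *: f (act n x b) + f (act n y b)) -linearP.
  congr (f _); apply: val_inj => /=.
  by rewrite scalerDr !scalerA mulrC.
have t_lin2 n : linear (fun f : it_sys I M A n =>
    lin_of (@t_lin n f) : homod M (ideal_transform I A)).
  move=> a f g; apply: lin_eq => m.
  rewrite -[LHS]/(dlim_in (it_sys I R^o A) n (homl A (act n m) (a *: f + g))).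
  rewrite -[RHS]/(a *: dlim_in (it_sys I R^o A) n (homl A (act n m) f) +
    dlim_in (it_sys I R^o A) n (homl A (act n m) g)) -linearP.
  by congr (dlim_in _ n _); apply: lin_eq.
have [|t tE] := @dlim_desc R (it_sys I M A) (homod M (ideal_transform I A))
    (fun n => lin_of (@t_lin2 n)).
  move=> i j h f; apply: lin_eq => m.
  rewrite -[RHS](dlim_in_comp (X := it_sys I R^o A) h).
  rewrite -[LHS]/(dlim_in (it_sys I R^o A) j
    (homl A (act j m) (ds_map (d := it_sys I M A) h f))).
  congr (dlim_in _ j _).
  by apply: lin_eq => a /=; congr (f _); apply: val_inj.
by exists t => n f m; rewrite tE.
Qed.

Definition theta (A : lmodType R) :
    {linear gen_ideal_transform I M A -> fcomp (homF M) (ideal_transform I) A} :=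
  sval (cid (theta_exists A)).

Lemma thetaE (A : lmodType R) n (f : it_sys I M A n) m :
  theta A (dlim_in _ n f) m = dlim_in (it_sys I R^o A) n (homl A (act n m) f).
Proof. by rewrite /theta; case: cid => t /= ->. Qed.

Lemma theta_natural (A B : lmodType R) (f : {linear A -> B}) x :
  theta B (fmap (gen_ideal_transform I M) f x) =
  fmap (fcomp (homF M) (ideal_transform I)) f (theta A x).
Proof.
have [n [g <-]] := dlim_surj x; apply: lin_eq => m.
rewrite gen_ideal_transform_mapE [LHS]thetaE.
rewrite -[RHS]/(fmap (ideal_transform I) f (theta A (dlim_in _ n g) m)) thetaE.
by rewrite gen_ideal_transform_mapE; congr (dlim_in _ n _); apply: lin_eq.
Qed.

Hypothesis M_fg : fin_gen_module M.

Lemma ideal_pow_self n a : ideal_pow I n a -> ideal_pow_mul I n R^o a.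
Proof.
move=> Ia; rewrite -[a]mulr1.
by apply: (@ideal_mul_mem R (ideal_pow I n) R^o (submod_full _) a 1).
Qed.

Lemma ideal_pow_unself n a : ideal_pow_mul I n R^o a -> ideal_pow I n a.
Proof.
apply: ideal_mul_sub => b x Ib _.
by rewrite -[b *: x]/(b * x) mulrC; exact: (submodZ (S := ideal_pow I n)).
Qed.

(** Each generator [m] has its own exponent beyond which a |-> f (a m) vanishes. Being finitely
    many, they have a common one, and for such a large k the map [f] vanishes on I^k M, whose
    elements are sums of a m with [a] in I^k and [m] a generator. *)
Lemma theta_inj (A : lmodType R) : injective (theta A).
Proof.
apply: raddf_inj => u; have [n [f <-]] := dlim_surj u => f0.
have [s sE] := M_fg.
pose P m k := exists h : (n <= k)%N, forall a, ds_map (d := it_sys I R^o A) h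
  (homl A (act n m) f) a = 0.
have [m j k jk [h hP]|m ms|k kP] := @common_bound _ P s.
- exists (leq_trans h jk) => a.
  rewrite -[RHS](hP (it_incl I R^o jk a)) /=; congr (f _).
  exact: val_inj.
- have : theta A (dlim_in _ n f) m = 0 by rewrite f0.
  rewrite thetaE => /dlim_inP[k [h hP]]; exists k, h => a.
  by rewrite hP.
have [h _] : exists h : (n <= maxn n k)%N, True by exists (leq_maxl n k).
apply/dlim_inP; exists (maxn n k), h; apply: lin_eq => x /=.
pose K : submod M := image (smod_incl _) (ker f).
suff : K (val x) by move=> [y Ky xy]; rewrite -[RHS]Ky; congr (f _); apply: val_inj.
have xP := smodP x; apply: ideal_mul_sub xP => a m Ia _.
have scale_lin : linear (fun m : M => a *: m).
  by move=> c x1 x2; rewrite scalerDr !scalerA mulrC.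
have : span [set` s] m by rewrite -sE.
apply: (span_min (S := preimage (lin_of scale_lin) K)) => {}m /kP[hk kP'] /=.
have Ia' : ideal_pow_mul I k R^o a.
  by apply: ideal_pow_self; apply: ideal_pow_anti Ia; exact: leq_maxr.
exists (act n m (mk_smod (ideal_pow_mul_anti hk Ia'))) => //=.
by rewrite -[RHS](kP' (mk_smod Ia')); congr (f _); apply: val_inj.
Qed.

(* A map g into D_I(A) is given on the generators by maps I^n -> A; these
   define a map on I^k M as soon as they kill the relations with coefficients
   in I^k, which Artin-Rees provides for large k. *)
Lemma theta_surj (R_noeth : noetherian_ring R) (A : lmodType R) g :
  exists u, theta A u = g.
Proof.
have [s sE] := M_fg; pose r := size s; pose m (i : 'I_r) := s`_i.
pose g' : {linear M -> dlim (it_sys I R^o A)} := g.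
have [n [phi phiE]] : exists n (phi : 'I_r -> it_sys I R^o A n),
    forall i, dlim_in _ n (phi i) = g' (m i).
  have /choice[p pP] (i : 'I_r) : exists p : {n & it_sys I R^o A n},
      dlim_in _ (projT1 p) (projT2 p) = g' (m i).
    have [n [x xE]] := dlim_surj (g' (m i)).
    by exists (existT _ n x).
  pose n := (\max_(i < r) projT1 (p i))%N.
  have pn i : (projT1 (p i) <= n)%N by exact: (leq_bigmax i).
  exists n, (fun i => ds_map (pn i) (projT2 (p i))) => i.
  by rewrite dlim_in_comp pP.
have pi_lin : linear (fun v : 'rV[R]_r => \sum_i v 0 i *: m i).
  move=> a u v; rewrite scaler_sumr -big_split; apply: eq_bigr => i _.
  by rewrite !mxE scalerDl scalerA.
pose pi := lin_of pi_lin.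
have pi_delta i : pi (delta_mx 0 i) = m i.
  rewrite /= (bigD1 i) //= mxE !eqxx scale1r big1 ?addr0 // => j ji.
  by rewrite mxE eqxx (negbTE ji) scale0r.
have pi_surj x : exists v, pi v = x.
  have : span [set` s] x by rewrite -sE.
  suff /[apply] : forall x, span [set` s] x -> range pi x by case=> v _ ->; exists v.
  apply: span_min => y /(nthP 0)[i ltis <-].
  by exists (delta_mx 0 (Ordinal ltis)); rewrite // pi_delta.
have coord_lin i : linear (fun v : 'rV[R]_r => v 0 i : R^o).
  by move=> a u v; rewrite !mxE.
pose coord i := lin_of (coord_lin i).
pose F k : submod 'rV[R]_r := ideal_pow_mul I k 'rV[R]_r.
have coordF k i v : F k v -> ideal_pow_mul I k R^o (coord i v).
  pose S := preimage (coord i) (ideal_pow_mul I k R^o).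
  move: v; apply: (ideal_mul_sub (T := S)) => a u Ia _; rewrite {}/S.
  rewrite -[preimage _ _ _]/(ideal_pow_mul I k R^o (coord i (a *: u))) linearZ.
  exact: (ideal_mul_mem (S := submod_full _)).
pose crd k i : {linear smod (F k) -> smod (ideal_pow_mul I k R^o)} :=
  smap (@coordF k i).
(* [G] sends a multiple a e_i of a basis vector, with [a] in I^n, to [phi i a]. It is the lift to
   I^n R^r of the map to be found. *)
have G_lin : linear (fun v : smod (F n) => \sum_i phi i (crd n i v)).
  move=> a u v; rewrite scaler_sumr -big_split; apply: eq_bigr => i _.
  by rewrite !linearP.
pose G := lin_of G_lin.
pose Kill : submod 'rV[R]_r := image (smod_incl (F n)) (ker G).
pose K := ker pi; have [ks ksE] := noetherian_row R_noeth K.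
(* For a relation [w], the germ of the sum of the w_i phi_i is the value of [g] at pi w = 0. So it
   vanishes on some I^l, which means that [G] kills a w for [a] in I^l. One [l] serves for the
   finitely many generators of [K]. *)
have [w l l' ll' wl a Ia|w wks|l lP] := @common_bound _
    (fun w l => forall a, ideal_pow I l a -> Kill (a *: w)) ks.
- by apply: wl; exact: ideal_pow_anti Ia.
- have Kw : K w by rewrite ksE; exact: span_sub.
  have : dlim_in _ n (\sum_i w 0 i *: phi i) = 0.
    rewrite -[RHS](raddf0 g') -[X in _ = g' X]Kw.
    exact: (lincomb_eq (fun i => w 0 i) phiE).
  move=> /dlim_inP[l [nl l0]]; exists l => a Ia.
  have Ial : ideal_pow_mul I l R^o a by exact: ideal_pow_self.
  have aF : F n (a *: w).
    by apply: ideal_mul_mem => //; exact: ideal_pow_anti Ia.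
  exists (mk_smod aF) => //=.
  have E0 : (ds_map (d := it_sys I R^o A) nl (\sum_i w 0 i *: phi i)) (mk_smod Ial) = 0.
    by rewrite l0.
  rewrite -[RHS]E0.
  rewrite -[RHS]/((\sum_i w 0 i *: phi i) (it_incl I R^o nl (mk_smod Ial))) hom_sumE.
  apply: eq_bigr => i _; rewrite homZE -linearZ; congr (phi i _); apply: val_inj => /=.
  by rewrite mxE mulrC.
have [k kP] := artin_rees I K l R_noeth (noetherian_row R_noeth (n := r)).
have {lP}kP v : F k v -> K v -> Kill v.
  move=> Fv Kv; have := kP _ Fv Kv; apply: ideal_mul_sub => a w Ia.
  have scale_lin : linear (fun w : 'rV[R]_r => a *: w).
    by move=> c x1 x2; rewrite scalerDr !scalerA mulrC.
  rewrite ksE; apply: (span_min (S := preimage (lin_of scale_lin) Kill)) => x /lP.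
  exact.
(* [k'] is at least [n] for [G] to be defined on I^k' R^r, and at least [k] for it to kill the
   relations there. *)
have [k' [nk' kk']] : exists k', (n <= k')%N /\ (k <= k')%N.
  by exists (maxn n k); rewrite leq_maxl leq_maxr.
have piF v : F k' v -> ideal_pow_mul I k' M (pi v).
  pose S := preimage pi (ideal_pow_mul I k' M).
  move: v; apply: (ideal_mul_sub (T := S)) => a u Ia _; rewrite {}/S.
  rewrite -[preimage _ _ _]/(ideal_pow_mul I k' M (pi (a *: u))) linearZ.
  exact: ideal_mul_mem.
pose pik : {linear smod (F k') -> smod (ideal_pow_mul I k' M)} := smap piF.
have [||h hE] := @lin_surj_factor R _ _ A pik (G \o it_incl I _ nk').
- move=> y; suff [v Fv vy] : image pi (F k') (val y).
    by exists (mk_smod Fv); apply: val_inj.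
  have yP := smodP y; apply: ideal_mul_sub yP => a x Ia _.
  have [v <-] := pi_surj x; exists (a *: v); last by rewrite linearZ.
  exact: ideal_mul_mem.
- move=> v /(congr1 val) /= v0.
  have [|y Gy vy] := kP (val v) _ v0.
    exact: ideal_pow_mul_anti kk' _ (smodP v).
  by rewrite -[RHS]Gy; congr (G _); apply: val_inj.
pose hk : it_sys I M A k' := h.
exists (dlim_in _ k' hk); apply: lin_eq => x.
have : span [set` s] x by rewrite -sE.
pose th : {linear M -> dlim (it_sys I R^o A)} := theta A (dlim_in _ k' hk).
move=> xs; apply/eqP; rewrite -subr_eq0; apply/eqP.
apply: (span_min (S := ker (th - g' : {linear M -> dlim (it_sys I R^o A)}))) xs.
move=> {}x /(nthP 0)[i ltis <-].
suff E : th s`_i = g' s`_i by apply/eqP; rewrite subr_eq0; exact/eqP.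
have := phiE (Ordinal ltis); rewrite /m /= => <-.
rewrite /th thetaE -(dlim_in_comp (X := it_sys I R^o A) nk').
apply: (congr1 (dlim_in (it_sys I R^o A) k')); apply: lin_eq => a.
have aF : F k' (val a *: delta_mx 0 (Ordinal ltis)).
  by apply: ideal_mul_mem => //; apply: ideal_pow_unself; exact: smodP.
have -> : homl A (act k' s`_i) h a = h (pik (mk_smod aF)).
  congr (h _); apply: val_inj.
  by rewrite -[RHS]/(pi (val a *: delta_mx 0 (Ordinal ltis))) linearZ pi_delta.
rewrite hE /= (bigD1 (Ordinal ltis)) //= big1 ?addr0 => [|j ji].
  by congr (phi _ _); apply: val_inj; rewrite /= !mxE !eqxx mulr1.
rewrite -[RHS](raddf0 (phi j)); congr (phi j _); apply: val_inj.
by rewrite /= !mxE eqxx (negbTE ji) mulr0.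
Qed.
End TransformHom.

(** * D_I preserves injective modules *)

Section Baer.
Variables (R : comNzRingType) (E : lmodType R).

Definition baer := forall (K : ideal R) (f : {linear smod K -> E}),
  exists e : E, forall x, f x = val x *: e.

Lemma baer_injective : baer -> injective_mod E.
Proof.
move=> E_baer A B i f i_inj.
pose part (G : set (B * E)) :=
  (forall a z w, G z -> G w -> G (a *: z + w)) /\ (forall e, G (0, e) -> e = 0).
pose G : set (B * E) := [set z | exists a, z = (i a, f a)].
pose P : set (set (B * E)) := [set H | part H /\ ((exists z, H z) -> G `<=` H)].
have [|H [[[HP H0] GH] Hmax]] := @Zorn_bigcup _ P.
  move=> F FP Ftot; split; first split.
  - move=> a z w [X FX Xz] [Y FY Yw].
    have [XY|YX] := Ftot _ _ FX FY.
      by exists Y => //; apply: (FP _ FY).1.1 => //; exact: XY.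
    by exists X => //; apply: (FP _ FX).1.1 => //; exact: YX.
  - by move=> e [X FX Xe]; exact: (FP _ FX).1.2.
  move=> [z [X FX Xz]] w Gw; exists X => //.
  by apply: (FP _ FX).2 => //; exists z.
have {}GH : G `<=` H.
  apply: contrapT => nGH.
  have nH z : ~ H z by move=> Hz; apply: nGH; apply: GH; exists z.
  apply: (Hmax G); last first.
    split=> // [|_ w //]; split=> [a _ _ [x ->] [y ->]|e [x [/esym ix0 ->]]].
      by exists (a *: x + y); rewrite !linearP.
    have -> : x = 0 by apply: i_inj; rewrite ix0 raddf0.
    by rewrite raddf0.
  split=> [z /nH|GsubH] //; apply: (nH (i 0, f 0)); apply: GsubH.
have H00 : H 0 by apply: GH; exists 0; rewrite !raddf0.
pose HS : submod (B * E)%type := Submod H00 HP.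
have Hfun x e e' : H (x, e) -> H (x, e') -> e = e'.
  move=> He He'; apply/eqP; rewrite -subr_eq0; apply/eqP/H0.
  have : HS ((x, e) - (x, e')) by exact: submodB.
  by rewrite -[(x, e) - (x, e')]/(x - x, e - e') subrr.
have tot b : exists e, H (b, e).
  (* [K] is the ideal of the [a] for which [H] has a value at a b. By Baer's condition these values
     are a |-> a e0, so that giving [b] the value [e0] is consistent. *)
  pose K : ideal R := @Submod R R^o (fun a => exists e, H (a *: b, e))
    (ex_intro _ 0 (eq_ind_r (fun z => H (z, 0)) H00 (scale0r b)))
    (fun c a a' '(ex_intro e He) '(ex_intro e' He') =>
      ex_intro _ (c *: e + e')
       (eq_ind_r (fun z => H (z, c *: e + e')) (HP c _ _ He He')
         (etrans (scalerDl b (c *: a) a') (congr2 +%R (esym (scalerA c a b)) erefl)))).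
  have /choice[g gP] (x : smod K) : exists e, H (val x *: b, e) by exact: smodP x.
  have g_lin : linear g.
    move=> c x y; apply: (Hfun _ _ _ (gP _)).
    have := HP c _ _ (gP x) (gP y).
    by rewrite /= scalerDl -scalerA.
  have [e0 e0P] := E_baer K (lin_of g_lin).
  pose L : set (B * E) := [set z | exists h a, H h /\ z = h + (a *: b, a *: e0)].
  have HL : H `<=` L by move=> z Hz; exists z, 0; rewrite !scale0r addr0.
  apply: contrapT => nb; apply: (Hmax L).
    split=> // LH; apply: nb; exists e0; apply: LH; exists 0, 1.
    by rewrite !scale1r add0r.
  split; last by move=> _; exact: subset_trans GH HL.
  split=> [c _ _ [h [a [Hh ->]]] [h' [a' [Hh' ->]]]|e [[x d] [a [Hx []]]]].
    exists (c *: h + h'), (c * a + a'); split; first exact: (HP).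
    rewrite scalerDr addrACA; congr (_ + _).
    by rewrite !scalerDl -!scalerA.
  move=> /esym/eqP; rewrite addr_eq0 => /eqP xE -> .
  have Ka : K (- a) by exists d; rewrite scaleNr -xE.
  have := e0P (mk_smod Ka); rewrite /= => ge.
  have -> : d = g (mk_smod Ka).
    by apply: (Hfun x) => //; have := gP (mk_smod Ka); rewrite /= scaleNr -xE.
  by rewrite ge scaleNr addNr.
have [h hP] := choice tot.
have h_lin : linear h.
  move=> a x y; apply: (Hfun _ _ _ (hP _)).
  exact: (HP _ _ _ (hP x) (hP y)).
exists (lin_of h_lin) => a; apply: (Hfun (i a)) (hP _) _.
by apply: GH; exists a.
Qed.
End Baer.

Lemma ideal_transform_injective (R : comNzRingType) (I : ideal R) (J : lmodType R) :
  noetherian_ring R -> injective_mod J -> injective_mod (ideal_transform I J).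
Proof.
move=> R_noeth J_inj; apply: baer_injective => K g.
have K_fg : fin_gen_module (smod K : lmodType R).
  have [s sE] := R_noeth K.
  have sK x : x \in s -> K x by move=> xs; rewrite sE; exact: span_sub.
  (* No generator in [s] lies outside [K]; the default 0 only makes [incl] total. *)
  pose incl (x : R) : smod K := if pselect (K x) is left Kx then mk_smod Kx else 0.
  exists (map incl s); apply: submodP => x; split=> // _.
  have : image (smod_incl K) (span [set` map incl s]) (val x).
    have Ks y : K y -> span [set` s] y by rewrite sE.
    have xP := Ks _ (smodP x); apply: span_min xP => y ys.
    have Ky := sK y ys; exists (mk_smod Ky) => //; apply: span_sub.
    apply/mapP; exists y => //; rewrite /incl.
    by case: pselect => [Ky'|//]; apply: val_inj.
  by move=> [y sy xy]; have -> : x = y by exact: val_inj.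
have [u uE] := theta_surj K_fg R_noeth g.
have [n [f fu]] := dlim_surj u.
have KR x : ideal_pow_mul I n (smod K) x -> ideal_pow_mul I n R^o (smod_incl K x).
  apply: (span_min (S := preimage (smod_incl K) (ideal_pow_mul I n R^o))).
  move=> _ [a [y [Ia _ ->]]].
  exact: (ideal_mul_mem (S := submod_full R^o)).
have [|h hE] := J_inj _ _ (smap KR) f.
  by move=> x y /(congr1 val) /= xy; apply: val_inj; exact: val_inj.
(* For [x] in [K], multiplying the class of [h] by [x] gives the class of a |-> h (a x), which is a
   |-> f (a x) because a x lies in I^n K. *)
exists (dlim_in (it_sys I R^o J) n (h : it_sys I R^o J n)) => x.
rewrite -uE -fu thetaE -linearZ; apply: (congr1 (dlim_in (it_sys I R^o J) n)).
apply: lin_eq => a; rewrite [RHS]homZE -linearZ.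
rewrite -[LHS]/(f (act I n x a)) -hE; congr (h _); apply: val_inj.
by rewrite /= -[LHS]/(val a * val x) mulrC.
Qed.

(** * The spectral sequence of a bicomplex *)

Section BicomplexSS.
Variables (R : comNzRingType) (C : bicomplex R).

Lemma tot_eq (x y : tot C) : (forall p q, x p q = y p q) -> x = y.
Proof.
move=> xy; apply: functional_extensionality_dep => p.
exact: functional_extensionality_dep.
Qed.

Lemma tot_dd (x : tot C) : tot_d C (tot_d C x) = 0.
Proof.
apply: tot_eq => p q; rewrite /= -[RHS]/(0 : C p q) /tot_d_fun.
case: p q => [|[|p]] [|[|q]]; rewrite ?raddf0 ?scaler0 ?addr0 ?add0r //=;
  rewrite ?linearD ?linearZ /= ?bc_dhdh ?bc_dvdv ?bc_comm ?scaler0 ?addr0 ?add0r //.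
all: rewrite ?raddf0 ?scaler0 ?addr0 ?add0r.
all: rewrite ?scalerDr ?scalerA //.
all: by rewrite [X in _ + X *: _]exprS mulN1r scaleNr subrr.
Qed.

Lemma tot_part_le (s s' n n' : int) x : s' <= s -> n = n' ->
  tot_part C s n x -> tot_part C s' n' x.
Proof. by move=> s's <- sx p q pq; apply: sx; move: pq; lia. Qed.

Lemma tot_part_d s n x : tot_part C s n x -> tot_part C s (n + 1) (tot_d C x).
Proof.
move=> sx p q pq; rewrite /= /tot_d_fun.
case: p q pq => [|p] [|q] pq; rewrite ?scaler0 ?addr0 ?add0r //.
all: rewrite ?sx ?raddf0 ?scaler0 ?addr0 //.
all: move: pq; lia.
Qed.

Lemma bc_cycle_le (r r' s s' n n' : int) x : s' <= s -> s' + r' <= s + r -> n = n' ->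
  bc_cycle C r s n x -> bc_cycle C r' s' n' x.
Proof.
move=> s's sr nn' [x1 x2]; split; first exact: tot_part_le x1.
by apply: tot_part_le x2 => //; rewrite nn'.
Qed.

Lemma bc_cycle_d (r s n : int) x : bc_cycle C r s n x ->
  forall r' s' n' : int, s' = s + r -> n' = n + 1 -> bc_cycle C r' s' n' (tot_d C x).
Proof.
move=> [_ x2] r' s' n' -> ->; split=> //; rewrite tot_dd; exact: submod0.
Qed.

Lemma bc_page_eq0 r p q (x : smod (bc_cycle C r p (p + q))) :
  bc_page_cls x = 0 <->
  exists y z, [/\ bc_cycle C (r - 1) (p + 1) (p + q) y,
    bc_cycle C (r - 1) (p - r + 1) (p + q - 1) z & val x = y + tot_d C z].
Proof.
rewrite /bc_page_cls sqcls_eq0; split.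
  by move=> [y [_ [Cy [z Cz ->] ->]]]; exists y, z.
by move=> [y [z [Cy Cz ->]]]; exists y, (tot_d C z); split=> //; exists z.
Qed.

Lemma bc_page_d_cycle (r p q : int) x : bc_cycle C r p (p + q) x ->
  bc_cycle C r (p + r) (p + r + (q - r + 1)) (tot_d C x).
Proof. by move=> Cx; apply: bc_cycle_d Cx _ _ _ _ _; ring. Qed.

Lemma bc_page_d_boundary (r p q : int) x :
  submod_sum (bc_cycle C (r - 1) (p + 1) (p + q))
       (image (tot_d C) (bc_cycle C (r - 1) (p - r + 1) (p + q - 1))) x ->
  submod_sum (bc_cycle C (r - 1) (p + r + 1) (p + r + (q - r + 1)))
       (image (tot_d C) (bc_cycle C (r - 1) (p + r - r + 1)
         (p + r + (q - r + 1) - 1))) (tot_d C x).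
Proof.
move=> [y [_ [Cy [z _ ->] ->]]]; exists 0, (tot_d C y); split.
- exact: submod0.
- by exists y => //; apply: bc_cycle_le Cy; lia.
- by rewrite linearD tot_dd addr0 add0r.
Qed.

Definition bc_page_d (r p q : int) :
    {linear bc_page C r p q -> bc_page C r (p + r) (q - r + 1)} :=
  sqmap (@bc_page_d_cycle r p q) (@bc_page_d_boundary r p q).

Lemma bc_page_dE r p q x (y : smod (bc_cycle C r (p + r) (p + r + (q - r + 1)))) :
  val y = tot_d C (val x) -> bc_page_d r p q (bc_page_cls x) = bc_page_cls y.
Proof.
by move=> yx; rewrite /bc_page_d sqmapE; congr (sqcls _ _ _); apply: val_inj.
Qed.

Lemma bc_page_surj r p q (u : bc_page C r p q) : exists x, bc_page_cls x = u.
Proof. exact: sqcls_surj. Qed.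

Lemma bc_page_dd r p q (u : bc_page C r p q) :
  bc_page_d r (p + r) (q - r + 1) (bc_page_d r p q u) = 0.
Proof.
have [x <-] := bc_page_surj u; have Cx := bc_page_d_cycle (smodP x).
rewrite (bc_page_dE (y := mk_smod Cx)) //.
rewrite /bc_page_d sqmapE; apply/sqcls_eq0.
by rewrite -[val _]/(tot_d C (tot_d C (val x))) tot_dd; exact: submod0.
Qed.

(** As [(p, q)] lies outside the quadrant, F^p and F^(p+1) agree in total degree p + q, so every
    element of Z_r^p is in Z_(r-1)^(p+1), which is divided out. *)
Lemma bc_page_quadrant r p q (u : bc_page C r p q) : (p < 0) || (q < 0) -> u = 0.
Proof.
have [x <-] := bc_page_surj u => pq0; apply/bc_page_eq0.
have [x1 x2] := smodP x; exists (val x), 0; split.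
- split; last by apply: tot_part_le x2; lia.
  by move=> a b ab; apply: x1; move: ab pq0; lia.
- exact: submod0.
- by rewrite raddf0 addr0.
Qed.

(** The isomorphism is induced by the inclusion of Z_(r+1) in Z_r. If d_r kills the class of [x],
    then d x = y + d z with [z] in F^(P+1) and [y] in F^(P+r+1), so x - z is in Z_(r+1) and has the
    class of [x]. *)
Lemma bc_page_next (r : nat) (p q : int) :
  iso (bc_page C r.+1 (p + r%:Z) (q - r%:Z + 1))
    (subquot (ker (bc_page_d r (p + r%:Z) (q - r%:Z + 1))) (range (bc_page_d r p q))).
Proof.
set P := p + r%:Z; set Q := q - r%:Z + 1.
have sub x : bc_cycle C r.+1 P (P + Q) x -> bc_cycle C r P (P + Q) x.
  by apply: bc_cycle_le; lia.
have kerP (x : smod (bc_cycle C r.+1 P (P + Q))) :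
    ker (bc_page_d r P Q) (bc_page_cls (mk_smod (sub _ (smodP x)))).
  rewrite /ker /= (bc_page_dE (y := mk_smod (bc_page_d_cycle (sub _ (smodP x))))) //.
  apply/bc_page_eq0; exists (tot_d C (val x)), 0; split.
  - by apply: bc_cycle_d (smodP x) _ _ _ _ _; lia.
  - exact: submod0.
  - by rewrite raddf0 addr0.
pose g x : subquot (ker (bc_page_d r P Q)) (range (bc_page_d r p q)) :=
  sqcls _ _ (mk_smod (kerP x)).
have g_lin : linear g.
  move=> a x y; rewrite /g -linearP; congr (sqcls _ _ _); apply: val_inj.
  by rewrite /= /bc_page_cls -linearP; congr (sqcls _ _ _); apply: val_inj.
apply: (@subquot_iso _ _ _ _ _ (lin_of g_lin)) => [u|x].
  have [v <-] := sqcls_surj u; have [x xv] := bc_page_surj (val v).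
  have := smodP v; rewrite -xv /ker /=.
  rewrite (bc_page_dE (y := mk_smod (bc_page_d_cycle (smodP x)))) //.
  move=> /bc_page_eq0[y [z [Cy Cz xyz]]].
have {}xyz : tot_d C (val x) = y + tot_d C z := xyz.
  have Cz' : bc_cycle C (r%:Z - 1) (P + 1) (P + Q) z by apply: bc_cycle_le Cz; lia.
  have Cx : bc_cycle C r.+1 P (P + Q) (val x - z).
    split; first apply: submodB.
    - by case: (smodP x).
    - by case: Cz' => z1 _; apply: tot_part_le z1; lia.
    - by rewrite linearB xyz addrK; case: Cy => y1 _; apply: tot_part_le y1; lia.
  exists (mk_smod Cx); congr (sqcls _ _ _); apply: val_inj; rewrite /= -xv.
  apply/sqclsP; exists (- z), 0; split; [|exact: submod0|].
    by apply: submodN; apply: bc_cycle_le Cz'; lia.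
  by rewrite addr0 -[LHS]/(val x - z - val x) addrAC subrr add0r.
split.
  (* Here the class of [x] is d_r of that of [y], so x - d y = z + d w. Then x = z + d (y + w), and
     d z = d x lies in F^(P+r+1), as a boundary on the page r + 1 requires. *)
  move=> /sqcls_eq0[/= u _].
  have [y <-] := bc_page_surj u.
  rewrite (bc_page_dE (y := mk_smod (bc_page_d_cycle (smodP y)))) //.
  move=> /sqclsP[z [_ [Cz [w Cw ->] xyz]]].
  have {}xyz : val x - tot_d C (val y) = z + tot_d C w := xyz.
  exists z, (tot_d C (val y + w)); split.
  - case: Cz => z1 z2; split; first by apply: tot_part_le z1; lia.
    have -> : z = val x - tot_d C (val y) - tot_d C w by rewrite xyz addrK.
    rewrite !linearB !tot_dd !subr0; case: (smodP x) => _ x2.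
    by apply: tot_part_le x2; lia.
  - exists (val y + w) => //; apply: (submodD (S := bc_cycle C _ _ _)).
      by apply: bc_cycle_le (smodP y); lia.
    by apply: bc_cycle_le Cw; lia.
  - by rewrite linearD [RHS]addrCA -xyz [RHS]addrC subrK.
move=> [y [_ [Cy [z Cz ->] xyz]]]; apply/sqcls_eq0 => /=.
have Cz' : bc_cycle C r p (p + q) z by apply: bc_cycle_le Cz; lia.
exists (bc_page_cls (mk_smod Cz')) => //.
rewrite (bc_page_dE (y := mk_smod (bc_page_d_cycle (smodP (mk_smod Cz'))))) //.
apply/sqclsP; exists y, 0; split; [|exact: submod0|].
  by apply: bc_cycle_le Cy; lia.
by rewrite addr0 -[LHS]/(val x - tot_d C z) xyz addrK.
Qed.

Definition bicomplex_ss : spectral_sequence R :=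
  @SpectralSequence R (fun r => bc_page C r%:Z) (fun r => bc_page_d r%:Z)
    (fun r p q _ pq u => bc_page_quadrant u pq)
    (fun r p q u _ => bc_page_dd u)
    (fun r p q _ => bc_page_next r p q).

Lemma bicomplex_ssP : is_bicomplex_ss bicomplex_ss C.
Proof.
exists (fun r p q => idfun); split=> [r p q _|r p q x y _]; first by exists idfun.
exact: bc_page_dE.
Qed.
End BicomplexSS.

(** * Total cohomology and convergence *)

Section TotalInjection.
Variables (R : comNzRingType) (C : bicomplex R).

Definition tot_in p q (c : C p q) : tot C := fun p' q' =>
  match p =P p' with
  | ReflectT ep => match q =P q' with
      | ReflectT eq => eq_rect q (C p') (eq_rect p (fun i => C i q) c p' ep) q' eq
      | ReflectF _ => 0
      end
  | ReflectF _ => 0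
  end.

Lemma tot_in_id p q (c : C p q) : tot_in c p q = c.
Proof.
rewrite /tot_in; case: eqP => // ep; case: eqP => // eq.
by rewrite (eq_axiomK ep) (eq_axiomK eq).
Qed.

Lemma tot_in_ne p q (c : C p q) p' q' : (p' != p) || (q' != q) ->
  tot_in c p' q' = 0.
Proof.
rewrite /tot_in; case: eqP => // ep; case: eqP => // eq.
by case/orP=> /eqP []; exact: esym.
Qed.

Lemma tot_in0 p q : tot_in (0 : C p q) = 0.
Proof.
apply: tot_eq => p' q'.
have [->|pp] := eqVneq p' p; last by rewrite tot_in_ne ?pp.
have [->|qq] := eqVneq q' q; last by rewrite tot_in_ne ?qq ?orbT.
by rewrite tot_in_id.
Qed.

Lemma tot_in_linear p q : linear (@tot_in p q).
Proof.
move=> a x y; apply: tot_eq => p' q'.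
rewrite -[RHS]/(a *: tot_in x p' q' + tot_in y p' q').
have [->|pp] := eqVneq p' p; last by rewrite !tot_in_ne ?pp ?scaler0 ?addr0.
have [->|qq] := eqVneq q' q; last by rewrite !tot_in_ne ?qq ?orbT ?scaler0 ?addr0.
by rewrite !tot_in_id.
Qed.

Lemma tot_in_part p q (c : C p q) (s n : int) : s <= p%:Z -> p%:Z + q%:Z = n ->
  tot_part C s n (tot_in c).
Proof. by move=> sp pqn p' q' pq'; apply: tot_in_ne; lia. Qed.

Lemma tot_d_in p q (c : C p q) : tot_d C (tot_in c) =
  tot_in (bc_dh C p q c) + tot_in ((-1) ^+ p *: bc_dv C p q c).
Proof.
apply: tot_eq => p' q'; rewrite -[RHS]/(tot_in _ p' q' + tot_in _ p' q').
rewrite /= /tot_d_fun; congr (_ + _).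
  case: p' => [|p']; first by rewrite tot_in_ne.
  have [->|pp] := eqVneq p' p; last by rewrite !tot_in_ne ?raddf0 ?pp // eqSS pp.
  have [->|qq] := eqVneq q' q; last by rewrite !tot_in_ne ?raddf0 ?qq ?orbT.
  by rewrite !tot_in_id.
case: q' => [|q']; first by rewrite scaler0 tot_in_ne ?orbT.
have [->|pp] := eqVneq p' p; last by rewrite !tot_in_ne ?raddf0 ?scaler0 ?pp.
have [->|qq] := eqVneq q' q; last first.
  by rewrite !tot_in_ne ?raddf0 ?scaler0 ?qq ?orbT // eqSS qq orbT.
by rewrite !tot_in_id.
Qed.

Lemma tot_d_in_part p q (c : C p q) (s n : int) : bc_dv C p q c = 0 ->
  s <= p%:Z + 1 -> p%:Z + q%:Z + 1 = n -> tot_part C s n (tot_d C (tot_in c)).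
Proof.
move=> c0 sp pqn; rewrite tot_d_in c0 scaler0 tot_in0 addr0.
by apply: tot_in_part; lia.
Qed.
End TotalInjection.

Section TotalCohomology.
Variables (R : comNzRingType) (C : bicomplex R).

Program Definition tot_cocycle (n : int) : submod (tot C) := @Submod R (tot C)
  (fun x => tot_part C 0 n x /\ tot_d C x = 0) _ _.
Next Obligation.
by move=> n; split; [exact: submod0|rewrite (raddf0 (tot_d C))].
Qed.
Next Obligation.
move=> n a x y [x1 x2] [y1 y2]; split; first exact: submodZD.
by rewrite (linearP (tot_d C)) x2 y2 scaler0 addr0.
Qed.

Definition tot_coboundary (n : int) : submod (tot C) :=
  image (tot_d C) (tot_part C 0 (n - 1)).

Definition tot_coh (n : int) : lmodType R :=
  subquot (tot_cocycle n) (tot_coboundary n).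

(** The filtration is by the classes that have a representative in F^p. The bound r >= n + 2 makes
    F^(p+r) zero in degree n + 1, so that Z_r^p consists of cocycles, and makes p - r + 1 negative,
    so that no coboundary lying in F^p is missed. *)
Lemma tot_converges (H : nat -> lmodType R) :
  (forall n : nat, iso (tot_coh n) (H n)) -> converges (bicomplex_ss C) H.
Proof.
move=> HH n; have [e eb] := HH n; have e_inj := bij_inj eb.
pose cls : {linear smod (tot_cocycle n) -> H n} := e \o sqcls _ _.
pose Phi (p : nat) := image cls (preimage (smod_incl _) (tot_part C p n)).
exists Phi; split.
- move=> h; have [u uh] := bij_surj eb h; have [x xu] := sqcls_surj u.
  exists x; last by rewrite /= xu.
  by case: (smodP x).
- by move=> p h [x xp ->]; exists x => //; apply: tot_part_le xp; lia.
- move=> h [x xn ->]; suff -> : x = 0 by rewrite raddf0.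
  apply: val_inj; apply: tot_eq => p q; apply: xn; lia.
move=> p q r pqn rn.
have pqn' : p%:Z + q%:Z = n%:Z by lia.
have cyc x : bc_cycle C r p (p%:Z + q%:Z) x -> tot_cocycle n x.
  move=> [x1 x2]; split; first by apply: tot_part_le x1; lia.
  by apply: tot_eq => p' q'; apply: x2; lia.
have PhiP (x : smod (bc_cycle C r p (p%:Z + q%:Z))) :
    Phi p (cls (mk_smod (cyc _ (smodP x)))).
  exists (mk_smod (cyc _ (smodP x))) => //.
  by have [x1 _] := smodP x; apply: tot_part_le x1; lia.
have g_lin : linear (fun x => sqcls (Phi p) (Phi p.+1) (mk_smod (PhiP x))).
  move=> a x y; rewrite -linearP; congr (sqcls _ _ _); apply: val_inj.
  rewrite -[RHS]/(a *: cls (mk_smod (cyc _ (smodP x))) +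
    cls (mk_smod (cyc _ (smodP y)))).
  by rewrite -[RHS]linearP; apply: (congr1 cls); apply: val_inj.
apply: (@subquot_iso _ _ _ _ _ (lin_of g_lin)) => [u|x].
  have [v <-] := sqcls_surj u; have [x xp xv] := smodP v.
  have Cx : bc_cycle C r p (p%:Z + q%:Z) (val x).
    split; first by apply: tot_part_le xp; lia.
    by have [_ ->] := smodP x; exact: submod0.
  exists (mk_smod Cx); congr (sqcls _ _ _); apply: val_inj.
  by rewrite xv; apply: (congr1 cls); apply: val_inj.
split.
  move=> /sqcls_eq0[y yp xy].
  have : sqcls _ (tot_coboundary n) (mk_smod (cyc _ (smodP x))) = sqcls _ _ y.
    exact: e_inj.
  move=> /sqclsP[w wn xyw]; exists (val y), (tot_d C w); split.
  - split; first by apply: tot_part_le yp; lia.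
    by have [_ ->] := smodP y; exact: submod0.
  - exists w => //; split; first by apply: tot_part_le wn; lia.
    rewrite -xyw; apply: submodB.
      by have [x1 _] := smodP x; apply: tot_part_le x1; lia.
    by apply: tot_part_le yp; lia.
  - by rewrite -xyw [RHS]addrC subrK.
move=> [y [_ [Cy [z Cz ->] xyz]]]; apply/sqcls_eq0.
have Cy' : tot_cocycle n y.
  case: Cy => y1 y2; split; first by apply: tot_part_le y1; lia.
  by apply: tot_eq => p' q'; apply: y2; lia.
exists (mk_smod Cy'); first by case: Cy => y1 _; apply: tot_part_le y1; lia.
rewrite [LHS]/=; congr (e _); apply/sqclsP; exists z.
  by case: Cz => z1 _ p' q' pq; apply: z1; lia.
by rewrite -[LHS]/(val x - y) xyz [LHS]addrC addKr.
Qed.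

Section RowsExact.
Variables (A : cochain R) (aug : forall q, {linear A q -> C 0%N q}).
Hypothesis aug_d : forall q x, bc_dv C 0 q (aug q x) = aug q.+1 (cc_d A q x).
Hypothesis aug_inj : forall q, injective (aug q).
Hypothesis aug_exact : forall q x, bc_dh C 0 q x = 0 <-> exists a, x = aug q a.
Hypothesis row_exact : forall p q x, bc_dh C p.+1 q x = 0 ->
  exists y, x = bc_dh C p q y.

(* The rightmost nonzero component of [x] is a row cocycle, hence can be removed
   by the differential of an element one column to the left. *)
Lemma staircase (k n : nat) x : tot_part C 0 n x ->
  (forall p q, tot_d C x p.+1 q = 0) -> (forall p q, (k < p)%N -> x p q = 0) ->
  exists2 w, tot_part C 0 (n%:Z - 1) w &
    forall p q, (0 < p)%N -> (x - tot_d C w) p q = 0.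
Proof.
elim: k x => [|k IHk] x xn dx xk.
  exists 0; first exact: submod0.
  by move=> p q p0; rewrite raddf0 subr0; exact: xk.
have [ltnk|lekn] := ltnP n k.+1.
  apply: IHk => // p q kp; apply: xn; lia.
pose q0 := (n - k.+1)%N; have q0E : (k.+1 + q0 = n)%N by rewrite subnKC.
(* The component of d x at [(k.+2, q0)] is the horizontal differential of [x k.+1 q0], because [x]
   vanishes in the column [k.+2]. *)
have [b bE] : exists y, x k.+1 q0 = bc_dh C k q0 y.
  apply: row_exact; have := dx k.+1 q0; rewrite /= /tot_d_fun.
  by case: (q0) => [|q1]; rewrite ?[x k.+2 _]xk // ?raddf0 ?scaler0 addr0.
have [|||w wn w0] := IHk (x - tot_d C (tot_in b)).
- apply: submodB => //; rewrite -[n%:Z](subrK 1); apply: tot_part_d.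
  by apply: tot_in_part; lia.
- by move=> p q; rewrite linearB tot_dd subr0.
- move=> p q kp; rewrite -[LHS]/(x p q - tot_d C (tot_in b) p q).
  have -> : tot_d C (tot_in b) p q = tot_in (bc_dh C k q0 b) p q.
    rewrite tot_d_in -[LHS]/(tot_in _ p q + tot_in _ p q).
    by rewrite [X in _ + X]tot_in_ne ?addr0 //; lia.
  have [-> {kp}|pk] := eqVneq p k.+1; last first.
    by rewrite xk ?tot_in_ne ?pk ?subr0 //; lia.
  have [->|qq] := eqVneq q q0; first by rewrite tot_in_id bE subrr.
  by rewrite tot_in_ne ?qq ?orbT // subr0; apply: xn; lia.
exists (tot_in b + w).
  by apply: submodD => //; apply: tot_in_part; lia.
move=> p q p0; have -> : tot_d C (tot_in b + w) = tot_d C (tot_in b) + tot_d C w.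
  exact: linearD.
by rewrite opprD addrA; exact: w0.
Qed.

(** [staircase] moves a total cocycle into the column 0 without changing its class. Its horizontal
    differential is then zero, so that it comes from [A] through [aug], and injectivity of [aug]
    makes the preimage a cocycle. *)
Lemma tot_coh_iso (n : nat) : iso (tot_coh n) (cohomology A n).
Proof.
apply: iso_sym.
have dh_aug q a : bc_dh C 0 q (aug q a) = 0 by apply/aug_exact; exists a.
have cocP (a : smod (cocycle A n)) : tot_cocycle n (tot_in (aug n (val a))).
  split; first by apply: tot_in_part; lia.
  by rewrite tot_d_in dh_aug aug_d [cc_d _ _ _](smodP a) raddf0 scaler0 !tot_in0 addr0.
have g_lin : linear (fun a => sqcls _ (tot_coboundary n) (mk_smod (cocP a))).
  move=> c a b; rewrite -linearP; congr (sqcls _ _ _); apply: val_inj.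
  by rewrite /= -tot_in_linear -linearP.
apply: (@subquot_iso _ _ _ _ _ (lin_of g_lin)) => [u|a].
  have [x <-] := sqcls_surj u; have [xn dx] := smodP x.
  have [p q|p q np|w wn w0] := @staircase n n (val x) xn.
  - by rewrite dx.
  - by apply: xn; lia.
  pose y := val x - tot_d C w.
  have dy : tot_d C y = 0 by rewrite linearB tot_dd dx subr0.
  have [a ya] : exists a, y 0%N n = aug n a.
    apply/aug_exact; have : tot_d C y 1 n = 0 by rewrite dy.
    rewrite /= /tot_d_fun.
    by case: (n) => [|m]; rewrite ?[y 1%N _]w0 ?raddf0 ?scaler0 ?addr0.
  have a0 : cocycle A n a.
    apply: aug_inj; rewrite raddf0 -aug_d -ya.
    have : tot_d C y 0 n.+1 = 0 by rewrite dy.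
    by rewrite /= /tot_d_fun add0r expr0 scale1r.
  have yE : y = tot_in (aug n a).
    apply: tot_eq => p q.
    have [->|p0] := eqVneq p 0%N; last by rewrite tot_in_ne ?p0 // [LHS]w0 // lt0n.
    have [->|qn] := eqVneq q n; first by rewrite tot_in_id.
    rewrite tot_in_ne ?qn ?orbT //.
    rewrite -[LHS]/(val x 0%N q - tot_d C w 0%N q) xn ?sub0r; last by lia.
    by have := tot_part_d wn; rewrite subrK => ->; rewrite ?oppr0 //; lia.
  exists (mk_smod a0); apply/sqclsP; exists (- w); first exact: submodN.
  by rewrite linearN -[LHS]/(tot_in (aug n a) - val x) -yE addrAC subrr add0r.
split.
  move=> /sqcls_eq0[w wn]; rewrite -[LHS]/(tot_in _) => aw.
  case: (n) a aw wn => [|m] a aw wn.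
    apply: aug_inj; rewrite raddf0 -[LHS]tot_in_id aw.
    have -> : w = 0 by apply: tot_eq => p q; apply: wn; lia.
    by rewrite raddf0.
  have wm : tot_part C 0 m w by apply: tot_part_le wn; lia.
  (* [w] need not be a cocycle, but its differential lies in the column 0, which is all that
     [staircase] asks. *)
  have [p q|p q mp|v vm v0] := @staircase m m w wm.
  - by rewrite -aw tot_in_ne.
  - by apply: wm; lia.
  pose y := w - tot_d C v.
  have dy : tot_d C y = tot_in (aug m.+1 (val a)) by rewrite linearB tot_dd subr0 -aw.
  have [b yb] : exists b, y 0%N m = aug m b.
    apply/aug_exact; have : tot_d C y 1 m = 0 by rewrite dy tot_in_ne.
    rewrite /= /tot_d_fun.
    by case: (m) => [|m']; rewrite ?[y 1%N _]v0 ?raddf0 ?scaler0 ?addr0.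
  exists b => //; apply: aug_inj; rewrite -aug_d -yb.
  have : tot_d C y 0 m.+1 = aug m.+1 (val a) by rewrite dy tot_in_id.
  by rewrite /= /tot_d_fun add0r expr0 scale1r.
move=> aB; apply/sqcls_eq0; rewrite -[val _]/(tot_in (aug n (val a))).
case: (n) a aB => [|m] a; first move=> aB.
  by have -> : val a = 0 := aB; rewrite (raddf0 (aug 0%N)) tot_in0; exact: submod0.
move=> [b _ ->]; exists (tot_in (aug m b)); first by apply: tot_in_part; lia.
by rewrite tot_d_in dh_aug tot_in0 add0r expr0 scale1r aug_d.
Qed.
End RowsExact.
End TotalCohomology.

(** * The second page *)

Section SecondPage.
Variables (R : comNzRingType) (C : bicomplex R) (q : nat) (H : cochain R).
(* [f] identifies [H p] with the cohomology in degree [q] of the column [p]. *)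
Variable f : forall p, {linear C p q -> H p}.
Hypothesis f_coboundary : forall p x, coboundary (bc_col C p) q x -> f p x = 0.
Hypothesis f_ker : forall p x, bc_dv C p q x = 0 -> f p x = 0 ->
  coboundary (bc_col C p) q x.
Hypothesis f_surj : forall p h, exists2 x, bc_dv C p q x = 0 & f p x = h.
Hypothesis f_d : forall p x, bc_dv C p q x = 0 ->
  f p.+1 (bc_dh C p q x) = cc_d H p (f p x).

Lemma tot_d_first (p : nat) (n : int) (x : tot C) q' : tot_part C p n x ->
  tot_d C x p q'.+1 = (-1) ^+ p *: bc_dv C p q' (x p q').
Proof.
move=> xp; rewrite [LHS]/= /tot_d_fun; case: p xp => [|p] xp; first by rewrite add0r.
by rewrite xp ?raddf0 ?add0r //; lia.
Qed.

(** The [match] is the vertical term of [tot_d_fun] at [(p, q)]; for [q = 0] it is zero, and so are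
    the coboundaries. *)
Lemma vertical_coboundary p (x : tot C) : coboundary (bc_col C p) q
  ((-1) ^+ p *: match q as k return C p k with
                | 0 => 0
                | k.+1 => bc_dv C p k (x p k)
                end).
Proof.
case: (q) => [|q'].
  by rewrite scaler0; exact: (submod0 (coboundary (bc_col C p) 0)).
by exists ((-1) ^+ p *: x p q'); rewrite // linearZ.
Qed.

Lemma col_coboundary_tot p x : coboundary (bc_col C p) q x ->
  exists2 z, tot_part C p (p%:Z + q%:Z - 1) z & tot_d C z p q = x.
Proof.
case: (q) x => [|q'] x; first move=> x0.
  have -> : x = 0 := x0; exists 0; first exact: submod0.
  by rewrite (raddf0 (tot_d C)).
move=> [y _ ->]; exists (tot_in ((-1) ^+ p *: (y : C p q'))).
  by apply: tot_in_part; lia.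
have E : (-1) ^+ p *: bc_dv C p q' ((-1) ^+ p *: (y : C p q')) = bc_dv C p q' y.
  by rewrite linearZ signrZK.
rewrite tot_d_in E -[LHS]/(tot_in _ _ _ + tot_in _ _ _).
by rewrite tot_in_id tot_in_ne ?add0r //; lia.
Qed.

(** A preimage under the differential of [H] lifts to a vertical cocycle in the column p - 1, whose
    total differential is purely horizontal. *)
Lemma lift_coboundary p (c : C p q) : coboundary H p (f p c) ->
  exists2 z, bc_cycle C 1 (p%:Z - 1) (p%:Z + q%:Z - 1) z &
    bc_dv C p q (tot_d C z p q) = 0 /\ f p (tot_d C z p q) = f p c.
Proof.
case: p c => [|p] c.
  move=> c0; have fc : f 0%N c = 0 := c0.
  exists 0; first exact: submod0.
  by rewrite (raddf0 (tot_d C)) fc; split; exact: raddf0.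
move=> [h _ fc]; have [z0 dvz0 fz0] := f_surj h.
exists (tot_in z0).
  by split; [apply: tot_in_part; lia|apply: tot_d_in_part => //; lia].
by rewrite tot_d_in dvz0 scaler0 tot_in0 addr0 tot_in_id bc_comm dvz0 raddf0 f_d ?fz0.
Qed.

(** The map takes [x] to the class of its component at [(p, q)]. For [x] in Z_2^p this component is
    a vertical cocycle, and its horizontal differential is cancelled by the vertical differential of
    the next component, hence is zero in [H]. *)
Lemma page2_iso p : iso (bc_page C 2 p%:Z q%:Z) (cohomology H p).
Proof.
set n := p%:Z + q%:Z.
have dv0 x : bc_cycle C 2 p n x -> bc_dv C p q (x p q) = 0.
  move=> [x1 x2]; have := tot_d_first q x1; rewrite x2; last by lia.
  by move=> /esym/(congr1 ( *:%R ((-1) ^+ p))); rewrite signrZK scaler0.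
have dh0 x : bc_cycle C 2 p n x -> cocycle H p (f p (x p q)).
  move=> Cx; rewrite /cocycle /ker /= -f_d ?dv0 //; apply: f_coboundary.
  case: Cx => x1 x2; have : tot_d C x p.+1 q = 0 by apply: x2; lia.
  move=> /eqP; rewrite addr_eq0 => /eqP; rewrite -[LHS]/(bc_dh C p q (x p q)) => ->.
  by apply: (submodN (S := coboundary _ _)); exact: vertical_coboundary.
have fx_lin : linear (fun x : smod (bc_cycle C 2 p n) =>
    sqcls (cocycle H p) (coboundary H p) (mk_smod (dh0 _ (smodP x)))).
  move=> a x y; rewrite -linearP; congr (sqcls _ _ _); apply: val_inj.
  by rewrite -[RHS]/(a *: f p (val x p q) + f p (val y p q)) -linearP.
apply: (@subquot_iso _ _ _ _ _ (lin_of fx_lin)) => [u|x].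
  have [h <-] := sqcls_surj u; have hP := smodP h.
  have [x0 dvx fx] := f_surj (val h).
  (* [x0] alone gives an element of Z_1^p. Subtracting [z], which starts in the column p + 1,
     cancels the horizontal differential and leads into Z_2^p. *)
  have [z zp dz] : exists2 z, tot_part C p.+1 n z & tot_d C z p.+1 q = bc_dh C p q x0.
    have [|z zp dz] := @col_coboundary_tot p.+1 (bc_dh C p q x0).
      apply: f_ker; first by rewrite bc_comm dvx raddf0.
      by rewrite f_d // fx; exact: hP.
    by exists z => //; apply: tot_part_le zp; lia.
  have Cx : bc_cycle C 2 p n (tot_in x0 - z).
    split; first apply: submodB.
    - exact: tot_in_part.
    - by apply: tot_part_le zp; lia.
    have dxp : tot_part C p.+1 (n + 1) (tot_d C (tot_in x0 - z)).
      rewrite linearB; apply: submodB; first by apply: tot_d_in_part => //; lia.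
      exact: tot_part_d.
    move=> p' q' pq; have [pq'|] := boolP ((p' == p.+1) && (q' == q)); last first.
      by move=> pq'; apply: dxp; lia.
    move: pq' pq => /andP[/eqP -> /eqP ->] _.
    rewrite linearB -[LHS]/(tot_d C (tot_in x0) p.+1 q - tot_d C z p.+1 q) dz.
    by rewrite tot_d_in dvx scaler0 tot_in0 addr0 tot_in_id subrr.
  exists (mk_smod Cx); congr (sqcls _ _ _); apply: val_inj => /=.
  rewrite -fx; congr (f p _); rewrite -[LHS]/(tot_in x0 p q - z p q).
  by rewrite tot_in_id zp ?subr0 //; lia.
(* Up to a vertical coboundary, the component of d z at [(p, q)] is the horizontal differential of a
   vertical cocycle in the column p - 1; for [p = 0] there is no such column. *)
have fd (z : tot C) : bc_cycle C 1 (p%:Z - 1) (n - 1) z ->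
    coboundary H p (f p (tot_d C z p q)).
  move=> [z1 z2]; case: (p) z1 z2 => [|p'] z1 z2.
    have -> : tot_d C z 0 q = 0 + (-1) ^+ 0 *: match q as k return C 0%N k with
        | 0 => 0 | k.+1 => bc_dv C 0%N k (z 0%N k) end by [].
    rewrite add0r f_coboundary; last exact: vertical_coboundary.
    exact: (submod0 (coboundary H 0)).
  have zp : tot_part C p' (n - 1) z by apply: tot_part_le z1; lia.
  have dvz : bc_dv C p' q (z p' q) = 0.
    have := tot_d_first q zp; rewrite z2; last by lia.
    by move=> /esym/(congr1 ( *:%R ((-1) ^+ p'))); rewrite signrZK scaler0.
  exists (f p' (z p' q)) => //; rewrite -f_d // -[RHS]addr0.
  rewrite -(f_coboundary (vertical_coboundary p'.+1 z)) -linearD; congr (f _ _).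
split.
  move=> /sqcls_eq0 /= fxB.
  (* [z1] accounts for the coboundary in [H] and [z2] for the vertical coboundary that remains. What
     is left of [x] has no component at [(p, q)], hence lies in F^(p+1). *)
  have [z1 Cz1 [dvz1 fz1]] := lift_coboundary fxB.
  have [|z2 z2p dz2] := @col_coboundary_tot p (val x p q - tot_d C z1 p q).
    apply: f_ker; rewrite linearB ?fz1 ?subrr // dvz1 dv0 ?subr0 //.
    exact: smodP.
  have Cz2 : bc_cycle C 1 (p%:Z - 1) (n - 1) z2.
    split; first by apply: tot_part_le z2p; lia.
    by apply: tot_part_le (tot_part_d z2p); lia.
  have Cz := submodD Cz1 Cz2; have [x1 x2] := smodP x.
  exists (val x - tot_d C (z1 + z2)), (tot_d C (z1 + z2)); split; last by rewrite subrK.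
    split; last by rewrite linearB tot_dd subr0; apply: tot_part_le x2; lia.
    move=> p' q' pq.
    have [/andP[/eqP -> /eqP ->]|pq'] := boolP ((p' == p) && (q' == q)).
      have -> : tot_d C (z1 + z2) = tot_d C z1 + tot_d C z2 by exact: linearD.
      rewrite -[LHS]/(val x p q - (tot_d C z1 p q + tot_d C z2 p q)) dz2.
      by rewrite [X in _ - X]addrC subrK subrr.
    rewrite -[LHS]/(val x p' q' - tot_d C (z1 + z2) p' q') x1; last by lia.
    by case: Cz => _ ->; rewrite ?subr0 //; lia.
  by exists (z1 + z2) => //; apply: bc_cycle_le Cz; lia.
move=> [y [_ [[y1 _] [z Cz ->] xyz]]]; apply/sqcls_eq0.
rewrite -[val _]/(f p (val x p q)) xyz -[(y + _) p q]/(y p q + tot_d C z p q).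
by rewrite y1 ?add0r; [apply: fd; apply: bc_cycle_le Cz; lia|lia].
Qed.
End SecondPage.

(** * Cartan-Eilenberg resolutions *)

Section ResolutionTransport.
Variables (R : comNzRingType) (N N' : lmodType R) (J J' : cochain R).
Variables (aug : {linear N -> J 0%N}) (aug' : {linear N' -> J' 0%N}).
Variables (f : {linear N -> N'}) (g : forall p, {linear J p -> J' p}).
Hypothesis f_bij : bijective f.
Hypothesis g_bij : forall p, bijective (g p).
Hypothesis g_d : forall p x, g p.+1 (cc_d J p x) = cc_d J' p (g p x).
Hypothesis fg_aug : forall y, aug' (f y) = g 0%N (aug y).

Lemma injective_iso (E E' : lmodType R) :
  iso E E' -> injective_mod E -> injective_mod E'.
Proof.
move=> [h hb] E_inj A B i k i_inj; have [h' [hK h'K]] := lin_inverse hb.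
have [l lE] := E_inj _ _ i (h' \o k) i_inj.
by exists (h \o l) => a /=; rewrite lE /= h'K.
Qed.

Lemma resolution_iso : is_inj_resolution aug -> is_inj_resolution aug'.
Proof.
case=> J_inj aug_inj ex0 exS.
have g_inj p := bij_inj (g_bij p); have g_surj p := bij_surj (g_bij p).
have coc p x : cocycle J' p (g p x) <-> cocycle J p x.
  rewrite /cocycle /ker /= -g_d; split=> [gx|->]; last by rewrite raddf0.
  by apply: g_inj; rewrite gx raddf0.
split.
- by move=> p; apply: injective_iso (J_inj p); exists (g p).
- move=> x' y'; have [x <-] := bij_surj f_bij x'; have [y <-] := bij_surj f_bij y'.
  by rewrite !fg_aug => /g_inj/aug_inj ->.
- move=> x'; have [x <-] := g_surj 0%N x'; rewrite coc ex0; split=> [[y _ ->]|[y' _]].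
    by exists (f y) => //; rewrite fg_aug.
  have [y <-] := bij_surj f_bij y'; rewrite fg_aug => /g_inj ->; by exists y.
move=> p x'; have [x <-] := g_surj p.+1 x'; rewrite coc exS; split=> [[y _ ->]|[y' _]].
  by exists (g p y) => //; rewrite g_d.
by have [y <-] := g_surj p y'; rewrite -g_d => /g_inj ->; exists y.
Qed.
End ResolutionTransport.

Section SubquotientResolution.
Variables (R : comNzRingType) (X : cochain R) (Z B : forall p, submod (X p)).
Variables (dZ : forall p x, Z p x -> Z p.+1 (cc_d X p x)).
Variables (dB : forall p x, B p x -> B p.+1 (cc_d X p x)).
Variables (N N' : lmodType R) (J : cochain R) (aug : {linear N -> J 0%N}).
Variables (f : {linear N -> N'}) (g : forall p, {linear J p -> X p}).
Variable aug' : {linear N' -> subquot (Z 0%N) (B 0%N)}.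
Hypothesis f_bij : bijective f.
Hypothesis gZ : forall p x, Z p (g p x).
Hypothesis gB : forall p x, B p (g p x) -> x = 0.
Hypothesis g_gen : forall p z, Z p z -> exists x, B p (z - g p x).
Hypothesis g_d : forall p x, B p.+1 (g p.+1 (cc_d J p x) - cc_d X p (g p x)).
Hypothesis fg_aug : forall y, aug' (f y) = sqcls _ _ (mk_smod (gZ (aug y))).

(** [g p] identifies [J p] with Z p / B p and has to respect the differentials only modulo [B]. This
    serves for the rows of cocycles, coboundaries and cohomology of the columns, where the [g p] are
    inclusions of factors. *)
Lemma subquot_resolution : is_inj_resolution aug ->
  is_inj_resolution (J := sq_cochain dZ dB) aug'.
Proof.
have h_lin p : linear (fun x => sqcls (Z p) (B p) (mk_smod (gZ x))).
  move=> a x y; rewrite -linearP; congr (sqcls _ _ _); apply: val_inj.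
  by rewrite -[RHS]/(a *: g p x + g p y) -linearP.
apply: (resolution_iso (J' := sq_cochain dZ dB)
  (g := fun p => lin_of (@h_lin p)) f_bij).
- move=> p; apply: bijP; first by apply: raddf_inj => x /sqcls_eq0 /gB.
  move=> u; have [z <-] := sqcls_surj u; have [x zx] := g_gen (smodP z).
  by exists x; apply/esym/sqclsP.
- by move=> p x; rewrite [RHS]sqmapE; apply/sqclsP; exact: g_d.
- exact: fg_aug.
Qed.
End SubquotientResolution.

(** * The horseshoe lemma *)

Section Horseshoe.
Variables (R : comNzRingType) (I K : cochain R).

(** Together with the differentials of [I] and [K], this makes (a, c) |-> (d a + t c, d c) square to
    zero. *)
Definition twisting (t : forall p, {linear K p -> I p.+1}) :=
  forall p c, cc_d I p.+1 (t p c) + t p.+1 (cc_d K p c) = 0.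

Section Twisted.
Variables (t : forall p, {linear K p -> I p.+1}) (tP : twisting t).

Definition twisted_d p (x : (I p * K p)%type) : (I p.+1 * K p.+1)%type :=
  (cc_d I p x.1 + t p x.2, cc_d K p x.2).

Fact twisted_d_linear p : linear (@twisted_d p).
Proof.
move=> a x y; rewrite /twisted_d /= !linearP; congr (_, _).
by rewrite /= scalerDr addrACA.
Qed.
HB.instance Definition _ p := GRing.isLinear.Build R (I p * K p)%type
  (I p.+1 * K p.+1)%type *:%R (@twisted_d p) (@twisted_d_linear p).

Definition twisted : cochain R.
Proof.
apply: (@Cochain R (fun p => (I p * K p)%type) (fun p => @twisted_d p)) => p [a c].
by rewrite /= /twisted_d /= !cc_dd linearD cc_dd add0r tP.
Defined.

Lemma twisted_d_inl p a : cc_d twisted p (a, 0) = (cc_d I p a, 0).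
Proof. by rewrite /= /twisted_d /= !raddf0 addr0. Qed.

End Twisted.

Variables (X Y W : lmodType R) (i : {linear X -> Y}) (pi : {linear Y -> W}).
Variables (eX : {linear X -> I 0%N}) (eW : {linear W -> K 0%N}).
Hypothesis i_inj : injective i.
Hypothesis pi_surj : forall w, exists y, pi y = w.
Hypothesis pi_i : forall x, pi (i x) = 0.
Hypothesis ker_pi : forall y, pi y = 0 -> exists x, y = i x.
Hypotheses (resX : is_inj_resolution eX) (resW : is_inj_resolution eW).

(** [s] extends [eX] to [Y], but d s has to vanish on [X] only. The defect factors through
    [eW \o pi], which gives [t] in degree 0, and every further [t] cancels the differential of the
    one before. *)
Lemma horseshoe_exists :
  exists st : {linear Y -> I 0%N} * (forall p, {linear K p -> I p.+1}),
    [/\ forall x, st.1 (i x) = eX x,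
        forall y, cc_d I 0 (st.1 y) + st.2 0%N (eW (pi y)) = 0 &
        twisting st.2].
Proof.
have dI0 x : cc_d I 0 (eX x) = 0 by apply/(ir_exact0 resX); exists x.
have I_inj := ir_injective resX; have [s sE] := I_inj 0%N _ _ i eX i_inj.
have [|k kE] := @injective_factor _ _ _ _ pi (cc_d I 0 \o s) (I_inj 1%N).
  by move=> y /ker_pi[x ->] /=; rewrite sE dI0.
have [|h0 h0E] := @injective_factor _ _ _ _ (eW \o pi) (cc_d I 0 \o s) (I_inj 1%N).
  move=> y /= ey; have /ker_pi[x ->] : pi y = 0.
    by apply: (ir_aug_inj resW); rewrite ey raddf0.
  by rewrite sE dI0.
pose t0 : {linear K 0%N -> I 1%N} := \- h0.
(* The invariant says that [t] sends cocycles to cocycles; it is what lets d t factor through the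
   differential of [K]. *)
have [||t [t0E tP tS]] := @dependent_choice (fun p => {linear K p -> I p.+1})
  (fun p t => forall c, cc_d K p c = 0 -> cc_d I p.+1 (t c) = 0)
  (fun p t t' => forall c, cc_d I p.+1 (t c) + t' (cc_d K p c) = 0) t0.
- move=> c /(ir_exact0 resW)[w _ ->]; have [y <-] := pi_surj w.
  by rewrite /t0 /= linearN [h0 _]h0E /= cc_dd oppr0.
- move=> p t tP.
  have [h hE] := @injective_factor _ _ _ _ (cc_d K p) (cc_d I p.+1 \o t)
    (I_inj p.+2) tP.
  pose h' : {linear K p.+1 -> I p.+2} := \- h.
  have hS c : cc_d I p.+1 (t c) + h' (cc_d K p c) = 0.
    by rewrite /h' /= hE subrr.
  exists h' => // c /(ir_exactS resW)[b _ ->].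
  by have /eqP := hS b; rewrite addrC addr_eq0 => /eqP ->; rewrite linearN cc_dd oppr0.
exists (s, t); split=> //= y.
by rewrite t0E /t0 /= [h0 _]h0E subrr.
Qed.

Definition horseshoe := cid horseshoe_exists.
Let s := (sval horseshoe).1.
Let t := (sval horseshoe).2.

Definition horseshoe_cochain : cochain R :=
  twisted (let: And3 _ _ h := svalP horseshoe in h).

Definition horseshoe_twist p : {linear K p -> I p.+1} := t p.

Lemma horseshoe_d_fst p (x : horseshoe_cochain p) :
  (cc_d horseshoe_cochain p x).1 = cc_d I p x.1 + horseshoe_twist p x.2.
Proof. by []. Qed.

Definition horseshoe_aug_fun (y : Y) : (I 0%N * K 0%N)%type := (s y, eW (pi y)).
Fact horseshoe_aug_linear : linear horseshoe_aug_fun.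
Proof. by move=> a x y; rewrite /horseshoe_aug_fun !linearP. Qed.
HB.instance Definition _ := GRing.isLinear.Build R Y (I 0%N * K 0%N)%type *:%R
  horseshoe_aug_fun horseshoe_aug_linear.
Definition horseshoe_aug : {linear Y -> horseshoe_cochain 0%N} := horseshoe_aug_fun.

Lemma horseshoe_aug_i x : horseshoe_aug (i x) = (eX x, 0).
Proof.
rewrite /= /horseshoe_aug_fun pi_i raddf0 /s.
by case: (svalP horseshoe) => -> _ _.
Qed.

Lemma horseshoe_resolution : is_inj_resolution horseshoe_aug.
Proof.
have [sE st tP] := svalP horseshoe.
have stE y : cc_d I 0 (s y) + t 0%N (eW (pi y)) = 0 by exact: st.
have tE p c : cc_d I p.+1 (t p c) + t p.+1 (cc_d K p c) = 0 by exact: tP.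
split.
- move=> n; apply: injective_prod; first exact: (ir_injective resX).
  exact: (ir_injective resW).
- apply: raddf_inj => y [sy ey].
  have [x yx] : exists x, y = i x.
    by apply: ker_pi; apply: (ir_aug_inj resW); rewrite ey raddf0.
  rewrite yx; suff -> : x = 0 by rewrite raddf0.
  by apply: (ir_aug_inj resX); rewrite raddf0 -sE -yx.
- move=> [a c]; split=> [[da dc]|[y _ ->]]; last first.
    rewrite /cocycle /ker /= /twisted_d /= stE; congr (_, _).
    by apply/(ir_exact0 resW); exists (pi y).
  have /(ir_exact0 resW)[w _ cw] := dc; have [y yw] := pi_surj w.
  have /(ir_exact0 resX)[x _ ax] : cc_d I 0 (a - s y) = 0.
    rewrite linearB; apply/eqP; rewrite subr_eq0; apply/eqP.
    by apply: (addIr (t 0%N c)); rewrite [LHS]da cw -yw stE.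
  exists (y + i x) => //; rewrite linearD horseshoe_aug_i /= /horseshoe_aug_fun.
  by rewrite -[RHS]/(s y + eX x, eW (pi y) + 0) addr0 -ax addrC subrK yw cw.
move=> n [a c]; split=> [[da dc]|[[a' c'] _ [-> ->]]]; last first.
  rewrite /cocycle /ker /= /twisted_d /= cc_dd; congr (_, _).
  by rewrite linearD cc_dd add0r tE.
have /(ir_exactS resW)[c' _ cc'] := dc.
have /(ir_exactS resX)[a' _ aa'] : cc_d I n.+1 (a - t n c') = 0.
  rewrite linearB; apply/eqP; rewrite subr_eq0; apply/eqP.
  by apply: (addIr (t n.+1 c)); rewrite [LHS]da cc' tE.
by exists (a', c') => //; rewrite /= /twisted_d /= -aa' subrK cc'.
Qed.
End Horseshoe.

Section ZeroResolution.
Variable R : comNzRingType.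

Definition zero_mod : lmodType R := smod (submod_zero R^o).

Lemma zero_mod_eq0 (x : zero_mod) : x = 0.
Proof. by apply: val_inj; exact: smodP x. Qed.

Definition zero_cochain : cochain R :=
  @Cochain R (fun=> zero_mod) (fun=> \0) (fun _ _ => erefl).

Lemma zero_resolution (N : lmodType R) (aug : {linear N -> zero_cochain 0%N}) :
  (forall x : N, x = 0) -> is_inj_resolution aug.
Proof.
move=> N0; split.
- by move=> n A B i f _; exists \0 => a; rewrite [RHS]zero_mod_eq0.
- by move=> x y _; rewrite [x]N0 [y]N0.
- move=> x; split=> // _; exists 0 => //.
  by rewrite [LHS]zero_mod_eq0 [RHS]zero_mod_eq0.
- move=> n x; split=> // _; exists 0 => //.
  by rewrite [LHS]zero_mod_eq0 [RHS]zero_mod_eq0.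
Qed.
End ZeroResolution.

Lemma sqcls_zero_bij (R : comNzRingType) (U : lmodType R) (Z : submod U) :
  bijective (sqcls Z (submod_zero U)).
Proof.
apply: bijP; last exact: sqcls_surj.
by apply: raddf_inj => x /sqcls_eq0 x0; apply: val_inj.
Qed.

(** * Existence of Cartan-Eilenberg resolutions *)

Section CartanEilenbergExists.
Variables (R : comNzRingType) (A : cochain R).

Let Zm q : lmodType R := smod (cocycle A q).
Let Bm q : lmodType R := smod (coboundary A q).
Let Hm q : lmodType R := cohomology A q.

(* With the horseshoe lemma used twice, the term at (p, q) of the bicomplex is
   (CE_B q p * CE_H q p) * CE_B q.+1 p. As the columns have no coboundaries in
   degree 0, the resolution [CE_B 0] of the zero module has to be zero. *)
Variables (CE_B CE_H : nat -> cochain R).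
Variable CE_Baug : forall q, {linear Bm q -> CE_B q 0%N}.
Variable CE_Haug : forall q, {linear Hm q -> CE_H q 0%N}.
Hypothesis CE_B_resolution : forall q, is_inj_resolution (CE_Baug q).
Hypothesis CE_H_resolution : forall q, is_inj_resolution (CE_Haug q).
Hypothesis CE_B0 : forall p (x : CE_B 0%N p), x = 0.

Lemma coboundary_cocycle q x : coboundary A q x -> cocycle A q x.
Proof.
by case: q x => [|q] x; [move=> ->; exact: raddf0|move=> [y _ ->]; exact: cc_dd].
Qed.

Definition B_incl q : {linear Bm q -> Zm q} :=
  smap (f := idfun) (@coboundary_cocycle q).

Definition A_d_fun q (x : A q) : Bm q.+1 :=
  @mk_smod R _ (coboundary A q.+1) (cc_d A q x) (ex_intro2 _ _ x I erefl).
Fact A_d_linear q : linear (@A_d_fun q).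
Proof. by move=> a x y; apply: val_inj; rewrite /= linearP. Qed.
HB.instance Definition _ q := GRing.isLinear.Build R (A q) (Bm q.+1) *:%R
  (@A_d_fun q) (@A_d_linear q).
Definition A_d q : {linear A q -> Bm q.+1} := @A_d_fun q.

Lemma B_incl_inj q : injective (B_incl q).
Proof. by move=> x y /(congr1 val) /= xy; apply: val_inj. Qed.
Lemma B_incl_cls q x : sqcls (cocycle A q) (coboundary A q) (B_incl q x) = 0.
Proof. by apply/sqcls_eq0; exact: smodP x. Qed.
Lemma B_incl_ker q y : sqcls (cocycle A q) (coboundary A q) y = 0 ->
  exists x, y = B_incl q x.
Proof. by move=> /sqcls_eq0 By; exists (mk_smod By); apply: val_inj. Qed.

Lemma Z_incl_inj q : injective (smod_incl (cocycle A q)).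
Proof. exact: val_inj. Qed.
Lemma A_d_surj q w : exists y, A_d q y = w.
Proof. by have [y _ wy] := smodP w; exists y; apply: val_inj. Qed.
Lemma A_d_incl q x : A_d q (smod_incl (cocycle A q) x) = 0.
Proof. by apply: val_inj; exact: smodP x. Qed.
Lemma A_d_ker q y : A_d q y = 0 -> exists x, y = smod_incl (cocycle A q) x.
Proof. by move=> /(congr1 val) dy; exists (@mk_smod R _ (cocycle A q) y dy). Qed.

Definition CE_Z q : cochain R :=
  horseshoe_cochain (@B_incl_inj q) (@sqcls_surj R _ _ _)
   (@B_incl_ker q) (CE_B_resolution q) (CE_H_resolution q).
Definition CE_Zaug q : {linear Zm q -> CE_Z q 0%N} :=
  horseshoe_aug (@B_incl_inj q) (@sqcls_surj R _ _ _)
   (@B_incl_ker q) (CE_B_resolution q) (CE_H_resolution q).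
Lemma CE_Z_resolution q : is_inj_resolution (CE_Zaug q).
Proof. by apply: horseshoe_resolution; exact: B_incl_cls. Qed.

Definition CE_A q : cochain R :=
  horseshoe_cochain (@Z_incl_inj q) (@A_d_surj q)
   (@A_d_ker q) (CE_Z_resolution q) (CE_B_resolution q.+1).
Definition CE_Aaug q : {linear A q -> CE_A q 0%N} :=
  horseshoe_aug (@Z_incl_inj q) (@A_d_surj q)
   (@A_d_ker q) (CE_Z_resolution q) (CE_B_resolution q.+1).
Lemma CE_A_resolution q : is_inj_resolution (CE_Aaug q).
Proof. by apply: horseshoe_resolution; exact: A_d_incl. Qed.

Definition CE_inB p q : {linear CE_B q p -> CE_A q p} :=
  lin_of (f := fun b => ((b, 0), 0) : CE_A q p)
   (fun a x y => congr2 pair (congr2 pair erefl (esym (etrans (addr0 _) (scaler0 _ a))))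
     (esym (etrans (addr0 _) (scaler0 _ a)))).
Definition CE_inH p q : {linear CE_H q p -> CE_A q p} :=
  lin_of (f := fun b => ((0, b), 0) : CE_A q p)
   (fun a x y => congr2 pair (congr2 pair (esym (etrans (addr0 _) (scaler0 _ a))) erefl)
     (esym (etrans (addr0 _) (scaler0 _ a)))).
Definition CE_inBS p q : {linear CE_B q.+1 p -> CE_A q p} :=
  lin_of (f := fun b => (0, b) : CE_A q p)
   (fun a x y => congr2 pair (esym (etrans (addr0 _) (scaler0 _ a))) erefl).
Definition CE_prB p q : {linear CE_A q p -> CE_B q p} :=
  lin_of (f := fun x : CE_A q p => x.1.1) (fun a x y => erefl).
Definition CE_prH p q : {linear CE_A q p -> CE_H q p} :=
  lin_of (f := fun x : CE_A q p => x.1.2) (fun a x y => erefl).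
Definition CE_prBS p q : {linear CE_A q p -> CE_B q.+1 p} :=
  lin_of (f := fun x : CE_A q p => x.2) (fun a x y => erefl).

Definition CE_inZ p q : {linear CE_Z q p -> CE_A q p} :=
  lin_of (f := fun z => (z, 0) : CE_A q p)
   (fun a x y => congr2 pair erefl (esym (etrans (addr0 _) (scaler0 _ a)))).

Lemma CE_split p q (x : CE_A q p) :
  x = CE_inB p q (CE_prB p q x) + CE_inH p q (CE_prH p q x) +
      CE_inBS p q (CE_prBS p q x).
Proof.
case: x => [[b h] c].
rewrite -[RHS]/((b + 0 + 0, 0 + h + 0), 0 + 0 + c).
by rewrite !addr0 !add0r.
Qed.

Lemma CE_d_inB p q b :
  cc_d (CE_A q) p (CE_inB p q b) = CE_inB p.+1 q (cc_d (CE_B q) p b).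
Proof.
by rewrite [LHS]twisted_d_inl [X in (X, _)]twisted_d_inl.
Qed.

Lemma CE_prBS_d p q x : CE_prBS p.+1 q (cc_d (CE_A q) p x) =
  cc_d (CE_B q.+1) p (CE_prBS p q x).
Proof. by []. Qed.

(** The twist of the outer horseshoe keeps [CE_prH] from being a chain map along the rows. Its
    contribution depends only on the component in [CE_B q.+1], which vanishes on the cocycles of the
    columns. *)
Lemma CE_prH_d p q x : CE_prH p.+1 q (cc_d (CE_A q) p x) =
  cc_d (CE_H q) p (CE_prH p q x) +
  CE_prH p.+1 q (cc_d (CE_A q) p (CE_inBS p q (CE_prBS p q x))).
Proof.
pose t := horseshoe_twist (@Z_incl_inj q) (@A_d_surj q) (@A_d_ker q)
  (CE_Z_resolution q) (CE_B_resolution q.+1) p.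
have E y : CE_prH p.+1 q (cc_d (CE_A q) p y) =
    cc_d (CE_H q) p (CE_prH p q y) + (t (CE_prBS p q y)).2.
  exact: (congr1 snd (horseshoe_d_fst y)).
have prH0 : CE_prH p q (CE_inBS p q (CE_prBS p q x)) = 0 by [].
have prBS : CE_prBS p q (CE_inBS p q (CE_prBS p q x)) = CE_prBS p q x by [].
by rewrite E [X in _ = _ + X]E prH0 prBS (raddf0 (cc_d (CE_H q) p)) add0r.
Qed.

(** The differential of [A] factors as A q -> B q.+1 -> A q.+1. The two maps lift to chain maps of
    the resolutions: the projection onto the quotient part of a horseshoe and the inclusion of the
    innermost sub part. *)
Definition CE_dv p q : {linear CE_A q p -> CE_A q.+1 p} :=
  CE_inB p q.+1 \o CE_prBS p q.

Definition CE_bicomplex : bicomplex R.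
Proof.
apply: (@Bicomplex R (fun p q => CE_A q p) (fun p q => cc_d (CE_A q) p) CE_dv) => p q x.
- exact: cc_dd.
- exact: raddf0.
- by rewrite /CE_dv [RHS]/= CE_d_inB.
Defined.

Lemma CE_col_coboundary p q x : coboundary (bc_col CE_bicomplex p) q x <->
  exists b, x = CE_inB p q b.
Proof.
case: q x => [|q] x; split.
- by move=> x0; exists 0; rewrite raddf0.
- move=> [b ->]; rewrite (CE_B0 b) raddf0.
  exact: (submod0 (coboundary (bc_col CE_bicomplex p) 0)).
- by move=> [y _ ->]; exists (CE_prBS p q y).
- by move=> [b ->]; exists (CE_inBS p q b).
Qed.

Lemma CE_col_cocycle p q x : cocycle (bc_col CE_bicomplex p) q x <->
  CE_prBS p q x = 0.
Proof.
split=> [x0|x0]; last by rewrite /cocycle /ker /= [x.2]x0.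
exact: (congr1 (fun y : CE_A q.+1 p => y.1.1) x0).
Qed.

Lemma CE_aug_Z q x : CE_Aaug q (smod_incl (cocycle A q) x) = (CE_Zaug q x, 0).
Proof. by apply: horseshoe_aug_i; exact: A_d_incl. Qed.

Lemma CE_aug_B q x : CE_Zaug q (B_incl q x) = (CE_Baug q x, 0).
Proof. by apply: horseshoe_aug_i; exact: B_incl_cls. Qed.

Lemma CE_aug_d q x : bc_dv CE_bicomplex 0 q (CE_Aaug q x) = CE_Aaug q.+1 (cc_d A q x).
Proof.
have -> : cc_d A q x = smod_incl (cocycle A q.+1) (B_incl q.+1 (A_d q x)) by [].
by rewrite CE_aug_Z CE_aug_B.
Qed.

(** The cocycles of a column are the factor [CE_Z], its coboundaries the factor [CE_B] and its
    cohomology the factor [CE_H], so the three rows inherit the chosen resolutions. [CE_inH] is a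
    chain map only up to the inner twist, whose values are coboundaries. *)
Lemma CE_resolution : is_CE_resolution CE_aug_d.
Proof.
split=> q.
- have [h1 h2 h3 h4] := CE_A_resolution q.
  by split; [exact: h1|exact: h2|exact: h3|exact: h4].
- pose g p := CE_inZ p q.
  have gZ p x : cocycle (bc_col CE_bicomplex p) q (g p x) by apply/CE_col_cocycle.
  apply: (@subquot_resolution R (bc_row CE_bicomplex q)
    (fun p => cocycle (bc_col CE_bicomplex p) q) (fun p => submod_zero (CE_A q p))
    (@row_cocycle R CE_bicomplex q) (@row_zero R CE_bicomplex q) _ _ (CE_Z q)
    (CE_Zaug q) (sqcls (cocycle A q) (submod_zero _)) g
    (sqmap (@aug_cocycle R A CE_bicomplex CE_Aaug CE_aug_d q)
      (@aug_zero R A CE_bicomplex CE_Aaug q))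
    (@sqcls_zero_bij _ _ _) gZ).
  + by move=> p x x0; exact: (congr1 fst x0).
  + move=> p [x c] /CE_col_cocycle c0; exists x.
    by have -> : c = 0 := c0; rewrite subrr; exact: submod0.
  + move=> p x; rewrite -[cc_d _ _ (g p x)](esym (twisted_d_inl _ x)) subrr.
    exact: submod0.
  + move=> y; rewrite sqmapE; congr (sqcls _ _ _); apply: val_inj.
    exact: CE_aug_Z.
  + exact: CE_Z_resolution.
- pose g p := CE_inB p q.
  have gZ p x : coboundary (bc_col CE_bicomplex p) q (g p x).
    by apply/CE_col_coboundary; exists x.
  apply: (@subquot_resolution R (bc_row CE_bicomplex q)
    (fun p => coboundary (bc_col CE_bicomplex p) q) (fun p => submod_zero (CE_A q p))
    (@row_coboundary R CE_bicomplex q) (@row_zero R CE_bicomplex q) _ _ (CE_B q)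
    (CE_Baug q) (sqcls (coboundary A q) (submod_zero _)) g
    (sqmap (@aug_coboundary R A CE_bicomplex CE_Aaug CE_aug_d q)
      (@aug_zero R A CE_bicomplex CE_Aaug q))
    (@sqcls_zero_bij _ _ _) gZ).
  + by move=> p x x0; exact: (congr1 (fun y : CE_A q p => y.1.1) x0).
  + move=> p x /CE_col_coboundary[b ->]; exists b.
    by rewrite subrr; exact: submod0.
  + move=> p x; rewrite -[cc_d _ _ (g p x)](esym (CE_d_inB x)) subrr.
    exact: submod0.
  + move=> y; rewrite sqmapE; congr (sqcls _ _ _); apply: val_inj.
    apply: (etrans (CE_aug_Z (B_incl q y))).
    by rewrite CE_aug_B.
  + exact: CE_B_resolution.
pose g p := CE_inH p q.
have gZ p x : cocycle (bc_col CE_bicomplex p) q (g p x) by apply/CE_col_cocycle.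
apply: (@subquot_resolution R (bc_row CE_bicomplex q)
    (fun p => cocycle (bc_col CE_bicomplex p) q)
    (fun p => coboundary (bc_col CE_bicomplex p) q)
    (@row_cocycle R CE_bicomplex q) (@row_coboundary R CE_bicomplex q) _ _ (CE_H q)
    (CE_Haug q) idfun g
    (sqmap (@aug_cocycle R A CE_bicomplex CE_Aaug CE_aug_d q)
      (@aug_coboundary R A CE_bicomplex CE_Aaug CE_aug_d q))
    _ gZ).
- by exists idfun.
- by move=> p x /CE_col_coboundary[b xb]; exact: (congr1 (fun y : CE_A q p => y.1.2) xb).
- move=> p x /CE_col_cocycle x0; exists (CE_prH p q x).
  apply/CE_col_coboundary; exists (CE_prB p q x).
  by rewrite {1}[x]CE_split x0 raddf0 addr0 addrK.
- move=> p x; apply/CE_col_coboundary.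
  set y := _ - _; have y0 : CE_prBS p.+1 q y = 0.
    rewrite linearB CE_prBS_d; have -> : CE_prBS p q (g p x) = 0 by [].
    by rewrite raddf0 subr0.
  have y1 : CE_prH p.+1 q y = 0.
    rewrite linearB CE_prH_d; have -> : CE_prBS p q (g p x) = 0 by [].
    by rewrite !raddf0 addr0 subrr.
  by exists (CE_prB p.+1 q y); rewrite {1}[y]CE_split y0 y1 !raddf0 !addr0.
- move=> u; have [y <-] := sqcls_surj u; rewrite sqmapE; apply/sqclsP.
  apply/CE_col_coboundary; exists (CE_prB 0 q (CE_Aaug q (val y))).
  have augE : CE_Aaug q (val y) = (CE_Zaug q y, 0) := CE_aug_Z y.
  have y0 : CE_prBS 0 q (CE_Aaug q (val y)) = 0 := congr1 snd augE.
  have y1 : CE_prH 0 q (CE_Aaug q (val y)) = CE_Haug q (sqcls _ _ y).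
    exact: (congr1 (fun v : CE_A q 0%N => v.1.2) augE).
  have E : CE_Aaug q (val y) = CE_inB 0 q (CE_prB 0 q (CE_Aaug q (val y))) +
      CE_inH 0 q (CE_Haug q (sqcls _ _ y)).
    by rewrite {1}[CE_Aaug q _]CE_split y0 y1 raddf0 addr0.
  by apply/eqP; rewrite subr_eq; apply/eqP; exact: E.
- exact: CE_H_resolution.
Qed.

End CartanEilenbergExists.

(** * Additive functors *)

Section FunctorFacts.
Variables (R : comNzRingType) (F : functor R).

Lemma fmap_eq (A B : lmodType R) (f g : {linear A -> B}) x : f =1 g ->
  fmap F f x = fmap F g x.
Proof. by move=> /lin_eq ->. Qed.

Lemma fmap_comp_eq (A B C : lmodType R) (g : {linear B -> C}) (f : {linear A -> B})
    (h : {linear A -> C}) x : (forall y, g (f y) = h y) ->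
  fmap F g (fmap F f x) = fmap F h x.
Proof. by move=> gfh; rewrite -fmap_comp; exact: fmap_eq. Qed.

Lemma fmap_comp0 (A B C : lmodType R) (g : {linear B -> C}) (f : {linear A -> B}) x :
  (forall y, g (f y) = 0) -> fmap F g (fmap F f x) = 0.
Proof. by move=> gf0; rewrite -fmap_comp; exact: fmap0. Qed.

Lemma cohomology_iso (A B : cochain R) (f : forall n, {linear A n -> B n}) n :
  (forall n, bijective (f n)) ->
  (forall n x, f n.+1 (cc_d A n x) = cc_d B n (f n x)) ->
  iso (cohomology A n) (cohomology B n).
Proof.
move=> f_bij f_d; have f_inj m := bij_inj (f_bij m).
have fP (x : smod (cocycle A n)) : cocycle B n (f n (val x)).
  by rewrite /cocycle /ker /= -f_d [cc_d _ _ _](smodP x) raddf0.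
have g_lin : linear (fun x => sqcls (cocycle B n) (coboundary B n) (mk_smod (fP x))).
  move=> a x y; rewrite -linearP; congr (sqcls _ _ _); apply: val_inj.
  by rewrite -[RHS]/(a *: f n (val x) + f n (val y)) -linearP.
apply: (@subquot_iso _ _ _ _ _ (lin_of g_lin)) => [u|x].
  have [y <-] := sqcls_surj u; have [x xy] := bij_surj (f_bij n) (val y).
  have x0 : cocycle A n x.
    by apply: f_inj; rewrite raddf0 f_d xy; exact: smodP y.
  by exists (mk_smod x0); congr (sqcls _ _ _); apply: val_inj.
apply: (iff_trans (sqcls_eq0 (coboundary B n) (mk_smod (fP x)))).
rewrite -[val _]/(f n (val x)); case: (n) (val x) => [|m] c; split.
- by move=> fc; apply: f_inj; rewrite raddf0.
- by move=> c0; have -> : c = 0 := c0; exact: raddf0.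
- move=> [b _ cb]; have [a ab] := bij_surj (f_bij m) b.
  by exists a => //; apply: f_inj; rewrite f_d ab.
- by move=> [a _ ->]; exists (f m a); rewrite ?f_d.
Qed.

(** * Splitting of resolutions of injective modules *)

Section SplitResolution.
Variables (N : lmodType R) (J : cochain R) (aug : {linear N -> J 0%N}).
Hypotheses (N_inj : injective_mod N) (resJ : is_inj_resolution aug).

(** The map id - d s kills the image of one differential, which is the kernel of the next, and so
    factors through the latter by injectivity. Injectivity of [N] starts the induction: it gives the
    retraction [s0]. *)
Lemma contracting_homotopy :
  exists (s0 : {linear J 0%N -> N}) (s : forall p, {linear J p.+1 -> J p}),
    [/\ forall y, s0 (aug y) = y,
        forall x, s 0%N (cc_d J 0 x) = x - aug (s0 x) &
        forall p x, s p.+1 (cc_d J p.+1 x) = x - cc_d J p (s p x)].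
Proof.
have J_inj := ir_injective resJ; have aug_inj := ir_aug_inj resJ.
have [s0 s0E] := N_inj (idfun : {linear N -> N}) aug_inj.
have sub_lin (A : lmodType R) (h : {linear A -> A}) : linear (fun x => x - h x).
  by move=> a x y; rewrite linearP scalerBr opprD addrACA.
have [|t0 t0E] := @injective_factor _ _ _ _ (cc_d J 0)
    (lin_of (@sub_lin _ (aug \o s0))) (J_inj 0%N).
  by move=> x /(ir_exact0 resJ)[y _ ->] /=; rewrite s0E subrr.
have [||s [sE sP sS]] := @dependent_choice (fun p => {linear J p.+1 -> J p})
  (fun p s => forall c, cc_d J p (s (cc_d J p c)) = cc_d J p c)
  (fun p s s' => forall c, s' (cc_d J p.+1 c) = c - cc_d J p (s c)) t0.
- move=> c; rewrite t0E /= linearB; apply/eqP.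
  rewrite subr_eq addrC -subr_eq subrr eq_sym.
  by apply/eqP/(ir_exact0 resJ); exists (s0 c).
- move=> p s sP.
  have [|s' s'E] := @injective_factor _ _ _ _ (cc_d J p.+1)
    (lin_of (@sub_lin _ (cc_d J p \o s))) (J_inj p.+1).
    by move=> x /(ir_exactS resJ)[y _ ->] /=; rewrite sP subrr.
  by exists s' => // c; rewrite s'E /= linearB cc_dd subr0.
by exists s0, s; split=> // x; rewrite sE t0E.
Qed.

Lemma fmap_aug_inj : injective (fmap F aug).
Proof.
have [s0 [s [sE _ _]]] := contracting_homotopy.
apply: (can_inj (g := fmap F s0)) => x.
by rewrite (fmap_comp_eq _ (h := idfun)) ?fmap_id.
Qed.

Lemma fmap_exact0 x : fmap F (cc_d J 0) x = 0 <-> exists a, x = fmap F aug a.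
Proof.
have [s0 [s [_ sE _]]] := contracting_homotopy.
split=> [x0|[a ->]]; last first.
  by apply: fmap_comp0 => y; apply/(ir_exact0 resJ); exists y.
exists (fmap F s0 x); rewrite -fmap_comp.
apply/eqP; rewrite -subr_eq0; apply/eqP.
have : fmap F (idfun : {linear J 0%N -> J 0%N}) x = x by exact: fmap_id.
move=> {1}<-.
have -> : fmap F (idfun : {linear J 0%N -> J 0%N}) =
    fmap F (s 0%N \o cc_d J 0) + fmap F (aug \o s0).
  by rewrite -fmapD; congr (fmap F _); apply: lin_eq => y; rewrite homDE /= sE subrK.
by rewrite homDE addrK fmap_comp x0 raddf0.
Qed.

Lemma fmap_exactS p x : fmap F (cc_d J p.+1) x = 0 ->
  exists y, x = fmap F (cc_d J p) y.
Proof.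
have [s0 [s [_ _ sE]]] := contracting_homotopy => x0.
exists (fmap F (s p) x); rewrite -fmap_comp.
apply/eqP; rewrite -subr_eq0; apply/eqP.
have : fmap F (idfun : {linear J p.+1 -> J p.+1}) x = x by exact: fmap_id.
move=> {1}<-.
have -> : fmap F (idfun : {linear J p.+1 -> J p.+1}) =
    fmap F (s p.+1 \o cc_d J p.+1) + fmap F (cc_d J p \o s p).
  by rewrite -fmapD; congr (fmap F _); apply: lin_eq => y; rewrite homDE /= sE subrK.
by rewrite homDE addrK fmap_comp x0 raddf0.
Qed.
End SplitResolution.
End FunctorFacts.

(** * Associated primes and support *)

Section AssSuppFacts.
Variables (R : comNzRingType) (P : spec R).

Lemma spec_notin_mul (s t : R) : ~ P s -> ~ P t -> ~ P (s * t).
Proof. by move=> Ps Pt /spec_prime[]. Qed.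

(** A fraction x / s vanishes exactly when some element outside [P] kills [x], whatever the
    denominator. *)
Lemma SuppE (U : lmodType R) :
  Supp U P <-> exists x : U, forall s, ~ P s -> s *: x <> 0.
Proof.
split=> [[u u0]|[x x0]].
  have [x [s [Ps us]]] : exists x s (Ps : ~ P s), u = frac x Ps.
    have [[x [s Ps']] <-] : exists f : fracs U P, \pi_(localization U P)%qT f = u.
      by exists (repr u); rewrite reprK.
    have Ps : ~ P s by exact/asboolP.
    by exists x, s, Ps; rewrite /frac (Prop_irrelevance Ps' (introT (asboolP _) Ps)).
  exists x => t Pt tx; apply: u0; rewrite us; apply/fracP; exists t; split=> //.
  by rewrite scaler0 subr0 scale1r.
exists (frac x (@spec_proper _ P)); move/fracP => [t [Pt]].
by rewrite scaler0 subr0 scale1r; exact: x0.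
Qed.

Lemma Ass_inj (U V : lmodType R) (f : {linear U -> V}) : injective f ->
  Ass U P -> Ass V P.
Proof.
move=> f_inj [x xP]; exists (f x) => a; rewrite xP -linearZ.
by split=> [->|ax]; [rewrite raddf0|apply: f_inj; rewrite ax raddf0].
Qed.

Lemma Ass_iso (U V : lmodType R) : iso U V -> Ass U P -> Ass V P.
Proof. by move=> [f /bij_inj]; exact: Ass_inj. Qed.

Lemma Supp_iso (U V : lmodType R) : iso U V -> Supp U P -> Supp V P.
Proof.
move=> [f /bij_inj f_inj] /SuppE[x xP]; apply/SuppE; exists (f x) => s Ps.
by rewrite -linearZ => fx; apply: (xP s Ps); apply: f_inj; rewrite fx raddf0.
Qed.

Lemma Supp_subquot (U : lmodType R) (Z B : submod U) :
  Supp (subquot Z B) P -> Supp U P.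
Proof.
move=> /SuppE[u uP]; have [x xu] := sqcls_surj u.
apply/SuppE; exists (val x) => s Ps sx; apply: (uP s Ps).
have x0 : s *: x = 0 by apply: val_inj.
by rewrite -xu -linearZ x0 raddf0.
Qed.

Lemma Ass_subquot0 (U : lmodType R) (Z B : submod U) : (forall x, B x -> x = 0) ->
  Ass (subquot Z B) P -> Ass U P.
Proof.
move=> B0 [u uP]; have [x xu] := sqcls_surj u; exists (val x) => a.
rewrite uP -xu -linearZ sqcls_eq0; split=> [/B0 //|ax].
by rewrite -[val _]/(a *: val x) ax; exact: submod0.
Qed.

Section Filtration.
Variables (U : lmodType R) (Phi : nat -> submod U) (n : nat).
Hypothesis Phi0 : forall x, Phi 0%N x.
Hypothesis Phin : forall x, Phi n.+1 x -> x = 0.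

(** [T] marks the nonzero elements that witness [P] in [U]. If no graded piece satisfied [Q], such
    an element could be pushed down the filtration to [Phi n.+1], which is zero. *)
Let filtration_step (T : U -> Prop) (Q : nat -> Prop) :
  (forall x, T x -> x <> 0) -> (exists x, T x) ->
  (forall p x, T x -> Phi p x -> Q p \/ exists2 y, T y & Phi p.+1 y) ->
  exists2 p, (p <= n)%N & Q p.
Proof.
move=> T0 [x0 Tx0] step; apply: contrapT => nQ.
have climb k : (k <= n.+1)%N -> exists2 y, T y & Phi k y.
  elim: k => [_|k IHk kn]; first by exists x0.
  have [y Ty Py] := IHk (ltnW kn).
  by have [Qk|//] := step _ _ Ty Py; case: nQ; exists k.
by have [y Ty /Phin y0] := climb _ (leqnn _); exact: T0 Ty y0.
Qed.

Lemma Ass_filtration : Ass U P ->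
  exists2 p, (p <= n)%N & Ass (subquot (Phi p) (Phi p.+1)) P.
Proof.
move=> U_P; pose T (x : U) := forall a : R, P a <-> a *: x = 0.
apply: (filtration_step (T := T)) => //.
  move=> x Tx x0; apply: (@spec_proper _ P); apply/Tx.
  by rewrite x0 scaler0.
(* If some [a] outside [P] brings [x] into the next step, a x still has annihilator [P], because [P]
   is prime. Otherwise the class of [x] in the graded piece has annihilator [P]. *)
move=> p x Tx px; have [[a [ax Pa]]|noa] :=
    pselect (exists a, Phi p.+1 (a *: x) /\ ~ P a).
  right; exists (a *: x) => // b; rewrite scalerA -Tx; split=> [Pb|].
    by rewrite mulrC; exact: (submodZ (S := P)).
  by move=> /spec_prime[].
left; exists (sqcls _ _ (mk_smod px)) => a; rewrite -linearZ sqcls_eq0.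
rewrite -[val _]/(a *: x); split=> [/Tx -> |ax]; first exact: submod0.
by apply: contrapT => Pa; apply: noa; exists a.
Qed.

Lemma Supp_filtration : Supp U P ->
  exists2 p, (p <= n)%N & Supp (subquot (Phi p) (Phi p.+1)) P.
Proof.
move=> /SuppE U_P; pose T (x : U) := forall s, ~ P s -> s *: x <> 0.
apply: (filtration_step (T := T)) => //.
  by move=> x Tx x0; apply: (Tx 1 (@spec_proper _ P)); rewrite x0 scaler0.
move=> p x Tx px; have [[a [ax Pa]]|noa] :=
    pselect (exists a, Phi p.+1 (a *: x) /\ ~ P a).
  right; exists (a *: x) => // s Ps; rewrite scalerA; apply: Tx.
  exact: spec_notin_mul.
left; apply/SuppE; exists (sqcls _ _ (mk_smod px)) => s Ps.
by rewrite -linearZ sqcls_eq0 => sx; apply: noa; exists s.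
Qed.
End Filtration.

Variable E : spectral_sequence R.

(** [ss_next] speaks of the target of a differential, so [p] and [q] are written as one. The
    incoming differential starts in the column p - r, which is zero when p < r. *)
Lemma ss_next_subquot (r : nat) (p q : int) : (2 <= r)%N ->
  exists Z B : submod (E r p q), iso (E r.+1 p q) (subquot Z B) /\
    (p < r%:Z -> forall x, B x -> x = 0).
Proof.
move=> r2.
have -> : p = (p - r%:Z) + r%:Z by ring.
have -> : q = (q + r%:Z - 1) - r%:Z + 1 by ring.
set p' := p - _; set q' := q + _ - 1.
exists (ker (ss_d E r (p' + r%:Z) (q' - r%:Z + 1))), (range (ss_d E r p' q')).
split; first exact: ss_next.
move=> pr _ [x _ ->]; have -> : x = 0.
  by apply: (@ss_quadrant _ E r) => //; move: pr; lia.
by rewrite raddf0.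
Qed.

Lemma Supp_page (r : nat) p q : (2 <= r)%N -> Supp (E r p q) P -> Supp (E 2%N p q) P.
Proof.
move=> /subnK <-; elim: (r - 2)%N => // k IHk E_P; apply: IHk.
have [|Z [B [EZB _]]] := @ss_next_subquot (k + 2) p q; first by rewrite leq_addl.
exact: Supp_subquot (Supp_iso EZB E_P).
Qed.

Lemma Ass_page0 (r : nat) q : (2 <= r)%N -> Ass (E r 0 q) P -> Ass (E 2%N 0 q) P.
Proof.
move=> /subnK <-; elim: (r - 2)%N => // k IHk E_P; apply: IHk.
have [|Z [B [EZB B0]]] := @ss_next_subquot (k + 2) 0 q; first by rewrite leq_addl.
by apply: Ass_subquot0 (Ass_iso EZB E_P); apply: B0; lia.
Qed.
End AssSuppFacts.

Lemma Ext0_iso (R : comNzRingType) (M N : lmodType R) : iso (Ext 0 M N) (homod M N).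
Proof.
apply: iso_sym; have resN := inj_resP N.
have fP (f : homod M N) : cocycle (map_cochain (homF M) (inj_res N)) 0
    (homr M (inj_res_aug N) f).
  by apply: lin_eq => x; apply/(ir_exact0 resN); exists (f x).
have g_lin : linear (fun f => sqcls _ (coboundary (map_cochain (homF M) (inj_res N)) 0)
    (mk_smod (fP f))).
  move=> a f g; rewrite -linearP; congr (sqcls _ _ _); apply: val_inj.
  by rewrite -[RHS]/(a *: homr M (inj_res_aug N) f + homr M (inj_res_aug N) g) -linearP.
exists (lin_of g_lin); apply: bijP.
  apply: raddf_inj => f /sqcls_eq0 f0; apply: lin_eq => x.
  apply: (ir_aug_inj resN); rewrite raddf0.
  exact: (congr1 (fun h : homod M (inj_res N 0%N) => h x) f0).
move=> u; have [g <-] := sqcls_surj u.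
have gE x : exists y, inj_res_aug N y = val g x.
  have /(ir_exact0 resN)[y _ yE] : cc_d (inj_res N) 0 (val g x) = 0.
    exact: (congr1 (fun h : homod M (inj_res N 1%N) => h x) (smodP g)).
  by exists y.
have [f fE] := choice gE.
have f_lin : linear f.
  by move=> a x y; apply: (ir_aug_inj resN); rewrite fE !linearP !fE.
exists (lin_of f_lin); congr (sqcls _ _ _); apply: val_inj; apply: lin_eq => x.
exact: fE.
Qed.

(** * The Grothendieck spectral sequence *)

Section CEFunctor.
Variables (R : comNzRingType) (F : functor R) (A : cochain R).
Variables (KB KH : nat -> cochain R).
Variable augB : forall q, {linear smod (coboundary A q) -> KB q 0%N}.
Variable augH : forall q, {linear cohomology A q -> KH q 0%N}.
Hypothesis resB : forall q, is_inj_resolution (augB q).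
Hypothesis resH : forall q, is_inj_resolution (augH q).
Hypothesis KB0 : forall p (x : KB 0%N p), x = 0.

Let C := CE_bicomplex resB resH.
Let FC := map_bicomplex F C.

Lemma fmap_CE_split p q (x : FC p q) :
  x = fmap F (CE_inB resB resH p q) (fmap F (CE_prB resB resH p q) x) +
      fmap F (CE_inH resB resH p q) (fmap F (CE_prH resB resH p q) x) +
      fmap F (CE_inBS resB resH p q) (fmap F (CE_prBS resB resH p q) x).
Proof.
rewrite -!fmap_comp -!homDE -!fmapD -[LHS]fmap_id.
by apply: fmap_eq => y; rewrite !homDE -CE_split.
Qed.

Lemma fmap_CE_cycle p q (x : FC p q) : bc_dv FC p q x = 0 ->
  fmap F (CE_prBS resB resH p q) x = 0.
Proof.
move=> x0; have := congr1 (fmap F (CE_prB resB resH p q.+1)) x0.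
by rewrite raddf0 => <-; rewrite -fmap_comp; exact: fmap_eq.
Qed.

(** [F] need not commute with cohomology, but it preserves the decomposition of the terms into
    factors, so the columns of [FC] have cohomology F (KH q p). The twist drops out, as it factors
    through [fmap F] of [CE_prBS], which is zero on vertical cocycles. *)
Lemma CE_page2 p q : iso (bc_page FC 2 p%:Z q%:Z) (cohomology (map_cochain F (KH q)) p).
Proof.
apply: (page2_iso (C := FC) (H := map_cochain F (KH q))
  (f := fun p => fmap F (CE_prH resB resH p q))) => {}p.
- case: q => [|q] x; first by move=> x0; have -> : x = 0 := x0; exact: raddf0.
  by move=> [y _ ->]; apply: fmap_comp0.
- move=> x /fmap_CE_cycle x0 xH.
  have {x0 xH}xE : x = fmap F (CE_inB resB resH p q) (fmap F (CE_prB resB resH p q) x).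
    by rewrite {1}[x]fmap_CE_split x0 xH !raddf0 !addr0.
  case: q x xE => [|q] x xE.
    rewrite xE (@fmap0 _ _ _ _ (CE_prB resB resH p 0)) => [|y]; last exact: KB0.
    by rewrite raddf0; exact: (submod0 (coboundary (bc_col FC p) 0)).
  exists (fmap F (CE_inBS resB resH p q) (fmap F (CE_prB resB resH p q.+1) x)) => //.
  by rewrite {1}xE; apply/esym/fmap_comp_eq.
- move=> h; exists (fmap F (CE_inH resB resH p q) h).
    by apply: fmap_comp0 => y; exact: raddf0.
  by rewrite -[RHS](@fmap_id _ F); apply: fmap_comp_eq.
move=> x /fmap_CE_cycle x0.
pose g : {linear KB q.+1 p -> KH q p.+1} :=
  CE_prH resB resH p.+1 q \o cc_d (CE_A resB resH q) p \o CE_inBS resB resH p q.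
pose g1 : {linear C p q -> KH q p.+1} := cc_d (KH q) p \o CE_prH resB resH p q.
pose g2 : {linear C p q -> KH q p.+1} := g \o CE_prBS resB resH p q.
have -> : fmap F (CE_prH resB resH p.+1 q) (bc_dh FC p q x) = fmap F (g1 + g2) x.
  by apply: fmap_comp_eq => y; rewrite homDE; exact: CE_prH_d.
have g20 : fmap F g2 x = 0 by rewrite fmap_comp x0; exact: raddf0.
by rewrite fmapD homDE g20 addr0; exact: fmap_comp.
Qed.

Lemma CE_tot_coh_iso (n : nat) : (forall q, injective_mod (A q)) ->
  iso (tot_coh FC n) (cohomology (map_cochain F A) n).
Proof.
move=> A_inj.
apply: (tot_coh_iso (C := FC) (A := map_cochain F A)
  (aug := fun q => fmap F (CE_Aaug resB resH q))).
- move=> q x; rewrite -!fmap_comp; apply: fmap_eq => y; exact: CE_aug_d.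
- move=> q; exact: fmap_aug_inj (A_inj q) (CE_A_resolution _ _ q).
- move=> q x; exact: fmap_exact0 (A_inj q) (CE_A_resolution _ _ q) x.
- move=> p q x; exact: fmap_exactS (A_inj q) (CE_A_resolution _ _ q) p x.
Qed.
End CEFunctor.

Section StandardCE.
Variables (R : comNzRingType) (A : cochain R).

(** The standard resolution would not do in degree 0: [inj_env] of the zero module is Hom_Z(R, Q/Z),
    which is not zero. *)
Definition std_B q : cochain R :=
  if q is q'.+1 then inj_res (smod (coboundary A q'.+1)) else zero_cochain R.

Definition std_Baug q : {linear smod (coboundary A q) -> std_B q 0%N} :=
  match q with 0 => \0 | q'.+1 => inj_res_aug (smod (coboundary A q'.+1)) end.

Lemma std_B_resolution q : is_inj_resolution (std_Baug q).
Proof.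
case: q => [|q]; last exact: inj_resP.
by apply: zero_resolution => x; apply: val_inj; exact: smodP x.
Qed.
End StandardCE.

(** Instead of taking injectives to F-acyclic modules, as in the classical statement, [G] keeps them
    injective, so that the rows split. The equivalence [t] turns the complex computing the derived
    functors of [H] into [map_cochain F A]. *)
Lemma grothendieck_ss_exists (R : comNzRingType) (F G H : functor R) (N : lmodType R)
    (t : forall A : lmodType R, {linear H A -> F (G A)}) :
  natural_equivalence (G := fcomp F G) t ->
  (forall J, injective_mod J -> injective_mod (G J)) ->
  exists E : spectral_sequence R,
    [/\ is_grothendieck_ss F G N E,
        forall p q : nat, iso (E 2%N p%:Z q%:Z)
          (right_derived F p (right_derived G q N)) &
        converges E (fun n => right_derived H n N)].
Proof.
move=> [t_bij t_nat] G_inj; pose A := map_cochain G (inj_res N).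
have A_inj q : injective_mod (A q) by apply: G_inj; exact: inj_env_injective.
pose resB := @std_B_resolution R A.
pose resH q := inj_resP (cohomology A q).
have KB0 p (x : std_B A 0 p) : x = 0 by exact: zero_mod_eq0.
exists (bicomplex_ss (map_bicomplex F (CE_bicomplex resB resH))); split.
- exists (CE_bicomplex resB resH), (CE_Aaug resB resH), (CE_aug_d resB resH).
  by split; [exact: CE_resolution|exact: bicomplex_ssP].
- by move=> p q; exact: CE_page2.
apply: tot_converges => n; apply: iso_trans (CE_tot_coh_iso F resB resH n A_inj) _.
apply: iso_sym; apply: (cohomology_iso (A := map_cochain H (inj_res N))
  (B := map_cochain F A) (f := fun n => t (inj_res N n))) => [m|m x].
  exact: t_bij.
exact: t_nat.
Qed.

Theorem theorem3p5 (R : comNzRingType) (R_noeth : noetherian_ring R)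
    (I : ideal R) (M : lmodType R) (M_fg : fin_gen_module M) (N : lmodType R) :
  let D := ideal_transform I in
  let DM := gen_ideal_transform I M in
  exists E : spectral_sequence R,
    [/\ [/\ exists theta : forall A : lmodType R,
              {linear DM A -> fcomp (homF M) D A},
              natural_equivalence theta,
            is_grothendieck_ss (homF M) D N E,
            forall p q : nat,
              iso (E 2%N p%:Z q%:Z) (Ext p M (right_derived D q N)) &
            converges E (fun n => right_derived DM n N)],
        forall t : nat,
          Ass (right_derived DM t N) `<=`
          (\bigcup_(i in [set i | (1 <= i <= t)%N]) Ass (E t.+2 i%:Z (t - i)%N%:Z))
          `|` Ass (homod M (right_derived D t N)) &
        forall t : nat,
          Supp (right_derived DM t N) `<=`
          \bigcup_(i in [set i | (i <= t)%N])
            Supp (Ext i M (right_derived D (t - i)%N N))].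
Proof.
move=> D DM.
have theta_nat : natural_equivalence (F := DM) (G := fcomp (homF M) D) (theta I M).
  split=> [A|A B f x]; last exact: theta_natural.
  by apply: bijP; [exact: theta_inj|exact: theta_surj].
have [E [E_groth E2 E_conv]] := grothendieck_ss_exists N theta_nat
  (fun J => @ideal_transform_injective R I J R_noeth).
exists E; split; first by split=> //; exists (theta I M).
  move=> t P DM_P; have [Phi [Phi0 _ Phin Phi_iso]] := E_conv t.
  have [i it iP] := Ass_filtration Phi0 Phin DM_P.
  (* On the diagonal of total degree [t], the page t + 2 is the first that [converges] identifies
     with the graded pieces. *)
  have EP : Ass (E t.+2 i%:Z (t - i)%N%:Z) P.
    apply: Ass_iso iP; apply/iso_sym/Phi_iso; first exact: subnKC.
    by rewrite subnKC // addn2.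
  (* The term of the second page at (0, t) is Ext^0, that is Hom; the other columns stay on the page
     t + 2. *)
  have [i0|i0] := posnP i; last by left; exists i => //=; rewrite i0.
  right; rewrite i0 subn0 in EP.
  by apply: Ass_iso (Ext0_iso _ _) _; apply: Ass_iso (E2 0%N t) _; exact: Ass_page0 EP.
move=> t P DM_P; have [Phi [Phi0 _ Phin Phi_iso]] := E_conv t.
have [i it iP] := Supp_filtration Phi0 Phin DM_P.
exists i => //; apply: Supp_iso (E2 i (t - i)%N) _; apply: (@Supp_page _ _ _ t.+2) => //.
apply: Supp_iso iP; apply/iso_sym/Phi_iso; first exact: subnKC.
by rewrite subnKC // addn2.
Qed.
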